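(* Let $n\ge 2$, let $K=K(t,x,u,u_1,\dots,u_n)$ be smooth with $\partial K/\partial u_n$ nowhere zero, and let $\Delta=u_t-K$. Let $\mathcal S=\sum_i s_i(t,x,u,u_1,\dots)D_x^i$ be a nonzero differential operator. Then $\mathcal S$ is a symplectic operator and $\Delta=0$ is a symplectic Hamiltonian system for $\mathcal S$ if and only if $\mathcal S$ is a variational operator for $\Delta$.
   Context: Write $u_0=u$, $u_1=u_x$, $u_i=\partial_x^i u$. $J^\infty(\mathbb R^2,\mathbb R)$ is the infinite jet space with coordinates $(t,x,u_{a,i})_{a,i\ge 0}$, where $u_{a,i}$ corresponds to $\partial_t^a\partial_x^i u$ (so $u_{0,i}=u_i$, $u_{1,0}=u_t$); $D_t,D_x$ are the total derivatives; the Euler operator is $\mathbf E(L)=\sum_{a,i}(-1)^{a+i}D_x^iD_t^a(\partial L/\partial u_{a,i})$. Smooth functions depend on finitely many coordinates. Variational operator: $\mathcal S=\sum_i s_i D_x^i$, with $s_i$ functions of $(t,x,u,u_1,\dots)$ only, is a variational operator for $\Delta$ if there is $L\in C^\infty(J^\infty(\mathbb R^2,\mathbb R))$ with $\mathcal S(\Delta)=\mathbf E(L)$ on $J^\infty(\mathbb R^2,\mathbb R)$. Symplectic operators: let $E=\mathbb R\times J^\infty(\mathbb R,\mathbb R)$ with coordinates $(t,x,u,u_1,u_2,\dots)$, $D_x=\partial_x+\sum_i u_{i+1}\partial_{u_i}$, $\theta^i_E=du_i-u_{i+1}dx$. An operator $\sum s_i(t,x,u,u_1,\dots)D_x^i$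 is regarded both as an operator on $E$ and on $J^\infty(\mathbb R^2,\mathbb R)$. $\Omega^{r,s}_{t_{sb}}(E)$ ($r=0,1$) is the space of forms that are finite sums of a function on $E$ times $dx$ ($r$ times) wedged with $s$ of the $\theta^i_E$. $D_x$ acts on these forms as a derivation with $D_x(dx)=0$, $D_x(\theta^i_E)=\theta^{i+1}_E$; $d^E_H\omega=dx\wedge D_x(\omega)$; $d^E_V$ is the anti-derivation with $d^E_Vf=\sum_i(\partial f/\partial u_i)\theta^i_E$, $d_V^E(dx)=0$, $d^E_V\theta^i_E=0$. For $\Sigma\in\Omega^{1,s}_{t_{sb}}(E)$, $s\ge1$, $I_E(\Sigma)=\frac1s\theta^0_E\wedge\sum_i(-D_x)^i(\partial_{u_i}\lrcorner\,\Sigma)$, and $\delta^E_V=I_E\circ d^E_V$. A differential operator $\mathcal S=\sum s_iD_x^i$ is symplectic if it is skew-adjoint ($\mathcal S^*=-\mathcal S$ where $\mathcal S^*(f)=\sum(-D_x)^i(s_if)$), and $\Sigma=dx\wedge\theta^0_E\wedge\sum_i s_i\theta^i_E$ satisfies $\Sigma\ne0$ and $\delta^E_V\Sigma=0$. $\Delta=0$ is a symplectic Hamiltonian system for $\mathcal S$ if, with $Y=\mathrm{pr}(K\partial_u)=\sum_i D_x^i(K)\partial_{u_i}$ and $T=\partial_t+Y$, one has $I_E\circ\pi^{1,2}\circ\mathcal L_T\Sigma=0$, where $\mathcal L_T$ is the Lie derivative and $\pi^{1,2}$ is the projection onto $\Omega^{1,2}_{t_{sb}}(E)$ obtained by writing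 a form in the coframe $dt,dx,\theta^i_E$ and keeping only the $dx\wedge\theta^i_E\wedge\theta^j_E$ terms. *)

(* Defs.v *)
From HB Require Import structures.
From mathcomp Require Import all_boot all_order all_algebra.
From mathcomp Require Import all_classical all_reals all_analysis.

Set Implicit Arguments.
Unset Strict Implicit.
Unset Printing Implicit Defensive.

Import Order.TTheory GRing.Theory Num.Theory.
Import numFieldNormedType.Exports.

Local Open Scope classical_set_scope.
Local Open Scope ring_scope.

(* Sums \sum_(i \in [set: I]) F i over an infinite type I are finitely
   supported sums: in each use below only finitely many terms are nonzero. *)

(* Coordinates t, x and u_a, a : A. The jet space J^oo(R^2, R) has
   A = nat * nat, with cu (a, i) standing for u_{a,i}; the space
   E = R x J^oo(R, R) has A = nat, with cu i standing for u_i. *)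
Inductive jcoord (A : Type) : Type := ct | cx | cu of A.
Arguments ct {A}.
Arguments cx {A}.

Definition jcoord_code (A : Type) (c : jcoord A) : option (option A) :=
  match c with ct => None | cx => Some None | cu a => Some (Some a) end.
Definition jcoord_decode (A : Type) (o : option (option A)) : jcoord A :=
  match o with None => ct | Some None => cx | Some (Some a) => cu a end.
Lemma jcoord_codeK (A : Type) : cancel (@jcoord_code A) (@jcoord_decode A).
Proof. by case. Qed.
HB.instance Definition _ (A : choiceType) :=
  Choice.copy (jcoord A) (can_type (@jcoord_codeK A)).

Section Calculus.
Variables (R : realType) (A : choiceType).
Implicit Types (f : (jcoord A -> R) -> R) (p : jcoord A -> R).

Definition partial (c : jcoord A) f : (jcoord A -> R) -> R :=
  fun p => derive1 (fun r : R => f (dfwith p c r)) (p c).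

Definition has_partial (c : jcoord A) f :=
  forall p, derivable (fun r : R => f (dfwith p c r)) (p c) 1.

Definition depends_on (cs : seq (jcoord A)) f :=
  forall p q, {in cs, p =1 q} -> f p = f q.

(* For a function of finitely many coordinates, continuity for the product
   topology is continuity in those coordinates. *)
Definition smooth f :=
  (exists cs, depends_on cs f) /\
  forall l : seq (jcoord A),
    continuous (foldr partial f l : {ptws jcoord A -> R} -> R) /\
    forall c, has_partial c (foldr partial f l).

(* X c is the coefficient of the coordinate vector field d/dc. *)
Definition vfield := jcoord A -> (jcoord A -> R) -> R.

Definition vact (X : vfield) f : (jcoord A -> R) -> R :=
  fun p => \sum_(c \in [set: jcoord A]) X c p * partial c f p.

End Calculus.

Section Jets.
Variable R : realType.

Definition jet := jcoord (nat * nat) -> R.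
Definition jfun := jet -> R.
Definition espace := jcoord nat -> R.
Definition efun := espace -> R.

Definition jDx : jfun -> jfun := vact (fun c (p : jet) =>
  match c with ct => 0 | cx => 1 | cu (a, i) => p (cu (a, i.+1)) end).
Definition jDt : jfun -> jfun := vact (fun c (p : jet) =>
  match c with ct => 1 | cx => 0 | cu (a, i) => p (cu (a.+1, i)) end).

Definition euler (L : jfun) : jfun := fun p =>
  \sum_(ai \in [set: nat * nat])
    (-1) ^+ (ai.1 + ai.2) *
    iter ai.2 jDx (iter ai.1 jDt (partial (cu ai) L)) p.

Definition eDx_field : vfield R nat := fun c (p : espace) =>
  match c with ct => 0 | cx => 1 | cu i => p (cu i.+1) end.
Definition eDx : efun -> efun := vact eDx_field.

(* The projection J^oo(R^2, R) -> E, along which functions on E are regarded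
   as functions on J^oo(R^2, R). *)
Definition res (p : jet) : espace := fun c =>
  match c with ct => p ct | cx => p cx | cu i => p (cu (0%N, i)) end.

Definition evolution (K : efun) : jfun :=
  fun p => p (cu (1%N, 0%N)) - K (res p).

(* The family s is the operator \sum_i s i * D_x^i. *)
Definition diffop (s : nat -> efun) :=
  (forall i, smooth (s i)) /\
  exists m, forall i, (m < i)%N -> forall p, s i p = 0.

Definition op_jet (s : nat -> efun) (f : jfun) : jfun := fun p =>
  \sum_(i \in [set: nat]) s i (res p) * iter i jDx f p.
Definition op_e (s : nat -> efun) (f : efun) : efun := fun p =>
  \sum_(i \in [set: nat]) s i p * iter i eDx f p.
Definition adjoint_op (s : nat -> efun) (f : efun) : efun := fun p =>
  \sum_(i \in [set: nat])
    iter i (fun g q => - eDx g q) (fun q => s i q * f q) p.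

Definition skew_adjoint (s : nat -> efun) :=
  forall f : efun, smooth f -> forall p, adjoint_op s f p = - op_e s f p.

Definition variational_operator (s : nat -> efun) (D : jfun) :=
  exists L : jfun, smooth L /\ forall p, op_jet s D p = euler L p.

End Jets.

(* The coframe dt, dx, theta^i = du_i - u_{i+1} dx of E, whose dual frame is
   d/dt, D_x, d/du_i. *)
Inductive coframe : Type := dt | dx | theta of nat.

Definition coframe_code (c : coframe) : option (option nat) :=
  match c with dt => None | dx => Some None | theta i => Some (Some i) end.
Definition coframe_decode (o : option (option nat)) : coframe :=
  match o with None => dt | Some None => dx | Some (Some i) => theta i end.
Lemma coframe_codeK : cancel coframe_code coframe_decode.
Proof. by case. Qed.
HB.instance Definition _ := Choice.copy coframe (can_type coframe_codeK).

Section Forms.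
Variable R : realType.

(* A differential form on E is given by its (alternating) coefficients in the
   coframe: w [:: c_1; ...; c_k] is the value of its degree k part on the dual
   frame vectors of c_1, ..., c_k, so that this part is
   1/k! \sum w [:: c_1; ...; c_k] c_1 /\ ... /\ c_k. *)
Definition form := seq coframe -> efun R.

Definition form_eq0 (w : form) := forall cs p, w cs p = 0.

Definition form1 : form := fun cs _ => (cs == [::])%:R.

(* c /\ w, evaluated on the dual frame: cs loses its j-th entry. *)
Definition wedge (c : coframe) (w : form) : form := fun cs p =>
  \sum_(j < size cs | nth dt cs j == c)
    (-1) ^+ j * w (take j cs ++ drop j.+1 cs) p.

(* d/du_i is the dual frame vector of theta i. *)
Definition contract_u (i : nat) (w : form) : form :=
  fun cs => w (theta i :: cs).

(* c(X); note that X is given by its components in the coordinates t, x, u_i. *)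
Definition pairing (c : coframe) (X : vfield R nat) : efun R := fun p =>
  match c with
  | dt => X ct p
  | dx => X cx p
  | theta i => X (cu i) p - p (cu i.+1) * X cx p
  end.

Definition contract (X : vfield R nat) (w : form) : form := fun cs p =>
  pairing dt X p * w (dt :: cs) p + pairing dx X p * w (dx :: cs) p +
  \sum_(i \in [set: nat]) pairing (theta i) X p * w (theta i :: cs) p.

(* The derivation with D_x(f) the total derivative, D_x(dx) = 0 and
   D_x(theta^i) = theta^{i+1}: the second term is the algebraic derivation
   extending theta^i |-> theta^{i+1}. It is extended to all forms on E by
   D_x(dt) = 0. *)
Definition fDx (w : form) : form := fun cs p =>
  eDx (w cs) p +
  \sum_(i \in [set: nat]) wedge (theta i.+1) (contract_u i w) cs p.

Definition dH (w : form) : form := wedge dx (fDx w).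

(* On w = f c_1 /\ ... /\ c_k this is
   (\sum_i df/du_i theta^i) /\ c_1 /\ ... /\ c_k. *)
Definition dV (w : form) : form := fun cs p =>
  \sum_(i \in [set: nat])
    wedge (theta i) (fun cs' => partial (cu i) (w cs')) cs p.

(* The exterior derivative of E: it maps a function f to
   f_t dt + D_x(f) dx + \sum_i df/du_i theta^i, kills dt and dx, and maps
   theta^i = du_i - u_{i+1} dx to - du_{i+1} /\ dx = dx /\ theta^{i+1}. *)
Definition dE (w : form) : form := fun cs p =>
  wedge dt (fun cs' => partial ct (w cs')) cs p + dH w cs p + dV w cs p.

(* Flows need not exist on E; the Lie derivative is given by Cartan's
   formula. *)
Definition lie (X : vfield R nat) (w : form) : form := fun cs p =>
  dE (contract X w) cs p + contract X (dE w) cs p.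

Definition proj_rs (r s : nat) (w : form) : form := fun cs p =>
  if [&& size cs == (r + s)%N, count_mem dt cs == 0%N & count_mem dx cs == r]
  then w cs p else 0.

(* s is the vertical degree of w, which must have type (1, s). *)
Definition IE (s : nat) (w : form) : form := fun cs p =>
  s%:R^-1 * wedge (theta 0) (fun cs' q =>
    \sum_(i \in [set: nat])
      iter i (fun v cs'' q' => - fDx v cs'' q') (contract_u i w) cs' q) cs p.

Definition deltaV (s : nat) (w : form) : form := IE s.+1 (dV w).

(* dx /\ theta^0 /\ \sum_i s_i theta^i *)
Definition Sigma (s : nat -> efun R) : form :=
  wedge dx (wedge (theta 0) (fun cs p =>
    \sum_(i \in [set: nat]) s i p * wedge (theta i) form1 cs p)).

Definition symplectic (s : nat -> efun R) :=
  [/\ skew_adjoint s, ~ form_eq0 (Sigma s) & form_eq0 (deltaV 2 (Sigma s))].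

(* T = d/dt + pr (K d/du) *)
Definition T_field (K : efun R) : vfield R nat := fun c =>
  match c with
  | ct => fun _ => 1
  | cx => fun _ => 0
  | cu i => iter i (@eDx R) K
  end.

Definition symplectic_hamiltonian (K : efun R) (s : nat -> efun R) :=
  form_eq0 (IE 2 (proj_rs 1 2 (lie (T_field K) (Sigma s)))).

End Forms.

(* Main.v *)
From HB Require Import structures.
Require Import Defs.
From mathcomp Require Import all_boot all_order all_algebra.
From mathcomp Require Import all_classical all_reals all_analysis.
From mathcomp Require Import ring zify.
Set Implicit Arguments.
Unset Strict Implicit.
Unset Printing Implicit Defensive.
Require Import Defs.
Import Order.TTheory GRing.Theory Num.Theory.
Import numFieldNormedType.Exports.
Local Open Scope classical_set_scope.
Local Open Scope ring_scope.

(** Put F = S(u_t - K). A function on the jet space is an Euler-Lagrange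
    expression exactly when its linearization
    $\sum_{a,i} (\partial F/\partial u_{a,i}) D_t^a D_x^i$ is formally self-adjoint.
    Self-adjointness is necessary because second partial derivatives are symmetric
    ([adjoint2_euler]); it is sufficient because the Lagrangian
    $u \int_0^1 F(\lambda u)\,d\lambda$ then has F as its Euler-Lagrange expression
    ([homotopy_lagrangian]).

    Now F is $\sum_i s_i u_{1,i} - S(K)$, affine in the coordinates u_{1,i}, with
    coefficients that live on E. So the linearization has order one in D_t, and
    the difference with its adjoint splits according to the power of D_t and to
    the coordinates u_{1,i}, which are independent of E. Three equations on E
    result ([adjoint2_sourceP]): the coefficient of D_t says that S is
    skew-adjoint; the part of order zero that is linear in the u_{1,i} is an
    equation on the derivatives of S alone ([closure_arr]); the rest says that the
    time derivative of S is minus the linearization of S(K) plus its adjoint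
    ([hamiltonian_arr]).

    On the side of forms, write E(w) for
    $\sum_i (-D_x)^i(\partial_{u_i} \lrcorner w)$. Since E annihilates the image of
    D_x, integration by parts gives E(theta^0 /\ E(w)) = r E(w) for a form w of
    vertical degree r ([Eform_awedge0]), so I_E(w) = 0 means E(w) = 0, and E(w) is
    computed like a formal adjoint. For skew-adjoint S, the form E(d_V Sigma) is
    twice the second equation ([Eul_dsigma]). By Cartan's formula the
    (1,2)-part of the Lie derivative of Sigma along T consists of
    d_V(T contracted with Sigma), T contracted with d_V Sigma, and the time
    derivative of the coefficients. Under the second equation E annihilates the
    middle term, and the others contribute twice the third equation ([Eul_rho]).
    Hence both sides of the equivalence are the same three equations
    ([symplectic_hamiltonianP]).

    In all of these computations an operator $\sum_i a_i D^i$, or a multilinear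
    one, is the array of its coefficients, over the ring of smooth functions. The
    analysis enters through two facts: partial derivatives commute ([partialC]),
    and the homotopy integral is smooth, which rests on a Taylor estimate that is
    uniform on boxes ([smooth_Taylor]). *)

(** * Partial derivatives and smooth functions *)

Section Partials.
Variables (R : realType) (A : choiceType).
Implicit Types (f g : (jcoord A -> R) -> R) (p q : jcoord A -> R) (c d : jcoord A).

Lemma dfwithK c p (r r' : R) :
  dfwith (dfwith p c r) c r' = dfwith p c r' :> (jcoord A -> R).
Proof.
apply/funext => d; have [<-|cd] := eqVneq c d; first by rewrite !dfwithin.
by rewrite !dfwithout.
Qed.

Lemma dfwith_id c p : dfwith p c (p c) = p :> (jcoord A -> R).
Proof.
apply/funext => d; have [<-|cd] := eqVneq c d; first by rewrite dfwithin.
by rewrite dfwithout.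
Qed.

Lemma has_partial_is_derive c f p (r : R) : has_partial c f ->
  is_derive r 1 (fun r => f (dfwith p c r)) (partial c f (dfwith p c r)).
Proof.
move=> /(_ (dfwith p c r)); rewrite /partial dfwithin.
under eq_fun do rewrite dfwithK.
by move=> h; apply: DeriveDef => //; rewrite derive1E.
Qed.

Lemma partialP c f p (v : R) :
  is_derive (p c) 1 (fun r => f (dfwith p c r)) v -> partial c f p = v.
Proof. by move=> h; rewrite /partial derive1E; exact: derive_val. Qed.

Lemma has_partial_of c f (v : (jcoord A -> R) -> R) :
  (forall p, is_derive (p c) 1 (fun r => f (dfwith p c r)) (v p)) ->
  has_partial c f /\ partial c f = v.
Proof.
move=> h; split; first by move=> p; have [] := h p.
by apply/funext => p; exact: partialP.
Qed.

Lemma is_derive_partial c f p : has_partial c f ->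
  is_derive (p c) 1 (fun r => f (dfwith p c r)) (partial c f p).
Proof.
by move=> /(@has_partial_is_derive c f p (p c)); rewrite dfwith_id.
Qed.

Lemma has_partialD c f g : has_partial c f -> has_partial c g ->
  has_partial c (f \+ g) /\ partial c (f \+ g) = partial c f \+ partial c g.
Proof.
move=> hf hg; apply: has_partial_of => p /=.
have := is_derive_partial p hf; have := is_derive_partial p hg => ? ?.
exact: is_deriveD.
Qed.

Lemma has_partialN c f : has_partial c f ->
  has_partial c (\- f) /\ partial c (\- f) = \- partial c f.
Proof.
move=> hf; apply: has_partial_of => p /=.
have := is_derive_partial p hf => ?; exact: is_deriveN.
Qed.

Lemma has_partialM c f g : has_partial c f -> has_partial c g ->
  has_partial c (f \* g) /\
  partial c (f \* g) = (partial c f \* g) \+ (f \* partial c g).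
Proof.
move=> hf hg; apply: has_partial_of => p /=.
have := is_derive_partial p hf; have := is_derive_partial p hg => ? ?.
have := is_deriveM (f := fun r => f (dfwith p c r)) (g := fun r => g (dfwith p c r))
  (x := p c) (v := 1 : R).
move=> /(_ _ _ _ _) h; apply: is_derive_eq.
by rewrite dfwith_id addrC; congr (_ + _); rewrite /GRing.scale /= mulrC.
Qed.

Lemma has_partial_cst c (r : R) :
  has_partial c (fun _ : jcoord A -> R => r) /\
  partial c (fun _ : jcoord A -> R => r) = fun=> 0.
Proof. by apply: has_partial_of => p /=; exact: is_derive_cst. Qed.

Lemma has_partial_coord c d :
  has_partial c (fun p => p d) /\ partial c (fun p => p d) = fun=> (c == d)%:R.
Proof.
apply: has_partial_of => p /=; have [<-|cd] := eqVneq c d.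
  by under eq_fun do rewrite dfwithin; exact: is_derive_id.
by under eq_fun do rewrite dfwithout//; exact: is_derive_cst.
Qed.

Lemma depends_on_partial0 cs f c : depends_on cs f -> c \notin cs ->
  partial c f = fun=> 0.
Proof.
move=> fcs ccs; apply/funext => p; apply: partialP.
have -> : (fun r => f (dfwith p c r)) = cst (f p).
  apply/funext => r; apply: fcs => d dcs; rewrite dfwithout//.
  by apply: contraNneq ccs => ->.
exact: is_derive_cst.
Qed.

Lemma depends_on_partial cs f c : depends_on cs f ->
  depends_on cs (partial c f).
Proof.
move=> fcs; have [ccs|/(depends_on_partial0 fcs)->//] := boolP (c \in cs).
move=> p q pq; rewrite /partial (pq c ccs); congr (derive1 _ _).
apply/funext => r; apply: fcs => d dcs.
have [<-|cd] := eqVneq c d; first by rewrite !dfwithin.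
by rewrite !dfwithout// pq.
Qed.

Lemma depends_on_sub cs cs' f : {subset cs <= cs'} -> depends_on cs f ->
  depends_on cs' f.
Proof. by move=> s fcs p q pq; apply: fcs => d /s; exact: pq. Qed.

Lemma smooth_depends f : smooth f -> exists2 cs, uniq cs & depends_on cs f.
Proof.
move=> [[cs fcs] _]; exists (undup cs); first exact: undup_uniq.
by apply: depends_on_sub fcs => c; rewrite mem_undup.
Qed.

Lemma smooth_continuous f : smooth f ->
  continuous (f : {ptws jcoord A -> R} -> R).
Proof. by case=> _ /(_ [::]) []. Qed.

Lemma smooth_has_partial f c : smooth f -> has_partial c f.
Proof. by case=> _ /(_ [::]) [_]. Qed.

Lemma smooth_partial f c : smooth f -> smooth (partial c f).
Proof.
case=> [[cs fcs]] h; split; first by exists cs; exact: depends_on_partial.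
by move=> l; have := h (rcons l c); rewrite foldr_rcons.
Qed.

(** Smoothness is the largest class of continuous functions of finitely many
    coordinates that is stable under partial derivatives; closure properties
    are proved by exhibiting a stable class, so that no formula for iterated
    derivatives is needed. *)
Lemma smooth_coind (P : ((jcoord A -> R) -> R) -> Prop) :
  (forall f, P f -> [/\ exists cs, depends_on cs f,
     continuous (f : {ptws jcoord A -> R} -> R) &
     forall c, has_partial c f /\ P (partial c f)]) ->
  forall f, P f -> smooth f.
Proof.
move=> hP f Pf; split; first by have [] := hP f Pf.
move=> l; have Pl : P (foldr (@partial R A) f l).
  by elim: l => //= c l /hP[_ _ /(_ c)[]].
by have [_ ? h] := hP _ Pl; split=> // c; have [] := h c.
Qed.

Lemma smooth_cst (r : R) : smooth (fun _ : jcoord A -> R => r).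
Proof.
apply: (@smooth_coind (fun f => exists r, f = fun=> r)) => [f [{}r ->]|];
  last by exists r.
split; [by exists [::]|exact: cst_continuous|move=> c].
by have [? ->] := has_partial_cst c r; split=> //; exists 0.
Qed.

Lemma smooth_coord c : smooth (fun p : jcoord A -> R => p c).
Proof.
apply: (@smooth_coind (fun f => (f = fun p => p c) \/ exists r, f = fun=> r)) => [f|];
  last by left.
case=> [->|[r ->]].
  split; first by exists [:: c] => p q; apply; rewrite mem_seq1.
    exact: (@proj_continuous (jcoord A) (fun=> R) c).
  by move=> d; have [? ->] := has_partial_coord d c; split=> //; right; eexists.
split; [by exists [::]|exact: cst_continuous|move=> d].
by have [? ->] := has_partial_cst d r; split=> //; right; exists 0.
Qed.

(** The Leibniz rule turns a product into a sum of products, so that sums and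
    products have to be generated together to obtain a class that is stable
    under partial derivatives. *)
Inductive smooth_alg : ((jcoord A -> R) -> R) -> Prop :=
| smooth_alg_base f : smooth f -> smooth_alg f
| smooth_algD f g : smooth_alg f -> smooth_alg g -> smooth_alg (f \+ g)
| smooth_algM f g : smooth_alg f -> smooth_alg g -> smooth_alg (f \* g).

Lemma smooth_algE f : smooth_alg f -> smooth f.
Proof.
move: f; apply: smooth_coind => f; elim=> {f} [f sf|f g|f g].
- split; [by case: sf|exact: smooth_continuous|move=> c].
  split; first exact: smooth_has_partial.
  exact/smooth_alg_base/smooth_partial.
- move=> _ [[cs fcs] fc fp] _ [[cs' gcs] gc gp]; split.
  + exists (cs ++ cs') => p q pq /=.
    by rewrite (fcs p q) ?(gcs p q)// => d dc; apply: pq; rewrite mem_cat dc ?orbT.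
  + move=> p.
    have h := @cvgD R R _ (nbhs (p : {ptws jcoord A -> R})) _ f g _ _ (fc p) (gc p).
    exact: h.
  + move=> c; have [f1 f2] := fp c; have [g1 g2] := gp c.
    have [? ->] := has_partialD f1 g1; split=> //; exact: smooth_algD.
- move=> fa [[cs fcs] fc fp] ga [[cs' gcs] gc gp]; split.
  + exists (cs ++ cs') => p q pq /=.
    by rewrite (fcs p q) ?(gcs p q)// => d dc; apply: pq; rewrite mem_cat dc ?orbT.
  + move=> p.
    have h := @cvgM R _ (nbhs (p : {ptws jcoord A -> R})) _ f g _ _ (fc p) (gc p).
    exact: h.
  + move=> c; have [f1 f2] := fp c; have [g1 g2] := gp c.
    have [? ->] := has_partialM f1 g1; split=> //.
    by apply: smooth_algD; apply: smooth_algM.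
Qed.

Lemma smoothD f g : smooth f -> smooth g -> smooth (f \+ g).
Proof.
by move=> sf sg; apply/smooth_algE/smooth_algD; exact: smooth_alg_base.
Qed.

Lemma smoothM f g : smooth f -> smooth g -> smooth (f \* g).
Proof.
by move=> sf sg; apply/smooth_algE/smooth_algM; exact: smooth_alg_base.
Qed.

Lemma smoothN f : smooth f -> smooth (\- f).
Proof.
move=> sf; have -> : \- f = (fun=> -1) \* f by apply/funext => p /=; rewrite mulN1r.
by apply: smoothM => //; exact: smooth_cst.
Qed.

End Partials.

Arguments smooth_has_partial {R A f} c _ p.
Arguments has_partial_coord {R A} c d.

(** * Taylor estimates on boxes *)

Section Taylor.
Variables (R : realType) (A : choiceType).
Implicit Types (f g : (jcoord A -> R) -> R) (p q B : jcoord A -> R) (c d : jcoord A).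

Definition in_box B p := forall c, `|p c| <= B c.
Definition between p q x :=
  forall c : jcoord A, (Num.min (p c) (q c) <= x c <= Num.max (p c) (q c))%R.
Definition dist1 (cs : seq (jcoord A)) p q : R := \sum_(c <- cs) `|q c - p c|.

Lemma dist1_ge0 cs p q : 0 <= dist1 cs p q.
Proof. by apply: sumr_ge0 => c _. Qed.

(** A box is compact for the product topology by Tychonoff's theorem, even with
    infinitely many coordinates, so boundedness is immediate. *)
Lemma smooth_bounded_box f B : smooth f ->
  exists2 M, 0 <= M & forall p, in_box B p -> `|f p| <= M.
Proof.
move=> /smooth_continuous fc.
have cB : compact ([set p | forall c, `[- B c, B c]%classic (p c)] :
    set {ptws jcoord A -> R}).
  have h := @tychonoff (jcoord A) (fun=> R) (fun c => `[- B c, B c]%classic)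
    (fun c => @segment_compact _ _ _). exact h.
have /compact_bounded[M [_ hM]] : compact (f @` [set p | forall c, `[- B c, B c]%classic (p c)]).
  apply: continuous_compact cB; exact: continuous_subspaceT.
exists (`|M| + 1) => [|p pB]; first by rewrite addr_ge0.
apply: (hM (`|M| + 1)); first by rewrite (le_lt_trans (ler_norm M))// ltrDl.
exists p => // c; rewrite /= in_itv /=.
by have := pB c; rewrite ler_norml.
Qed.

Lemma smooth_partials_bounded_box f B (cs : seq (jcoord A)) : smooth f ->
  exists2 M, 0 <= M &
    forall c p, c \in cs -> in_box B p -> `|partial c f p| <= M.
Proof.
move=> sf; elim: cs => [|c cs [M M0 hM]]; first by exists 0.
have [N N0 hN] := smooth_bounded_box B (smooth_partial c sf).
exists (M + N) => [|d p]; first exact: addr_ge0.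
rewrite inE => /predU1P[->|dcs] pB.
  by rewrite (le_trans (hN _ pB))// lerDr.
by rewrite (le_trans (hM _ _ dcs pB))// lerDl.
Qed.

Lemma has_partial_continuous c f p : has_partial c f ->
  continuous (fun r => f (dfwith p c r)).
Proof.
move=> hf r; apply/differentiable_continuous/derivable1_diffP.
by have [] := has_partial_is_derive p r hf.
Qed.

Lemma has_partial_MVT c f p (r r' : R) : has_partial c f ->
  exists2 x, Num.min r r' <= x <= Num.max r r' &
  f (dfwith p c r') - f (dfwith p c r) = partial c f (dfwith p c x) * (r' - r).
Proof.
move=> hf; wlog rr' : r r' / r <= r'.
  move=> h; have /orP[rr'|rr'] := le_total r r'; first exact: h.
  have [x xr e] := h _ _ rr'; exists x; [by rewrite minC maxC | by rewrite -opprB e -mulrN opprB].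
have [|x xr e] := @MVT_segment R (fun r => f (dfwith p c r))
    (fun r => partial c f (dfwith p c r)) r r' rr' (fun x _ => has_partial_is_derive p x hf).
  exact/continuous_subspaceT/has_partial_continuous.
by exists x => //; rewrite min_l// max_r//; move: xr; rewrite in_itv.
Qed.

Lemma between_box B p q x : in_box B p -> in_box B q -> between p q x ->
  in_box B x.
Proof.
move=> pB qB xpq c; have /andP[h1 h2] := xpq c.
have := pB c; have := qB c; rewrite !ler_norml => /andP[q1 q2] /andP[p1 p2].
apply/andP; split; first by apply: le_trans h1; rewrite le_min p1 q1.
by apply: (le_trans h2); rewrite ge_max p2 q2.
Qed.

Lemma between_dist1 cs p q x : between p q x -> dist1 cs p x <= dist1 cs p q.
Proof.
move=> xpq; apply: ler_sum => c _; have /andP[] := xpq c.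
have [pq|/ltW pq] := leP (p c) (q c) => h1 h2.
  by rewrite !ger0_norm ?subr_ge0// lerD2r.
by rewrite !ler0_norm ?subr_le0// lerN2 lerD2r.
Qed.

(** One coordinate is changed at a time, and the one-variable mean value
    theorem is applied to each change. *)
Lemma mean_value cs f p q : uniq cs -> smooth f -> depends_on cs f ->
  exists X : jcoord A -> jcoord A -> R, (forall c, between p q (X c)) /\
  f q - f p = \sum_(c <- cs) partial c f (X c) * (q c - p c).
Proof.
move=> ucs sf fcs.
pose mix (l : seq (jcoord A)) : jcoord A -> R := fun c => if c \in l then q c else p c.
have -> : f q = f (mix cs) by apply: fcs => c ccs; rewrite /mix ccs.
have bpp c : Num.min (p c) (q c) <= p c <= Num.max (p c) (q c).
  by rewrite ge_min le_max lexx.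
have bpq c : Num.min (p c) (q c) <= q c <= Num.max (p c) (q c).
  by rewrite ge_min le_max lexx !orbT.
elim: cs ucs {fcs} => [_|c cs IH /= /andP[ccs ucs]].
  by exists (fun=> p); split=> //; rewrite big_nil subrr.
have [X [bX eX]] := IH ucs.
have [x xpq e] := has_partial_MVT (mix cs) (p c) (q c) (@smooth_has_partial _ _ f c sf).
exists (fun d => if d == c then dfwith (mix cs) c x else X d); split.
  move=> d; case: eqP => // _ d'; have [<-|cd'] := eqVneq c d'.
    by rewrite dfwithin.
  by rewrite dfwithout// /mix; case: ifP.
rewrite big_cons eqxx -e; have -> : mix (c :: cs) = dfwith (mix cs) c (q c).
  apply/funext => d; rewrite /mix inE; have [->|dc] := eqVneq d c.
    by rewrite dfwithin.
  by rewrite dfwithout// eq_sym.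
have -> : dfwith (mix cs) c (p c) = mix cs.
  by rewrite -[RHS](dfwith_id c) /mix (negPf ccs).
rewrite -[LHS](subrKA (f (mix cs))) eX; congr (_ + _).
apply: eq_big_seq => d dcs; case: eqP => // dc.
by move: ccs; rewrite -dc dcs.
Qed.

Lemma smooth_Lipschitz f B cs : uniq cs -> smooth f -> depends_on cs f ->
  exists2 M, 0 <= M & forall p q, in_box B p -> in_box B q ->
    `|f q - f p| <= M * dist1 cs p q.
Proof.
move=> ucs sf fcs; have [M M0 hM] := smooth_partials_bounded_box B cs sf.
exists M => // p q pB qB; have [X [bX ->]] := mean_value p q ucs sf fcs.
rewrite (le_trans (ler_norm_sum _ _ _))// mulr_sumr big_seq [X in _ <= X]big_seq.
apply: ler_sum => c ccs; rewrite normrM ler_wpM2r//.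
exact/hM/(between_box pB qB).
Qed.

Lemma smooth_Lipschitz_partials f B cs (l : seq (jcoord A)) : uniq cs -> smooth f -> depends_on cs f ->
  exists2 M, 0 <= M & forall c p q, c \in l -> in_box B p -> in_box B q ->
    `|partial c f q - partial c f p| <= M * dist1 cs p q.
Proof.
move=> ucs sf fcs; elim: l => [|c l [M M0 hM]]; first by exists 0.
have [N N0 hN] :=
  smooth_Lipschitz B ucs (smooth_partial c sf) (depends_on_partial c fcs).
exists (M + N) => [|d p q]; first exact: addr_ge0.
rewrite inE => /predU1P[->|dl] pB qB.
  by rewrite (le_trans (hN _ _ pB qB))// ler_wpM2r ?dist1_ge0// lerDr.
by rewrite (le_trans (hM _ _ _ dl pB qB))// ler_wpM2r ?dist1_ge0// lerDl.
Qed.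

(** The quadratic error bound is uniform on a box. This uniformity is what makes
    differentiation under an integral sign elementary below. *)
Lemma smooth_Taylor f B cs : uniq cs -> smooth f -> depends_on cs f ->
  exists2 M, 0 <= M & forall p q, in_box B p -> in_box B q ->
    `|f q - f p - \sum_(c <- cs) partial c f p * (q c - p c)|
      <= M * dist1 cs p q ^+ 2.
Proof.
move=> ucs sf fcs.
have [M M0 hM] := smooth_Lipschitz_partials B cs ucs sf fcs.
exists M => // p q pB qB; have [X [bX ->]] := mean_value p q ucs sf fcs.
rewrite -sumrB (le_trans (ler_norm_sum _ _ _))//.
rewrite expr2 mulrA [X in _ <= _ * X]/dist1 mulr_sumr big_seq [X in _ <= X]big_seq.
apply: ler_sum => c ccs; rewrite -mulrBl normrM ler_wpM2r//.
rewrite (le_trans (hM _ _ _ ccs pB (between_box pB qB (bX c))))//.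
by rewrite ler_wpM2l// between_dist1.
Qed.

End Taylor.

Section LocallyLipschitz.
Variables (R : realType) (A : choiceType).
Implicit Types (g : (jcoord A -> R) -> R) (p q : jcoord A -> R).

Lemma near_coords (cs : seq (jcoord A)) p (d : R) : 0 < d ->
  \forall q \near (p : {ptws jcoord A -> R}), forall c, c \in cs -> `|q c - p c| <= d.
Proof.
have FF : Filter (nbhs (p : {ptws jcoord A -> R})) by exact: nbhs_filter.
move=> d0; elim: cs => [|c cs IH]; first by apply: (@filterE _ _ FF) => q c.
have h := @proj_continuous (jcoord A) (fun=> R) c p.
have {}h : \forall q \near (p : {ptws jcoord A -> R}), `|q c - p c| <= d.
  move/(@cvgrPdist_le R R _ _ FF) : h => /(_ _ d0) h.
  by apply: (@filterS _ _ FF _ _ _ h) => q; rewrite distrC.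
apply: (@filterS2 _ _ FF _ _ _ _ IH h) => q h1 h2 b; rewrite inE => /predU1P[->//|]; exact: h1.
Qed.

(** Integrals over a parameter inherit Lipschitz bounds from the integrand; this
    turns such bounds into continuity for the product topology. *)
Lemma locally_Lipschitz_continuous g (cs : seq (jcoord A)) : depends_on cs g ->
  (forall p, exists2 M, 0 <= M & forall q, (forall c, `|q c - p c| <= 1) ->
    `|g q - g p| <= M * dist1 cs p q) ->
  continuous (g : {ptws jcoord A -> R} -> R).
Proof.
move=> gcs h p; have [M M0 hM] := h p.
have FF : Filter (nbhs (p : {ptws jcoord A -> R})) by exact: nbhs_filter.
apply/(@cvgrPdist_le R R _ _ FF) => e e0.
pose K := M * (size cs)%:R + 1.
have K0 : 0 < K by rewrite ltr_wpDl// mulr_ge0.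
have d0 : 0 < Num.min 1 (e / K) by rewrite lt_min ltr01 divr_gt0.
apply: (@filterS _ _ FF _ _ _ (near_coords cs p d0)) => q qp.
(* A neighbourhood of p bounds q in the finitely many coordinates cs only;
   the others are reset, which does not change g q. *)
pose q' : jcoord A -> R := fun c => if c \in cs then q c else p c.
have -> : g q = g q' by apply: gcs => c ccs; rewrite /q' ccs.
have q'p c : `|q' c - p c| <= Num.min 1 (e / K).
  by rewrite /q'; case: ifP => [/qp//|_]; rewrite subrr normr0 ltW.
rewrite distrC (le_trans (hM _ _))//.
  by move=> c; rewrite (le_trans (q'p c))// ge_min lexx.
rewrite (@le_trans _ _ (K * (e / K)))//; last by rewrite mulrC divfK// gt_eqF.
rewrite (@le_trans _ _ (M * ((size cs)%:R * (e / K))))//.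
  rewrite ler_wpM2l// /dist1 (@le_trans _ _ (\sum_(c <- cs) (e / K)))//.
    by apply: ler_sum => c _; rewrite (le_trans (q'p c))// ge_min lexx orbT.
  by rewrite big_const_seq count_predT iter_addr_0 mulr_natl.
by rewrite [leLHS]mulrA ler_wpM2r ?divr_ge0 ?(ltW e0) ?(ltW K0)// lerDl.
Qed.

End LocallyLipschitz.

(** * Symmetry of second partial derivatives *)

Section Schwarz.
Variables (R : realType) (A : choiceType).
Implicit Types (f g : (jcoord A -> R) -> R) (p q B : jcoord A -> R) (c d : jcoord A).

Lemma dfwithC c d p (r r' : R) : c != d ->
  dfwith (dfwith p c r) d r' = dfwith (dfwith p d r') c r :> (jcoord A -> R).
Proof.
move=> cd; apply/funext => e.
have [<-|de] := eqVneq d e; first by rewrite dfwithin dfwithout// dfwithin.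
rewrite dfwithout//; have [<-|ce] := eqVneq c e; first by rewrite !dfwithin.
by rewrite !dfwithout.
Qed.

(** The mean value theorem in c, then in d, reduces the second difference to one
    mixed derivative. The left-hand side is symmetric in c and d, which gives
    [partialC]. *)
Lemma second_difference f c d p : c != d -> smooth f ->
  exists2 C, 0 <= C & forall h : R, 0 < h <= 1 -> exists2 e, `|e| <= C * h &
    f (dfwith (dfwith p d (p d + h)) c (p c + h)) - f (dfwith p c (p c + h))
    - (f (dfwith p d (p d + h)) - f p)
    = h ^+ 2 * (partial d (partial c f) p + e).
Proof.
move=> cd sf; have [cs ucs fcs] := smooth_depends sf.
have [M M0 hM] := smooth_Lipschitz (fun c => `|p c| + 1) ucs
  (smooth_partial d (smooth_partial c sf))
  (depends_on_partial d (depends_on_partial c fcs)).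
exists (M * (size cs)%:R) => [|h /andP[h0 h1]]; first exact: mulr_ge0.
have [|||x] := @MVT_segment R
  (fun r => f (dfwith (dfwith p d (p d + h)) c r) - f (dfwith p c r))
  (fun r => partial c f (dfwith (dfwith p d (p d + h)) c r)
            - partial c f (dfwith p c r)) (p c) (p c + h).
- by rewrite lerDl ltW.
- move=> x _; apply: is_deriveB;
  exact/has_partial_is_derive/smooth_has_partial.
- apply: continuous_subspaceT => x; apply: (@continuousB R R R).
    exact/has_partial_continuous/smooth_has_partial.
  exact/has_partial_continuous/smooth_has_partial.
rewrite in_itv /= => /andP[x1 x2].
have -> : dfwith (dfwith p d (p d + h)) c (p c) = dfwith p d (p d + h).
  by rewrite -dfwithC// dfwith_id.
rewrite dfwith_id (addrC (p c)) addrK => ->.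
rewrite -dfwithC//.
have e1 : dfwith (dfwith p c x) d (p d) = dfwith p c x.
  by rewrite -[RHS](dfwith_id d) dfwithout.
have [|y] := has_partial_MVT (dfwith p c x) (p d) (p d + h)
  (@smooth_has_partial _ _ (partial c f) d _); first exact: smooth_partial.
rewrite min_l ?max_r ?lerDl ?(ltW h0)// => /andP[y1 y2].
rewrite e1 (addrC (p d)) addrK => ->.
set q := dfwith _ d y; exists (partial d (partial c f) q - partial d (partial c f) p);
  last by rewrite subrKC mulrC [in RHS]expr2 mulrA mulrAC -mulrA; rewrite mulrC.
have qp e : `|q e - p e| <= h.
  rewrite /q; have [<-|de] := eqVneq d e.
    by rewrite dfwithin ger0_norm ?subr_ge0// lerBlDr addrC.
  rewrite dfwithout//; have [<-|ce] := eqVneq c e.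
    by rewrite dfwithin ger0_norm ?subr_ge0// lerBlDr addrC.
  by rewrite dfwithout// subrr normr0 ltW.
rewrite (le_trans (hM _ _ _ _))//.
- by move=> e; rewrite lerDl.
- move=> e; rewrite -[q e](subrK (p e)) addrC (le_trans (ler_normD _ _))// lerD2l.
  exact: le_trans h1.
- rewrite -mulrA ler_wpM2l// mulr_natl -[X in X *+ _]mulr1 mulr1.
  rewrite /dist1 (le_trans (ler_sum _ (fun e _ => qp e)))//.
  by rewrite big_const_seq count_predT iter_addr_0.
Qed.

Lemma partialC f c d : smooth f ->
  partial c (partial d f) = partial d (partial c f).
Proof.
move=> sf; have [->//|cd] := eqVneq c d; apply/funext => p.
have [C C0 hC] := second_difference p cd sf.
have dc : d != c by rewrite eq_sym.
have [C' C'0 hC'] := second_difference p dc sf.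
apply/eqP; rewrite -subr_eq0 -normr_le0; apply/ler_addgt0Pl => e e0.
rewrite addr0.
pose h := Num.min 1 (e / (C + C' + 1)).
have K0 : 0 < C + C' + 1 by rewrite ltr_wpDl// addr_ge0.
have h0 : 0 < h by rewrite lt_min ltr01 divr_gt0.
have h01 : 0 < h <= 1 by rewrite h0 ge_min lexx.
have [x hx ex] := hC h h01; have [y hy ey] := hC' h h01.
have exy : partial d (partial c f) p + x = partial c (partial d f) p + y.
  have h2 : h ^+ 2 != 0 by rewrite expf_neq0// gt_eqF.
  apply: (mulfI h2); rewrite -ex -ey dfwithC//; ring.
have -> : partial c (partial d f) p - partial d (partial c f) p = x - y.
  by apply/eqP; rewrite subr_eq addrC addrA exy addrK.
rewrite (le_trans (ler_normB _ _))// (le_trans (lerD hx hy))//.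
rewrite -mulrDl (@le_trans _ _ ((C + C' + 1) * h))//.
  by rewrite ler_wpM2r ?(ltW h0)// lerDl.
by rewrite mulrC -ler_pdivlMr// ge_min lexx orbT.
Qed.

End Schwarz.

(** * Smooth functions as a ring with derivations *)
Section SmoothRing.
Variables (R : realType) (A : choiceType).
Local Notation fn := ((jcoord A -> R) -> R).

Definition smooth_pred : {pred fn} := fun f => `[< smooth f >].

Lemma smooth_predP (f : fn) : reflect (smooth f) (f \in smooth_pred).
Proof. exact: asboolP. Qed.

Lemma smooth_subring : subring_closed smooth_pred.
Proof.
split; first exact/smooth_predP/smooth_cst.
  move=> f g /smooth_predP sf /smooth_predP sg; apply/smooth_predP.
  by apply: smoothD => //; exact: smoothN.
move=> f g /smooth_predP sf /smooth_predP sg; apply/smooth_predP; exact: smoothM.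
Qed.
HB.instance Definition _ := GRing.isSubringClosed.Build fn smooth_pred smooth_subring.

Record sfun := SFun { sval_fun :> fn; sfun_subproof : sval_fun \in smooth_pred }.
HB.instance Definition _ := [isSub for sval_fun].
HB.instance Definition _ := [Choice of sfun by <:].
HB.instance Definition _ := GRing.SubChoice_isSubComPzRing.Build fn smooth_pred sfun smooth_subring.

Lemma smooth_sfun (f : sfun) : smooth f.
Proof. exact/smooth_predP/sfun_subproof. Qed.

Definition to_sfun (f : fn) (sf : smooth f) : sfun :=
  SFun (introT (smooth_predP f) sf).

Lemma sfunP (f g : sfun) : (forall p, f p = g p) -> f = g.
Proof. by move=> fg; apply: val_inj; apply/funext. Qed.

Lemma sfunDE (f g : sfun) p : (f + g) p = f p + g p. Proof. by []. Qed.
Lemma sfunME (f g : sfun) p : (f * g) p = f p * g p. Proof. by []. Qed.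
Lemma sfunNE (f : sfun) p : (- f) p = - f p. Proof. by []. Qed.
Lemma sfun0E p : (0 : sfun) p = 0. Proof. by []. Qed.
Lemma sfun1E p : (1 : sfun) p = 1. Proof. by []. Qed.
Lemma sfun_sumE (I : Type) (r : seq I) (P : pred I) (F : I -> sfun) p :
  (\sum_(i <- r | P i) F i) p = \sum_(i <- r | P i) F i p.
Proof. by elim/big_rec2: _ => // i x y _ <-. Qed.

End SmoothRing.

Section Derivations.
Variables (R : realType) (A : choiceType).
Local Notation sfun := (sfun R A).
Implicit Types (f g : sfun) (c d : jcoord A) (X Y : jcoord A -> sfun).

Definition dpart c f : sfun := to_sfun (smooth_partial c (smooth_sfun f)).

Lemma dpart_is_zmod_morphism c : zmod_morphism (dpart c).
Proof.
move=> f g; apply: sfunP => p /=.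
have hf := smooth_has_partial c (smooth_sfun f).
have hg := smooth_has_partial c (smooth_sfun g).
have [hN eN] := has_partialN hg.
by have [_ ->] := has_partialD hf hN; rewrite /= eN.
Qed.
HB.instance Definition _ c :=
  GRing.isZmodMorphism.Build sfun sfun (dpart c) (dpart_is_zmod_morphism c).

Lemma dpartM c f g : dpart c (f * g) = dpart c f * g + f * dpart c g.
Proof.
apply: sfunP => p /=.
have hf := smooth_has_partial c (smooth_sfun f).
have hg := smooth_has_partial c (smooth_sfun g).
by have [_ ->] := has_partialM hf hg.
Qed.

Lemma dpartC c d f : dpart c (dpart d f) = dpart d (dpart c f).
Proof. by apply: sfunP => p /=; rewrite (partialC c d (smooth_sfun f)). Qed.

Lemma dpart0 cs f c : depends_on cs f -> c \notin cs -> dpart c f = 0.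
Proof. by move=> fcs ccs; apply: sfunP => p /=; rewrite (depends_on_partial0 fcs ccs). Qed.

Definition sconst (r : R) : sfun := to_sfun (smooth_cst A r).
Definition scoord c : sfun := to_sfun (@smooth_coord R A c).

Lemma dpart_const c r : dpart c (sconst r) = 0.
Proof. by apply: sfunP => p /=; have [_ ->] := has_partial_cst c r. Qed.

Lemma dpart1 c : dpart c 1 = 0.
Proof. by rewrite -[1]/(1 : sfun) -(dpart_const c 1); congr dpart; apply: sfunP. Qed.

Lemma dpart_coord c d : dpart c (scoord d) = (c == d)%:R.
Proof.
apply: sfunP => p /=; have [_ ->] := @has_partial_coord R A c d.
by case: eqP.
Qed.

Lemma vactE X f cs p : uniq cs -> depends_on cs f ->
  vact X f p = (\sum_(c <- cs) X c * dpart c f) p.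
Proof.
move=> ucs fcs; rewrite /vact (fsbigE cs)//=.
  under eq_bigl do rewrite in_setT.
  by rewrite sfun_sumE.
by move=> c _ ccs; rewrite (depends_on_partial0 fcs ccs) mulr0.
Qed.

Lemma smooth_vact X f : smooth (vact X f).
Proof.
have [cs ucs fcs] := smooth_depends (smooth_sfun f).
have -> : vact X f = \sum_(c <- cs) X c * dpart c f.
  by apply/funext => p; rewrite (vactE X p ucs fcs).
exact: smooth_sfun.
Qed.

Definition svact X f : sfun := to_sfun (smooth_vact X f).

Lemma svactE X f cs : uniq cs -> depends_on cs f ->
  svact X f = \sum_(c <- cs) X c * dpart c f.
Proof. by move=> ucs fcs; apply: sfunP => p; rewrite -(vactE X p ucs fcs). Qed.

Lemma depends_common f g : exists cs, [/\ uniq cs, depends_on cs f & depends_on cs g].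
Proof.
have [cs ucs fcs] := smooth_depends (smooth_sfun f).
have [cs' ucs' gcs] := smooth_depends (smooth_sfun g).
exists (undup (cs ++ cs')); split; first exact: undup_uniq.
  by apply: depends_on_sub fcs => c h; rewrite mem_undup mem_cat h.
by apply: depends_on_sub gcs => c h; rewrite mem_undup mem_cat h orbT.
Qed.

Lemma depends_onD cs f g : depends_on cs f -> depends_on cs g -> depends_on cs (f + g).
Proof. by move=> hf hg p q pq; rewrite !sfunDE (hf p q)// (hg p q). Qed.

Lemma depends_onN cs f : depends_on cs f -> depends_on cs (- f).
Proof. by move=> hf p q pq; rewrite !sfunNE (hf p q). Qed.

Lemma depends_onM cs f g : depends_on cs f -> depends_on cs g -> depends_on cs (f * g).
Proof. by move=> hf hg p q pq; rewrite !sfunME (hf p q)// (hg p q). Qed.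

Lemma svact_is_zmod_morphism X : zmod_morphism (svact X).
Proof.
move=> f g; have [cs [ucs fcs gcs]] := depends_common f g.
rewrite !(svactE X ucs)//; last by apply: depends_onD => //; exact: depends_onN.
by rewrite -sumrB; apply: eq_bigr => c _; rewrite raddfB mulrBr.
Qed.
HB.instance Definition _ X :=
  GRing.isZmodMorphism.Build sfun sfun (svact X) (svact_is_zmod_morphism X).

Lemma svactM X f g : svact X (f * g) = svact X f * g + f * svact X g.
Proof.
have [cs [ucs fcs gcs]] := depends_common f g.
rewrite !(svactE X ucs)//; last exact: depends_onM.
rewrite mulr_suml mulr_sumr -big_split; apply: eq_bigr => c _ /=.
by rewrite dpartM mulrDr mulrA (mulrCA f).
Qed.

Lemma svact_coord X c : svact X (scoord c) = X c.
Proof.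
rewrite (@svactE X _ [:: c])//; last by move=> p q; apply; rewrite mem_seq1.
by rewrite big_seq1 dpart_coord eqxx mulr1.
Qed.

Lemma dpart_svact X d f :
  dpart d (svact X f) = svact (fun c => dpart d (X c)) f + svact X (dpart d f).
Proof.
have [cs ucs fcs] := smooth_depends (smooth_sfun f).
rewrite !(svactE _ ucs)//; last exact: depends_on_partial.
rewrite raddf_sum -big_split; apply: eq_bigr => c _ /=.
by rewrite dpartM dpartC.
Qed.

(** The situation of a total derivative: only one coefficient of X involves the
    coordinate d, namely the one of the coordinate e. *)
Lemma dpart_svact_coord X d (e : option (jcoord A)) f :
  (forall c, dpart d (X c) = (Some c == e)%:R) ->
  dpart d (svact X f) = svact X (dpart d f) + (if e is Some c then dpart c f else 0).
Proof.
move=> Xe; rewrite dpart_svact addrC; congr (_ + _).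
have [cs ucs fcs] := smooth_depends (smooth_sfun f).
rewrite (svactE _ ucs fcs); under eq_bigr do rewrite Xe.
case: e {Xe} => [c|]; last by rewrite big1// => c _; rewrite mul0r.
have [ccs|ccs] := boolP (c \in cs).
  rewrite (bigD1_seq _ ccs ucs)/= eqxx mul1r big1 ?addr0// => b /negPf bc.
  by rewrite (inj_eq Some_inj) bc mul0r.
rewrite (dpart0 fcs ccs) big_seq big1// => b bcs.
by case: eqP => [[bc]|]; rewrite ?mul0r//; move: ccs; rewrite -bc bcs.
Qed.

(** It suffices to compare two vector fields on coordinates: the second order
    terms agree because partial derivatives commute. *)
Lemma svactC X Y f : (forall c, svact X (Y c) = svact Y (X c)) ->
  svact X (svact Y f) = svact Y (svact X f).
Proof.
move=> XY; have [cs ucs fcs] := smooth_depends (smooth_sfun f).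
have fcs' c : depends_on cs (dpart c f) by exact: depends_on_partial.
have E Z W : svact Z (svact W f) = \sum_(c <- cs) svact Z (W c) * dpart c f +
    \sum_(c <- cs) \sum_(d <- cs) W c * (Z d * dpart d (dpart c f)).
  rewrite (svactE W ucs)// raddf_sum -big_split; apply: eq_bigr => c _ /=.
  by rewrite svactM (svactE Z ucs (fcs' c)) mulr_sumr.
rewrite !E; congr (_ + _); first by apply: eq_bigr => c _; rewrite XY.
rewrite exchange_big; apply: eq_bigr => c _; apply: eq_bigr => d _ /=.
by rewrite dpartC mulrCA.
Qed.

Lemma svact_eq (X : vfield R A) Y f : (forall c p, X c p = Y c p) ->
  vact X f = svact Y f.
Proof.
by move=> XY; rewrite (_ : X = fun c => Y c)//; apply/funext => c; apply/funext.
Qed.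

End Derivations.

(** * Formal adjoints and integration by parts *)

Section Adjoint.
Variables (V : zmodType) (D : {additive V -> V}).

Definition negD (v : V) : V := - D v.

Lemma negD_is_zmod_morphism : zmod_morphism negD.
Proof. by move=> u v; rewrite /negD raddfB opprB opprK addrC. Qed.
HB.instance Definition _ :=
  GRing.isZmodMorphism.Build V V negD negD_is_zmod_morphism.

Definition negiter m (v : V) : V := iter m negD v.

Lemma negiter_is_zmod_morphism m : zmod_morphism (negiter m).
Proof. by elim: m => // m IH u v; rewrite /negiter /= -!/(negiter m _) IH raddfB. Qed.
HB.instance Definition _ m :=
  GRing.isZmodMorphism.Build V V (negiter m) (negiter_is_zmod_morphism m).

Lemma negiterS m v : negiter m.+1 v = - D (negiter m v). Proof. by []. Qed.
Lemma negiterSr m v : negiter m.+1 v = negiter m (- D v).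
Proof. exact: iterSr. Qed.

Lemma negiterSD m v : negiter m.+1 v = - negiter m (D v).
Proof. by rewrite negiterSr raddfN. Qed.

Definition bounded_by n (a : nat -> V) := forall i, (n <= i)%N -> a i = 0.

Lemma bounded_byW n m a : (n <= m)%N -> bounded_by n a -> bounded_by m a.
Proof. by move=> nm an i mi; apply: an; exact: leq_trans mi. Qed.

Lemma sum_bounded n m (a : nat -> V) : (n <= m)%N -> bounded_by n a ->
  \sum_(i < m) a i = \sum_(i < n) a i.
Proof.
move=> nm an; rewrite -(big_mkord xpredT) (big_cat_nat (leq0n n) nm) /= big_mkord.
rewrite [X in _ + X]big_nat_cond [X in _ + X]big1 ?addr0// => i /andP[/andP[ni _] _].
exact: an.
Qed.

(** The sequence [a] stands for the operator $\sum_i a_i D^i$ in an auxiliary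
    variable, and [Eul] sends it to the value of the adjoint operator on 1. *)
Definition Eul N (a : nat -> V) : V := \sum_(i < N) negiter i (a i).

(** Composition with D on the left of the operator encoded by a sequence. *)
Definition shD (a : nat -> V) : nat -> V :=
  fun i => D (a i) + (if i is j.+1 then a j else 0).

Lemma shD_is_zmod_morphism : zmod_morphism shD.
Proof.
move=> a b; apply/funext => -[|i]; rewrite /shD !fctE raddfB.
  by rewrite !addr0.
by rewrite opprD addrACA.
Qed.
HB.instance Definition _ :=
  GRing.isZmodMorphism.Build (nat -> V) (nat -> V) shD shD_is_zmod_morphism.

Lemma Eul_is_zmod_morphism N : zmod_morphism (Eul N).
Proof. by move=> a b; rewrite /Eul -sumrB; apply: eq_bigr => i _; rewrite !fctE raddfB. Qed.
HB.instance Definition _ N :=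
  GRing.isZmodMorphism.Build (nat -> V) V (Eul N) (Eul_is_zmod_morphism N).

Lemma Eul_bounded n N a : (n <= N)%N -> bounded_by n a -> Eul N a = Eul n a.
Proof. move=> nN an; apply: (sum_bounded (a := fun i => negiter i (a i))) => // i ni.
by rewrite an// raddf0. Qed.

Lemma bounded_shD n a : bounded_by n a -> bounded_by n.+1 (shD a).
Proof. by move=> an [//|i ni]; rewrite /shD (an i.+1 (ltnW ni)) (an i ni) raddf0 addr0. Qed.

(** Total derivatives have no Euler-Lagrange expression: the sum telescopes. *)
Lemma Eul_shD n N a : bounded_by n a -> (n < N)%N -> Eul N (shD a) = 0.
Proof.
move=> an nN; rewrite (Eul_bounded nN (bounded_shD an)) /Eul /shD.
under eq_bigr do rewrite raddfD.
rewrite big_split /= big_ord_recr big_ord_recl /= (an n (leqnn n)) !raddf0.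
rewrite addr0 add0r -big_split big1// => i _.
by rewrite !add0n -[negD _]/(negiter i.+1 _) negiterSD; exact: subrr.
Qed.

End Adjoint.
Arguments bounded_by {V} n a.

Section AdjointMorphism.
Variables (U V : zmodType) (DU : {additive U -> U}) (DV : {additive V -> V}).

Lemma negiter_morph (phi : {additive U -> V}) : (forall u, phi (DU u) = DV (phi u)) ->
  forall m u, phi (negiter DU m u) = negiter DV m (phi u).
Proof. by move=> h; elim=> // m IH u; rewrite !negiterS raddfN h IH. Qed.

Lemma Eul_morph (phi : {additive U -> V}) : (forall u, phi (DU u) = DV (phi u)) ->
  forall N a, phi (Eul DU N a) = Eul DV N (fun i => phi (a i)).
Proof.
by move=> h N a; rewrite raddf_sum; apply: eq_bigr => i _; rewrite (negiter_morph h).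
Qed.

Variable m : nat -> {additive U -> V}.
Hypothesis DVm : forall k u, DV (m k u) = m k.+1 u + m k (DU u).

(** Integration by parts: [m k] is multiplication by the k-th derivative of one
    fixed quantity, and each derivative can be moved onto it. *)
Lemma Eul_negiter n N k j (v : nat -> U) : bounded_by n v -> (n + j < N)%N ->
  Eul DV N (fun i => m k (negiter (shD DU) j v i)) = Eul DV N (fun i => m (k + j) (v i)).
Proof.
elim: j n v => [|j IH] n v vn nN; first by rewrite addn0.
rewrite negiterSr (IH n.+1); first last.
- by rewrite addSnnS.
- by move=> i ni; rewrite -[LHS]/(- shD DU v i) (bounded_shD DU vn ni) oppr0.
have -> : (fun i => m (k + j) ((- shD DU v) i)) =
    (fun i => m (k + j).+1 (v i)) - shD DV (fun i => m (k + j) (v i)).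
  apply/funext => i; rewrite !fctE /shD DVm raddfN raddfD.
  rewrite -[in RHS]addrA [in RHS]opprD addNKr.
  by congr (- (_ + _)); case: i => [|i]; rewrite ?raddf0.
rewrite raddfB /= (@Eul_shD _ DV n) ?subr0 ?addnS//.
  by move=> i ni; rewrite vn// raddf0.
by rewrite (leq_ltn_trans _ nN)// leq_addr.
Qed.

(** Summing over the outer index: a formal adjoint followed by an evaluation
    through [m] is the transposed pairing, up to terms that [Eul] kills. *)
Lemma Eul_Eul n N (w : nat -> nat -> U) : bounded_by n w ->
  (forall k, bounded_by n (w k)) -> (n + n < N)%N ->
  Eul DV N (fun i => m 0 (Eul (shD DU) N w i)) =
  Eul DV N (fun i => \sum_(k < n) m k (w k i)).
Proof.
move=> wn wkn nN; have nN' : (n <= N)%N by rewrite (leq_trans _ (ltnW nN))// leq_addr.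
rewrite (Eul_bounded _ nN' wn).
have -> : (fun i => m 0 (Eul (shD DU) n w i)) =
    \sum_(k < n) (fun i => m 0 (negiter (shD DU) k (w k) i)).
  by apply/funext => i; rewrite /Eul !fct_sumE raddf_sum.
have -> : (fun i => \sum_(k < n) m k (w k i)) = \sum_(k < n) (fun i => m k (w k i)).
  by apply/funext => i; rewrite fct_sumE.
rewrite !raddf_sum; apply: eq_bigr => k _.
by rewrite /= (@Eul_negiter n) ?add0n// (leq_ltn_trans _ nN)// leq_add2l ltnW.
Qed.

End AdjointMorphism.

(** * Alternating forms and the interior Euler operator *)

Section PointwiseOps.
Variables (T : Type) (V : zmodType).
Implicit Types (f g : T -> V).
Lemma fctDE f g x : (f + g) x = f x + g x. Proof. by []. Qed.
Lemma fctNE f x : (- f) x = - f x. Proof. by []. Qed.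
Lemma fctBE f g x : (f - g) x = f x - g x. Proof. by []. Qed.
Lemma fct0E x : (0 : T -> V) x = 0. Proof. by []. Qed.
End PointwiseOps.

Section FormCalculus.
Variables (V : zmodType) (D : {additive V -> V}).
Local Notation aform := (seq coframe -> V).
Implicit Types (v w : aform) (c : coframe) (l : seq coframe).

Definition ctr c w : aform := fun l => w (c :: l).

Lemma ctr_is_zmod_morphism c : zmod_morphism (ctr c).
Proof. by []. Qed.
HB.instance Definition _ c :=
  GRing.isZmodMorphism.Build aform aform (ctr c) (ctr_is_zmod_morphism c).

(** Exterior multiplication, defined by the rule that contraction is an
    antiderivation. *)
Fixpoint awedge c w l : V :=
  if l is c' :: l' then (if c' == c then w l' else 0) - awedge c (ctr c' w) l' else 0.

Lemma awedge_is_zmod_morphism c : zmod_morphism (awedge c).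
Proof.
move=> v w; apply/funext => l; rewrite !fctE.
elim: l v w => [|c' l IH] v w; first by rewrite /= subr0.
rewrite /= raddfB IH; case: (c' == c); rewrite ?fctE ?subr0; last by rewrite !sub0r opprD.
by rewrite !opprD !opprK addrACA.
Qed.
HB.instance Definition _ c :=
  GRing.isZmodMorphism.Build aform aform (awedge c) (awedge_is_zmod_morphism c).

Lemma ctr_awedge c c' w :
  ctr c' (awedge c w) = (if c' == c then w else 0) - awedge c (ctr c' w).
Proof. by apply/funext => l; rewrite !fctE /ctr /=; case: ifP. Qed.

(** [csucc] is D_x on the coframe, and [cpred] is its transpose on the dual
    frame. *)
Definition cpred c := if c is theta i.+1 then Some (theta i) else None.
Definition csucc c := if c is theta i then Some (theta i.+1) else None.
Definition octr oc w : aform := if oc is Some c then ctr c w else (fun=> 0).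
Definition owedge oc w : aform := if oc is Some c then awedge c w else (fun=> 0).

(** The derivation of the tensor algebra that extends D by
    theta_i |-> theta_(i+1). On alternating forms it is the usual one, but this
    version satisfies a recursion without any sign. *)
Fixpoint fD w l : V :=
  if l is c :: l' then fD (ctr c w) l' + octr (cpred c) w l' else D (w [::]).

Lemma fD_is_zmod_morphism : zmod_morphism fD.
Proof.
move=> v w; apply/funext => l; rewrite !fctE.
elim: l v w => [|c l IH] v w; first by rewrite /= raddfB.
rewrite /= raddfB IH; case: (cpred c) => [c'|] /=; last by rewrite !addr0.
by rewrite opprD addrACA.
Qed.
HB.instance Definition _ := GRing.isZmodMorphism.Build aform aform fD fD_is_zmod_morphism.

Lemma ctr_fD c w : ctr c (fD w) = fD (ctr c w) + octr (cpred c) w.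
Proof. by []. Qed.

Lemma awedge_cons c w c' l :
  awedge c w (c' :: l) = (if c' == c then w l else 0) - awedge c (ctr c' w) l.
Proof. by []. Qed.

Lemma fD_cons w c l : fD w (c :: l) = fD (ctr c w) l + octr (cpred c) w l.
Proof. by []. Qed.

Lemma cpred_eq c c' : (cpred c' == Some c) = (csucc c == Some c').
Proof. by case: c c' => [||i] [||[|j]] //=; apply/eqP/eqP => -[->]. Qed.

Lemma owedge_cons oc w c l : owedge oc w (c :: l) =
  (if oc == Some c then w l else 0) - owedge oc (ctr c w) l.
Proof.
case: oc => [d|]; last by rewrite /= subr0.
by rewrite [LHS]awedge_cons eq_sym (inj_eq Some_inj).
Qed.

Lemma octr_awedge oc c w l : octr oc (awedge c w) l =
  (if oc == Some c then w l else 0) - awedge c (octr oc w) l.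
Proof.
case: oc => [d|]; last by rewrite /= -[fun=> 0]/(0 : aform) raddf0 subr0.
by rewrite (inj_eq Some_inj).
Qed.

(** The Leibniz rule for D_x. The recursions of [fD] and [awedge] fit together
    because [cpred] and [csucc] are transposed ([cpred_eq]). *)
Lemma fD_awedge c w : fD (awedge c w) = owedge (csucc c) w + awedge c (fD w).
Proof.
apply/funext => l; rewrite fctDE; elim: l w => [|c' l IH] w.
  by rewrite /= raddf0 addr0; case: (csucc c).
rewrite fD_cons ctr_awedge raddfB fctBE /= IH.
rewrite ctr_fD (raddfD (awedge c)) fctDE /=.
rewrite owedge_cons octr_awedge cpred_eq.
have -> : fD (if c' == c then w else 0) l = if c' == c then fD w l else 0.
  by case: ifP => //; rewrite raddf0.
rewrite !opprD !addrA; congr (_ - _); rewrite [LHS]addrC !addrA; congr (_ - _).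
by rewrite addrAC.
Qed.

Definition alternating w := forall a b l1 l2,
  w (l1 ++ a :: b :: l2) = - w (l1 ++ b :: a :: l2).

Lemma alternating_ctr c w : alternating w -> alternating (ctr c w).
Proof. by move=> aw a b l1 l2; exact: (aw a b (c :: l1)). Qed.

Lemma alternating_ctr2 a b w : alternating w -> ctr a (ctr b w) = - ctr b (ctr a w).
Proof. by move=> aw; apply/funext => l; exact: (aw b a [::]). Qed.

Lemma alternatingD v w : alternating v -> alternating w -> alternating (v + w).
Proof. by move=> av aw a b l1 l2; rewrite !fctDE av aw opprD. Qed.

Lemma alternatingN w : alternating w -> alternating (- w).
Proof. by move=> aw a b l1 l2; rewrite !fctNE aw. Qed.

Lemma alternating0 : alternating 0.
Proof. by move=> a b l1 l2; rewrite !fct0E oppr0. Qed.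

Lemma alternating_sum (I : Type) (r : seq I) (P : pred I) (F : I -> aform) :
  (forall i, P i -> alternating (F i)) -> alternating (\sum_(i <- r | P i) F i).
Proof. by move=> h; elim/big_ind: _ => //; [exact: alternating0|exact: alternatingD]. Qed.

Lemma alternating_awedge c w : alternating w -> alternating (awedge c w).
Proof.
move=> aw a b l1 l2; elim: l1 w aw => [|c' l1 IH] w aw; last first.
  rewrite /= IH; last exact: alternating_ctr.
  rewrite aw opprK opprB addrC; congr (_ + _).
  by case: ifP => _ //; rewrite oppr0.
rewrite !cat0s !awedge_cons (alternating_ctr2 b a aw) (raddfN (awedge c)) fctNE /=.
set W := awedge c _ l2; rewrite /ctr.
set x := (if a == c then _ else _); set y := (if b == c then _ else _).
by rewrite !opprB addrA.
Qed.

End FormCalculus.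

Section FormDegrees.
Variables (V : zmodType) (D : {additive V -> V}).
Local Notation aform := (seq coframe -> V).
Implicit Types (v w : aform) (c : coframe) (l : seq coframe) (P : pred coframe).

(** The type of a form is recorded by the number of entries of each kind; unlike
    a condition on the length, this behaves additively under contraction and
    exterior multiplication. *)
Definition count_is P k w := forall l, count P l != k -> w l = 0.

Lemma count_is_ctr P k c w : count_is P (P c + k)%N w -> count_is P k (ctr c w).
Proof. by move=> hw l hl; apply: hw; rewrite /= eqn_add2l. Qed.

Lemma count_is_ctr0 P c w : count_is P 0 w -> P c -> ctr c w = 0.
Proof. by move=> hw Pc; apply/funext => l; apply: hw; rewrite /= Pc. Qed.

Lemma count_isD P k v w : count_is P k v -> count_is P k w -> count_is P k (v + w).
Proof. by move=> hv hw l hl; rewrite fctDE hv// hw// addr0. Qed.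

Lemma count_isN P k w : count_is P k w -> count_is P k (- w).
Proof. by move=> hw l hl; rewrite fctNE hw// oppr0. Qed.

Lemma count_is_sum P k (I : Type) (r : seq I) (Q : pred I) (F : I -> aform) :
  (forall i, Q i -> count_is P k (F i)) -> count_is P k (\sum_(i <- r | Q i) F i).
Proof. by move=> h; elim/big_ind: _ => //; exact: count_isD. Qed.

Lemma count_is_awedge P k c w : count_is P k w ->
  count_is P (P c + k)%N (awedge c w).
Proof.
move=> hw l; elim: l k w hw => [//|c' l IH] k w hw hl; rewrite awedge_cons.
have -> : (if c' == c then w l else 0) = 0.
  by case: (eqVneq c' c) hl => [->|//] hl; apply: hw; move: hl; rewrite /= eqn_add2l.
rewrite sub0r; apply/eqP; rewrite oppr_eq0; apply/eqP.
have [Pc'|/negPf Pc'] := boolP (P c'); last first.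
  apply: (IH k); first by apply: count_is_ctr; rewrite Pc'.
  by move: hl; rewrite /= Pc'.
case: k hw hl => [|k] hw hl; first by rewrite (count_is_ctr0 hw Pc') raddf0.
apply: (IH k); first by apply: count_is_ctr; rewrite Pc'.
by move: hl; rewrite /= Pc' addnS add1n eqSS.
Qed.

Lemma count_is_fD P k w : (forall c c', cpred c = Some c' -> P c' = P c) ->
  count_is P k w -> count_is P k (fD D w).
Proof.
move=> hP hw l; elim: l k w hw => [|c l IH] k w hw hl.
  by rewrite /= hw// raddf0.
rewrite fD_cons; have -> : octr (cpred c) w l = 0.
  case e : (cpred c) => [c'|] //=; apply: hw.
  by rewrite /= (hP _ _ e); exact: hl.
rewrite addr0; have [Pc|/negPf Pc] := boolP (P c); last first.
  apply: (IH k); first by apply: count_is_ctr; rewrite Pc.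
  by move: hl; rewrite /= Pc.
case: k hw hl => [|k] hw hl.
  by rewrite (count_is_ctr0 hw Pc) -[fD D 0]/(_ 0) raddf0.
apply: (IH k); first by apply: count_is_ctr; rewrite Pc.
by move: hl; rewrite /= Pc add1n eqSS.
Qed.

Definition is_dt c := if c is dt then true else false.
Definition is_dx c := if c is dx then true else false.
Definition is_theta c := if c is theta _ then true else false.

Lemma all_theta l : count is_dt l = 0%N -> count is_dx l = 0%N ->
  exists js, l = map theta js.
Proof.
elim: l => [|[||j] l IH] //= ht hx; first by exists [::].
by have [js ->] := IH ht hx; exists (j :: js).
Qed.

Lemma alternating_move w a l1 l2 : alternating w -> w (a :: l1 ++ l2) = 0 ->
  w (l1 ++ a :: l2) = 0.
Proof.
move=> aw; elim/last_ind: l1 l2 => // l1 b IH l2 h.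
by rewrite cat_rcons aw IH ?oppr0// -cat_rcons.
Qed.

(** Moving dx to the front changes a coefficient only by a sign, and the other
    entries are then all of the form theta_j. *)
Lemma alternating_eq0 r w : alternating w -> count_is is_dt 0 w ->
  count_is is_dx 1 w -> count_is is_theta r w ->
  (forall js, size js = r -> w (dx :: map theta js) = 0) -> w = 0.
Proof.
move=> aw wt wx wr h; apply/funext => l.
have [lt|/wt//] := eqVneq (count is_dt l) 0%N.
have [lx|/wx//] := eqVneq (count is_dx l) 1%N.
have [lr|/wr//] := eqVneq (count is_theta l) r.
have : dx \in l.
  by rewrite -has_pred1 has_count (@eq_count _ _ is_dx) ?lx//; case.
move=> dxl; case/splitPr: dxl lt lx lr => l1 l2 lt lx lr.
apply: alternating_move => //.
move: lt lx lr; rewrite !count_cat /= add0n addnCA -!count_cat => lt [lx] lr.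
have [js e] := all_theta lt lx; rewrite e in lr *; apply: h.
by rewrite -lr count_map; elim: js {e lt lx lr} => //= j js ->.
Qed.

Definition theta_bounded n w := forall i, (n <= i)%N -> ctr (theta i) w = 0.

Lemma theta_bounded_ctr n c w : alternating w -> theta_bounded n w ->
  theta_bounded n (ctr c w).
Proof. by move=> aw wn i ni; rewrite alternating_ctr2// wn// raddf0 ?oppr0. Qed.

(** Euler's identity for the vertical degree: each entry theta_j is removed once
    and put back. *)
Lemma sum_awedge_ctr n w l : alternating w -> theta_bounded n w ->
  \sum_(k < n) awedge (theta k) (ctr (theta k) w) l = w l *+ count is_theta l.
Proof.
elim: l w => [|c l IH] w aw wn; first by rewrite big1.
under eq_bigr do rewrite awedge_cons alternating_ctr2// raddfN fctNE opprK.
rewrite big_split /= IH; first last.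
- exact: theta_bounded_ctr.
- exact: alternating_ctr.
rewrite mulrnDr [ctr c w l]/ctr; congr (_ + _).
case: c => [||j]; rewrite /= ?mulr1n ?mulr0n; [by rewrite big1|by rewrite big1|].
have [jn|nj] := ltnP j n; last first.
  rewrite big1 => [|i _]; first by rewrite -[RHS]/(ctr (theta j) w l) wn.
  by case: eqP => // -[ij]; move: nj; rewrite ij leqNgt ltn_ord.
rewrite (bigD1 (Ordinal jn))//= eqxx big1 ?addr0// => i ij.
by case: eqP => // -[ji]; case/eqP: ij; apply: val_inj; rewrite /= ji.
Qed.

(** The form $\sum_i (-D_x)^i (\partial_{u_i} \lrcorner w)$, that is the interior
    Euler operator without its factor theta_0 and its normalization. *)
Definition Eform N w : aform := Eul (fD D) N (fun i => ctr (theta i) w).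

Lemma Eform_is_zmod_morphism N : zmod_morphism (Eform N).
Proof. by move=> v w; rewrite /Eform -raddfB. Qed.
HB.instance Definition _ N :=
  GRing.isZmodMorphism.Build aform aform (Eform N) (Eform_is_zmod_morphism N).

Lemma ctr_theta_fD (u : aform) :
  (fun i => ctr (theta i) (fD D u)) = shD (fD D) (fun i => ctr (theta i) u).
Proof.
by apply/funext => i; rewrite ctr_fD /shD; congr (_ + _); case: i.
Qed.

Lemma ctr_theta_is_zmod_morphism :
  zmod_morphism (fun (u : aform) i => ctr (theta i) u).
Proof. by []. Qed.
Definition ctr_theta : aform -> nat -> aform := fun u i => ctr (theta i) u.
HB.instance Definition _ := GRing.isZmodMorphism.Build aform (nat -> aform) ctr_theta
  ctr_theta_is_zmod_morphism.

Lemma Eul_e0 (U : zmodType) (DU : {additive U -> U}) N (u : U) : (0 < N)%N ->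
  Eul DU N (fun i => if i == 0%N then u else 0) = u.
Proof. case: N => // N _; by rewrite /Eul big_ord_recl big1 ?addr0// => i _; rewrite raddf0. Qed.

(** The interior Euler operator is a projection: by integration by parts,
    theta_0 /\ E(w) and $\sum_k \theta^k \wedge \partial_k \lrcorner w$ differ by a
    total derivative, and E annihilates total derivatives. *)
Lemma Eform_awedge0 n N r w : alternating w -> theta_bounded n w ->
  count_is is_theta r.+1 w -> (n + n < N)%N ->
  Eform N (awedge (theta 0) (Eform N w)) = (Eform N w) *+ r.+1.
Proof.
move=> aw wn wr nN; rewrite {1}/Eform.
have -> : (fun i => ctr (theta i) (awedge (theta 0) (Eform N w))) =
    (fun i => if i == 0%N then Eform N w else 0) -
    (fun i => awedge (theta 0) (Eul (shD (fD D)) N (fun k i => ctr (theta i) (ctr (theta k) w)) i)).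
  apply/funext => i; rewrite ctr_awedge fctBE; congr (_ - awedge _ _).
  rewrite /Eform -[ctr (theta i) _]/(ctr_theta _ i) (Eul_morph (DV := shD (fD D)))//.
  exact: ctr_theta_fD.
rewrite raddfB /= Eul_e0 ?(leq_ltn_trans _ nN)//.
rewrite (Eul_Eul (m := fun k => awedge (theta k)) _ (n := n))//.
- have -> : (fun i => \sum_(k < n) awedge (theta k) (ctr (theta i) (ctr (theta k) w))) =
      - (fun i => ctr (theta i) w *+ r).
    apply/funext => i; rewrite fctNE.
    under eq_bigr do rewrite alternating_ctr2// raddfN.
    rewrite sumrN; congr (- _); apply/funext => l.
    rewrite fct_sumE sum_awedge_ctr; first last.
    + exact: theta_bounded_ctr.
    + exact: alternating_ctr.
    have hr := @count_is_ctr is_theta r (theta i) w wr.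
    have [->|hl] := eqVneq (count is_theta l) r; first by rewrite natmulfctE.
    by rewrite natmulfctE hr// !mul0rn.
  rewrite raddfN opprK /= mulrS; congr (_ + _).
  rewrite /Eform -raddfMn /=; congr (Eul _ _ _); apply/funext => i.
  by rewrite [in RHS]natmulfctE.
- by move=> k u; exact: fD_awedge.
- by move=> k nk; apply/funext => i; rewrite /= wn// raddf0.
- by move=> k i ni; rewrite alternating_ctr2// wn// raddf0 ?oppr0.
Qed.

(** No information is lost by the factor theta_0, since E recovers E(w) from
    theta_0 /\ E(w). *)
Lemma awedge0_Eform_eq0 n N r w : (forall v : V, v *+ r.+1 = 0 -> v = 0) ->
  alternating w -> theta_bounded n w -> count_is is_theta r.+1 w -> (n + n < N)%N ->
  awedge (theta 0) (Eform N w) = 0 -> Eform N w = 0.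
Proof.
move=> V0 aw wn wr nN h; have := Eform_awedge0 aw wn wr nN.
rewrite h raddf0 => /esym e; apply/funext => l; apply: V0.
by move/(congr1 (@^~ l)): e; rewrite natmulfctE.
Qed.

Lemma ctr_dx_Eform N w : alternating w ->
  ctr dx (Eform N w) = - Eform N (ctr dx w).
Proof.
move=> aw; rewrite /Eform (Eul_morph (DV := fD D)); last first.
  by move=> u; rewrite /= ctr_fD; apply/funext => l; rewrite fctDE addr0.
rewrite -raddfN /=; congr (Eul _ _ _); apply/funext => i.
by rewrite fctNE alternating_ctr2.
Qed.

Definition arr1 v : nat -> V := fun j => v [:: theta j].
Definition arr2 v : nat -> nat -> V := fun j k => v [:: theta j; theta k].

Lemma arr1_is_zmod_morphism : zmod_morphism arr1. Proof. by []. Qed.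
Lemma arr2_is_zmod_morphism : zmod_morphism arr2. Proof. by []. Qed.
HB.instance Definition _ := GRing.isZmodMorphism.Build aform (nat -> V) arr1
  arr1_is_zmod_morphism.
HB.instance Definition _ := GRing.isZmodMorphism.Build aform (nat -> nat -> V) arr2
  arr2_is_zmod_morphism.

Lemma arr1_Eform N v : arr1 (Eform N v) =
  Eul (shD D) N (fun i j => v [:: theta i; theta j]).
Proof.
rewrite /Eform (Eul_morph (DV := shD D))// => u; apply/funext => j.
by rewrite /= /arr1 /shD fD_cons; congr (_ + _); case: j.
Qed.

Lemma arr2_Eform N v : arr2 (Eform N v) =
  Eul (shD (shD D)) N (fun i j k => v [:: theta i; theta j; theta k]).
Proof.
rewrite /Eform (Eul_morph (DV := shD (shD D)))// => u.
apply/funext => j; apply/funext => k.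
rewrite /= /arr2 /shD !fD_cons fctDE; case: j => [|j]; rewrite ?fct0E;
by congr (_ + _); congr (_ + _); case: k.
Qed.

Definition cmap (f : V -> V) w : aform := fun l => f (w l).

Lemma alternating_cmap (f : {additive V -> V}) w : alternating w -> alternating (cmap f w).
Proof. by move=> aw a b l1 l2; rewrite /cmap aw raddfN. Qed.

Lemma count_is_cmap (f : {additive V -> V}) P k w : count_is P k w ->
  count_is P k (cmap f w).
Proof. by move=> hw l hl; rewrite /cmap hw// raddf0. Qed.

End FormDegrees.

(** * Forms on E with smooth coefficients *)

Section FiniteSums.
Lemma fsbig_nat (V : nmodType) n (F : nat -> V) :
  (forall i, (n <= i)%N -> F i = 0) -> \sum_(i \in [set: nat]) F i = \sum_(i < n) F i.
Proof.
move=> F0; rewrite (fsbigE (iota 0 n)) ?iota_uniq//=; last first.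
  by move=> i _; rewrite mem_iota add0n /= -leqNgt; exact: F0.
under eq_bigl do rewrite in_setT.
by rewrite -[iota 0 n]/(iota 0 n) -{1}(subn0 n) -/(index_iota 0 n) big_mkord.
Qed.
End FiniteSums.

Section FormsOnE.
Variable R : realType.
Local Notation fn := (sfun R nat).
Local Notation aform := (seq coframe -> fn).
Local Notation du i := (dpart (cu i)).
Implicit Types (w : aform) (c : coframe) (l : seq coframe) (f : fn).

Definition eDx_sfield (c : jcoord nat) : fn :=
  match c with ct => 0 | cx => 1 | cu i => scoord R (cu i.+1) end.
Local Notation sD := (svact eDx_sfield).

Lemma eDxE f : eDx f = sD f.
Proof. by apply: svact_eq => -[||i]. Qed.

Lemma du_sD i f : du i (sD f) = sD (du i f) + (if i is j.+1 then du j f else 0).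
Proof.
rewrite (@dpart_svact_coord _ _ _ _ (if i is j.+1 then Some (cu j) else None)).
  by case: i.
case=> [||k] /=; rewrite ?raddf0 ?dpart1 ?dpart_coord; case: i => [|i] //=.
by rewrite (inj_eq Some_inj) eq_sym; congr (nat_of_bool _)%:R; apply/eqP/eqP => -[->].
Qed.

Lemma dt_sD f : dpart ct (sD f) = sD (dpart ct f).
Proof.
rewrite (@dpart_svact_coord _ _ _ _ None) ?addr0// => -[||k] /=.
- exact: raddf0.
- exact: dpart1.
- by rewrite dpart_coord.
Qed.

Definition fform w : form R := fun cs p => w cs p.

Lemma fform_eq0 w : form_eq0 (fform w) <-> w = 0.
Proof.
by split=> [h|-> //]; apply/funext => cs; apply: sfunP => p; exact: h.
Qed.

Lemma wedge_nil c (w : form R) p : wedge c w [::] p = 0.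
Proof. by rewrite /wedge big_ord0. Qed.

Lemma wedge_cons c (w : form R) c' l p :
  wedge c w (c' :: l) p =
  (if c' == c then w l p else 0) - wedge c (fun l => w (c' :: l)) l p.
Proof.
rewrite /wedge big_mkcond big_ord_recl /= expr0 mul1r drop0; congr (_ + _).
rewrite -sumrN [RHS]big_mkcond; apply: eq_bigr => j _ /=; case: ifP => // _.
by rewrite exprS mulN1r mulNr.
Qed.

Lemma wedgeE c w : wedge c (fform w) = fform (awedge c w).
Proof.
apply/funext => l; apply/funext => p.
elim: l w => [|c' l IH] w; first by rewrite wedge_nil.
rewrite wedge_cons /fform awedge_cons sfunDE sfunNE -/(fform _ _ _).
by rewrite -[in RHS]/(fform (awedge c (ctr c' w)) l p) -IH; case: ifP.
Qed.

Lemma awedge_notin (V : zmodType) c (w : seq coframe -> V) l :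
  c \notin l -> awedge c w l = 0.
Proof.
elim: l w => // c' l IH w; rewrite inE negb_or awedge_cons => /andP[cc' cl].
by rewrite eq_sym (negPf cc') IH// subrr.
Qed.

Lemma theta_notin (l : seq coframe) : exists n, forall i, (n <= i)%N -> theta i \notin l.
Proof.
elim: l => [|c l [n IH]]; first by exists 0%N.
case: c => [||j]; [exists n|exists n|exists (maxn n j.+1)] => i; rewrite inE negb_or.
- exact: IH.
- exact: IH.
- rewrite geq_max => /andP[ni ji]; rewrite IH// andbT.
  by apply/eqP => -[ij]; rewrite ij ltnn in ji.
Qed.

(** On alternating forms the sign-free recursion of [fD] agrees with the sum of
    theta^{i+1} /\ (d/du_i contracted with w). *)
Lemma fD_sum w l n : alternating w ->
  (forall i, (n <= i)%N -> theta i.+1 \notin l) ->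
  fD sD w l = sD (w l) + \sum_(i < n) awedge (theta i.+1) (ctr (theta i) w) l.
Proof.
elim: l w => [|c l IH] w aw nl.
  by rewrite /= big1 ?addr0.
have nl' i : (n <= i)%N -> theta i.+1 \notin l.
  by move=> /nl; rewrite inE negb_or => /andP[].
rewrite fD_cons IH//; last exact: alternating_ctr.
rewrite -addrA; congr (_ + _); under [in RHS]eq_bigr do
  rewrite awedge_cons alternating_ctr2// (raddfN (awedge _)) fctNE opprK.
rewrite big_split /= addrC; congr (_ + _).
case: c nl => [||[|j]] nl /=; [by rewrite big1|by rewrite big1|by rewrite big1|].
have [jn|nj] := ltnP j n; last by have := nl _ nj; rewrite inE eqxx.
rewrite (bigD1 (Ordinal jn))//= eqxx big1 ?addr0// => i ij.
by case: eqP => // -[ji]; case/eqP: ij; apply: val_inj; rewrite /= ji.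
Qed.

Lemma fDxE w : alternating w -> fDx (fform w) = fform (fD sD w).
Proof.
move=> aw; apply/funext => l; apply/funext => p.
have [n nl] := theta_notin l.
rewrite /fDx /fform (fD_sum (n := n))//; last first.
  by move=> i ni; rewrite nl// (leq_trans ni).
rewrite sfunDE sfun_sumE eDxE (@fsbig_nat _ n).
  congr (_ + _); apply: eq_bigr => i _.
  by rewrite -[contract_u _ _]/(fform (ctr (theta i) w)) wedgeE.
move=> i ni; rewrite -[contract_u _ _]/(fform (ctr (theta i) w)) wedgeE /fform.
by rewrite awedge_notin// nl// (leq_trans ni).
Qed.

Lemma alternating_fD w : alternating w -> alternating (fD sD w).
Proof.
move=> aw a b l1 l2; elim: l1 w aw => [|c l1 IH] w aw.
  rewrite !cat0s !fD_cons (alternating_ctr2 b a aw) (raddfN (fD sD)) fctNE.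
  rewrite !opprD -!addrA; congr (_ + _).
  have o1 c d l : octr (cpred c) (ctr d w) l = - octr (cpred c) w (d :: l).
    case: (cpred c) => [c'|] /=; last by rewrite oppr0.
    exact: (aw d c' [::] l).
  rewrite o1 addrC; congr (_ + _); first by rewrite -[LHS]opprK -o1.
rewrite !cat_cons !fD_cons IH ?opprD; last exact: alternating_ctr.
congr (_ + _); case: (cpred c) => [c'|] /=; last by rewrite oppr0.
exact: (aw a b (c' :: l1) l2).
Qed.

Lemma iter_fDxE w i : alternating w ->
  iter i (fun v cs q => - fDx v cs q) (fform w) = fform (negiter (fD sD) i w) /\
  alternating (negiter (fD sD) i w).
Proof.
move=> aw; elim: i => // i [IH aIH]; split; last exact/alternatingN/alternating_fD.
by rewrite iterS IH fDxE.
Qed.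

Lemma IE_E n N r w : alternating w -> theta_bounded n w -> (n <= N)%N ->
  IE r (fform w) = fun cs p => r%:R^-1 * awedge (theta 0) (Eform sD N w) cs p.
Proof.
move=> aw wn nN; apply/funext => cs; apply/funext => p; rewrite /IE.
have -> : awedge (theta 0) (Eform sD N w) cs p =
  wedge (theta 0) (fform (Eform sD N w)) cs p by rewrite wedgeE.
congr (_ * wedge _ _ _ _); apply/funext => l; apply/funext => q.
have E i : iter i (fun v cs'' q' => - fDx v cs'' q') (contract_u i (fform w)) l q =
    negiter (fD sD) i (ctr (theta i) w) l q.
  rewrite -[contract_u _ _]/(fform (ctr (theta i) w)).
  by have [->] := @iter_fDxE (ctr (theta i) w) i (@alternating_ctr _ _ _ aw).
rewrite (@fsbig_nat _ N).
  by under eq_bigr do rewrite E; rewrite /fform /Eform /Eul fct_sumE sfun_sumE.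
by move=> i Ni; rewrite E wn ?raddf0// (leq_trans nN).
Qed.

Lemma fn_mulrn_eq0 r (f : fn) : f *+ r.+1 = 0 -> f = 0.
Proof.
move=> f0; apply: sfunP => p.
have e k : (f *+ k) p = f p *+ k by elim: k => // k IH; rewrite !mulrS sfunDE IH.
by apply/eqP; have := e r.+1; rewrite f0 => /esym/eqP; rewrite mulrn_eq0.
Qed.

Lemma IE_eq0 n N r w : alternating w -> theta_bounded n w ->
  count_is is_theta r.+1 w -> (n + n < N)%N ->
  form_eq0 (IE r.+1 (fform w)) <-> Eform sD N w = 0.
Proof.
move=> aw wn wr nN; rewrite (IE_E (n := n) (N := N))//; last first.
  by rewrite (leq_trans _ (ltnW nN))// leq_addr.
split=> [h|->]; last by move=> cs p; rewrite raddf0 mulr0.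
apply: (awedge0_Eform_eq0 _ aw wn wr nN); first exact: fn_mulrn_eq0.
apply/fform_eq0 => cs p; apply/eqP; have /eqP := h cs p.
by rewrite mulf_eq0 invr_eq0 pnatr_eq0.
Qed.

End FormsOnE.

(** * Adjoints, closedness and the Hamiltonian condition in coefficients *)

Section Tensors.
Variables (V : zmodType) (D : {additive V -> V}).

(** The tensor product with theta_k. *)
Definition etens k (u : V) : nat -> V := fun j => if j == k then u else 0.

Lemma etens_is_zmod_morphism k : zmod_morphism (etens k).
Proof. by move=> u v; apply/funext => j; rewrite fctBE /etens; case: ifP; rewrite ?subr0. Qed.
HB.instance Definition _ k :=
  GRing.isZmodMorphism.Build V (nat -> V) (etens k) (etens_is_zmod_morphism k).

Lemma shD_etens k u : shD D (etens k u) = etens k.+1 u + etens k (D u).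
Proof.
apply/funext => j; rewrite fctDE /shD /etens (fun_if D) raddf0 addrC.
by case: j.
Qed.

Lemma sum_etens n (a : nat -> V) : bounded_by n a -> \sum_(k < n) etens k (a k) = a.
Proof.
move=> an; apply/funext => j; rewrite fct_sumE /etens.
have [jn|nj] := ltnP j n; last first.
  by rewrite an// big1// => i _; case: eqP => // ij; move: nj; rewrite ij leqNgt ltn_ord.
rewrite (bigD1 (Ordinal jn))//= eqxx big1 ?addr0// => i ij.
by case: eqP => // ji; case/eqP: ij; apply: val_inj.
Qed.

Definition transp (a : nat -> nat -> V) : nat -> nat -> V := fun j k => a k j.
Lemma transp_is_zmod_morphism : zmod_morphism transp. Proof. by []. Qed.
HB.instance Definition _ := GRing.isZmodMorphism.Build
  (nat -> nat -> V) (nat -> nat -> V) transp transp_is_zmod_morphism.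

Lemma transp_shD a : transp (shD (shD D) a) = shD (shD D) (transp a).
Proof.
apply/funext => j; apply/funext => k; rewrite /transp /shD !fctDE -!addrA; congr (_ + _).
by case: j => [|j]; case: k => [|k]; rewrite ?fct0E ?addr0 ?add0r// addrC.
Qed.

Lemma eq_Eul_morph (U : zmodType) (DU : {additive U -> U}) (phi : {additive U -> V}) N
    (a : nat -> U) (b : nat -> V) :
  (forall u, phi (DU u) = D (phi u)) -> (forall i, phi (a i) = b i) ->
  phi (Eul DU N a) = Eul D N b.
Proof. by move=> h ab; rewrite (Eul_morph h); congr Eul; apply/funext. Qed.

End Tensors.
Arguments etens {V} k%_N u _%_N.

Section Evaluation.
Variables (A : comPzRingType) (D : {additive A -> A}).
Hypothesis DM : forall f g, D (f * g) = D f * g + f * D g.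

(** The operator $\sum_k a_k D^k$ applied to f. *)
Definition ev M (f : A) (a : nat -> A) : A := \sum_(k < M) a k * iter k D f.

Lemma ev_is_zmod_morphism M f : zmod_morphism (ev M f).
Proof. by move=> a b; rewrite /ev -sumrB; apply: eq_bigr => k _; rewrite !fctBE mulrBl. Qed.
HB.instance Definition _ M f :=
  GRing.isZmodMorphism.Build (nat -> A) A (ev M f) (ev_is_zmod_morphism M f).

Lemma ev_shD m M f a : bounded_by m a -> (m < M)%N -> ev M f (shD D a) = D (ev M f a).
Proof.
move=> am mM; rewrite /ev raddf_sum /=.
under [RHS]eq_bigr do rewrite DM.
under eq_bigr do rewrite mulrDl.
rewrite !big_split /=; congr (_ + _); case: M mM => // M; rewrite ltnS => mM.
rewrite big_ord_recl [RHS]big_ord_recr /= mul0r add0r (am M mM) mul0r addr0.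
by apply: eq_bigr.
Qed.

Lemma bounded_negiter m a i : bounded_by m a -> bounded_by (m + i) (negiter (shD D) i a).
Proof.
move=> am; elim: i => [|i IH]; first by rewrite addn0.
by rewrite addnS => j mj; rewrite negiterS fctNE /= (bounded_shD D IH mj) oppr0.
Qed.

Lemma ev_negiter m M f a i : bounded_by m a -> (m + i <= M)%N ->
  ev M f (negiter (shD D) i a) = negiter D i (ev M f a).
Proof.
move=> am; elim: i => // i IH; rewrite addnS => mM.
rewrite !negiterS raddfN /= (@ev_shD (m + i))//; last exact: bounded_negiter.
by rewrite IH// ltnW.
Qed.

(** Why an array can stand for an adjoint operator: tensoring with theta_0 keeps
    track of the argument f, and evaluation at f commutes with D. *)
Lemma Eul_etens_ev n N M f (s : nat -> A) : bounded_by n s -> (n <= N)%N -> (N < M)%N ->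
  ev M f (Eul (shD D) N (fun i => etens 0%N (s i))) = Eul D N (fun i => s i * f).
Proof.
move=> sn nN NM; rewrite raddf_sum; apply: eq_bigr => i _.
rewrite /= (@ev_negiter 1)//; last 2 first.
- by move=> [].
- by rewrite add1n (leq_ltn_trans (ltnW (ltn_ord i))).
congr negiter; rewrite /ev; case: M NM => // M NM.
by rewrite big_ord_recl /= big1 ?addr0// => k _; rewrite mul0r.
Qed.

End Evaluation.

Section ArraysOnE.
Variable R : realType.
Local Notation fn := (sfun R nat).
Local Notation du i := (dpart (cu i)).
Local Notation sD := (svact (@eDx_sfield R)).
Local Notation D1 := (shD sD).
Local Notation D2 := (shD (shD sD)).

Definition dV1 (f : fn) : nat -> fn := fun j => du j f.
Lemma dV1_is_zmod_morphism : zmod_morphism dV1.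
Proof. by move=> f g; apply/funext => j; rewrite /dV1 raddfB. Qed.
HB.instance Definition _ :=
  GRing.isZmodMorphism.Build fn (nat -> fn) dV1 dV1_is_zmod_morphism.

Lemma dV1_sD f : dV1 (sD f) = D1 (dV1 f).
Proof. by apply/funext => j; rewrite /dV1 du_sD. Qed.

Definition dV2 (a : nat -> fn) : nat -> nat -> fn := fun j k => du j (a k).
Lemma dV2_is_zmod_morphism : zmod_morphism dV2.
Proof.
move=> a b; apply/funext => j; apply/funext => k.
by rewrite /dV2 fctBE raddfB.
Qed.
HB.instance Definition _ :=
  GRing.isZmodMorphism.Build (nat -> fn) (nat -> nat -> fn) dV2 dV2_is_zmod_morphism.

Lemma dV2_shD a : dV2 (D1 a) = D2 (dV2 a).
Proof.
apply/funext => j; apply/funext => k; rewrite /dV2 /shD !fctDE (raddfD (dpart (cu j))) /= du_sD -!addrA.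
congr (_ + _); rewrite addrC; congr (_ + _); first by case: k; rewrite ?raddf0.
by case: j.
Qed.

Variables (s : nat -> fn) (n N : nat).
Hypothesis sn : bounded_by n s.
Hypothesis dsn : forall i j, (n <= j)%N -> du j (s i) = 0.
Hypothesis nN : (n + n < N)%N.

(** Coefficients of the formal adjoint of $\sum_i s_i D_x^i$. *)
Definition adjoint_coef : nat -> fn := Eul D1 N (fun i => etens 0%N (s i)).

Definition skew := adjoint_coef = - s.

(** The coefficients of $(\chi, \psi) \mapsto \sum_{i,k} (-D_x)^i(\chi\,
    (\partial s_k/\partial u_i) D_x^k \psi)$, the adjoint of the linearization of
    $u \mapsto S(\psi)$ with psi held fixed. *)
Definition linearization_adjoint : nat -> nat -> fn := Eul D2 N (fun i => etens 0%N (fun k => du i (s k))).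

Let nN' : (n <= N)%N. Proof. by rewrite (leq_trans _ (ltnW nN))// leq_addr. Qed.

Lemma dV2_adjoint : Eul D2 N (fun m i => etens 0%N (du i (s m))) = dV2 adjoint_coef.
Proof.
apply/esym/eq_Eul_morph; first exact: dV2_shD.
move=> m; apply/funext => i; apply/funext => k.
by rewrite /= /dV2 /etens; case: ifP; rewrite ?raddf0.
Qed.

Lemma transp_dV2_adjoint :
  Eul D2 N (fun m => etens 0%N (fun k => du k (s m))) = transp (dV2 adjoint_coef).
Proof.
rewrite -dV2_adjoint; apply/esym/eq_Eul_morph; first exact: transp_shD.
move=> m; apply/funext => j; apply/funext => k.
by rewrite /= /transp /etens; case: ifP.
Qed.

Lemma transp_linearization_adjoint :
  Eul D2 N (fun i j => etens 0%N (du i (s j))) = transp linearization_adjoint.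
Proof.
apply/esym/eq_Eul_morph; first exact: transp_shD.
move=> m; apply/funext => j; apply/funext => k.
by rewrite /= /transp /etens; case: ifP.
Qed.

(** For skew-adjoint S the expression $\chi S(\psi) + \psi S(\chi)$ is a total
    derivative, hence so is its derivative in a vertical direction phi; the Euler
    expression in phi of the latter is therefore zero. *)
Lemma linearization_adjoint_antisym : skew -> transp linearization_adjoint = - linearization_adjoint.
Proof.
move=> sk; rewrite -transp_linearization_adjoint.
have := @Eul_Eul _ _ D1 D2 (fun k => etens k) (@shD_etens _ D1) n N
  (fun m i => etens 0%N (du i (s m))).
rewrite dV2_adjoint sk => /(_ _ _ nN) E.
transitivity (Eul D2 N (fun i => \sum_(k < n) etens k (etens 0%N (du i (s k))))).
  congr Eul; apply/funext => i.
  rewrite (@sum_etens _ n (fun k => etens 0%N (du i (s k))))// => k nk.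
  by rewrite sn// !raddf0.
rewrite -E.
- rewrite /linearization_adjoint -raddfN; congr Eul; apply/funext => i; rewrite fctNE -raddfN; congr etens.
  by apply/funext => k; rewrite /dV2 !fctNE raddfN.
- by move=> k nk; apply/funext => i; rewrite sn// !raddf0.
- by move=> k i ni; rewrite dsn// raddf0.
Qed.

(** The coefficients of theta_0 /\ $\sum_i s_i$ theta_i, and below those of its
    vertical differential. *)
Definition sigma_arr : nat -> nat -> fn := etens 0%N s - transp (etens 0%N s).

Definition dsigma_arr : nat -> nat -> nat -> fn := fun i j k =>
  du i (sigma_arr j k) - du j (sigma_arr i k) + du k (sigma_arr i j).

(** The obstruction to closedness: for skew-adjoint S, half of the interior Euler
    operator applied to the vertical differential of Sigma ([Eul_dsigma]). *)
Definition closure_arr : nat -> nat -> fn := linearization_adjoint - dV2 s + transp (dV2 s).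

(** The six terms of the vertical differential fall into three pairs; the members
    of a pair contribute equally because S is skew-adjoint. *)
Lemma Eul_dsigma : skew -> Eul D2 N dsigma_arr = closure_arr *+ 2.
Proof.
move=> sk.
have N0 : (0 < N)%N by rewrite (leq_ltn_trans _ nN).
have -> : dsigma_arr = (fun i => etens 0%N (fun k => du i (s k)))
   - (fun i j => etens 0%N (du i (s j)))
   - (fun i => if i == 0%N then dV2 s else 0)
   + (fun i j => etens 0%N (du j (s i)))
   + (fun i => if i == 0%N then transp (dV2 s) else 0)
   - (fun i => etens 0%N (fun k => du k (s i))).
  apply/funext => i; apply/funext => j; apply/funext => k.
  rewrite !(fctDE, fctNE) /dsigma_arr /sigma_arr /etens /transp !(fctDE, fctNE) !raddfB /=.
  have E (b : bool) (f : nat -> fn) l : (if b then f else 0) l = if b then f l else 0.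
    by case: b.
  have E2 (b : bool) (f : nat -> nat -> fn) l m : (if b then f else 0) l m = if b then f l m else 0.
    by case: b.
  rewrite !E !E2.
  have E3 (b : bool) c (f : fn) : dpart c (if b then f else 0) = if b then dpart c f else 0.
    by case: b; rewrite ?raddf0.
  rewrite !E3 /dV2; case: (j == _) (k == _) (i == _) => -[] []; ring.
rewrite !raddfD !raddfN /= !(Eul_e0 _ _ N0) dV2_adjoint transp_dV2_adjoint transp_linearization_adjoint.
rewrite (linearization_adjoint_antisym sk) sk -/linearization_adjoint !raddfN /= !opprK /closure_arr.
by rewrite mulr2n; apply/funext => j; apply/funext => k; rewrite !(fctDE, fctNE) /transp; ring.
Qed.

Variables (K : fn).
Hypothesis dKn : forall j, (n <= j)%N -> du j K = 0.
Hypothesis n0 : (0 < n)%N.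

Definition SK : fn := \sum_(i < n) s i * iter i sD K.

(** With T the evolution field, [kappa_arr] and [rho_arr] are, up to the factor
    dx and a sign in the first case, T contracted with Sigma and the (1,2)-part of
    the Lie derivative of Sigma along T, the latter by Cartan's formula. *)
Definition kappa_arr : nat -> fn := (fun j => K * s j) - etens 0%N SK.

Definition rho_arr : nat -> nat -> fn := fun i j =>
  du i (kappa_arr j) - du j (kappa_arr i) + dpart ct (sigma_arr i j) +
  \sum_(k < n) iter k sD K * dsigma_arr k i j.

(** The operator $S_t + \ell - \ell'$, where $\ell$ is the linearization of S(K) and
    $\ell'$ its formal adjoint. *)
Definition hamiltonian_arr : nat -> fn :=
  (fun j => dpart ct (s j)) + dV1 SK - Eul D1 N (fun i => etens 0%N (du i SK)).

Lemma skew_apply f : skew -> Eul sD N (fun i => f * s i) = - \sum_(i < n) s i * iter i sD f.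
Proof.
move=> sk.
have -> : (fun i => f * s i) = fun i => s i * f by apply/funext => i; rewrite mulrC.
rewrite -(@Eul_etens_ev _ sD (@svactM _ _ _) n N N.+1)//.
rewrite -/adjoint_coef sk raddfN /=; congr (- _).
rewrite /ev (@sum_bounded _ n N.+1 (fun k => s k * iter k sD f)) ?(leq_trans nN')//.
by move=> i ni; rewrite sn// mul0r.
Qed.

Lemma Eul_dV1K : skew -> Eul D1 N (fun i j => du j (K * s i)) = - dV1 SK.
Proof.
move=> sk; rewrite -raddfN /= -(skew_apply K sk); apply/esym/eq_Eul_morph => //.
exact: dV1_sD.
Qed.

(** K s and - S(K) differ by a total derivative, again because S is
    skew-adjoint. *)
Lemma Eul_dK : skew ->
  Eul D1 N (fun i j => du i (K * s j)) = - Eul D1 N (fun i => etens 0%N (du i SK)).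
Proof.
move=> sk.
have := @Eul_Eul _ _ sD D1 (fun k => etens k) (@shD_etens _ sD) n N
  (fun k i => du i (K * s k)).
rewrite Eul_dV1K// => /(_ _ _ nN) E.
transitivity (Eul D1 N (fun i => \sum_(k < n) etens k (du i (K * s k)))).
  congr Eul; apply/funext => i.
  rewrite (@sum_etens _ n (fun k => du i (K * s k)))// => k nk.
  by rewrite sn// mulr0 raddf0.
rewrite -E.
- by rewrite -[RHS]raddfN /=; congr Eul; apply/funext => i; rewrite !fctNE (raddfN (etens 0%N)).
- by move=> k nk; apply/funext => i; rewrite sn// mulr0 raddf0.
- by move=> k i ni; rewrite dpartM dKn// dsn// mul0r mulr0 addr0.
Qed.

Lemma dt_adjoint : Eul D1 N (fun i => etens 0%N (dpart ct (s i))) =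
  fun j => dpart ct (adjoint_coef j).
Proof.
pose phi (a : nat -> fn) : nat -> fn := fun j => dpart ct (a j).
have phiB : zmod_morphism phi.
  by move=> a b; apply/funext => j; rewrite /phi !fctBE raddfB.
pose mx := GRing.isZmodMorphism.Build (nat -> fn) (nat -> fn) phi phiB.
pose phi' : {additive (nat -> fn) -> (nat -> fn)} := HB.pack phi mx.
apply/esym/(@eq_Eul_morph _ _ _ _ phi').
  move=> a; apply/funext => j; rewrite /= /phi /shD raddfD /= dt_sD; congr (_ + _).
  by case: j; rewrite ?raddf0.
move=> i; apply/funext => j; rewrite /= /phi /etens.
by case: ifP; rewrite ?raddf0.
Qed.

Lemma dsigma_arr_bounded k i j : (n <= k)%N || (n <= i)%N -> dsigma_arr k i j = 0.
Proof.
have Sr a b : (n <= b)%N -> sigma_arr a b = 0.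
  move=> nb; rewrite /sigma_arr !(fctDE, fctNE) /transp /etens.
  have -> : (b == 0%N) = false by apply/eqP => b0; rewrite b0 leqNgt n0 in nb.
  by case: ifP => _; rewrite ?sn// !fct0E subr0.
have Sl a b : (n <= a)%N -> sigma_arr a b = 0.
  move=> na; have := Sr b a na; rewrite /sigma_arr !(fctDE, fctNE) /transp.
  by move=> h; apply/eqP; rewrite -oppr_eq0 opprB h.
have dS c a b : (n <= c)%N -> du c (sigma_arr a b) = 0.
  move=> nc; rewrite /sigma_arr !(fctDE, fctNE) /transp /etens raddfB /=.
  by case: ifP => _; case: ifP => _; rewrite ?dsn// ?fct0E ?raddf0 ?subr0 ?oppr0 ?addr0.
by case/orP => h; rewrite /dsigma_arr !(dS _ _ _ h) ?(Sl _ _ h) ?(Sr _ _ h) !raddf0 ?addr0 ?subr0 ?add0r ?oppr0.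
Qed.

(** T contracted with the vertical differential of Sigma integrates by parts to K
    times [closure_arr]. What remains is the vertical differential of
    K s - S(K) theta_0, which is that of -2 S(K) theta_0 up to a total derivative,
    and the time derivative of Sigma. *)
Lemma Eul_rho : skew -> closure_arr = 0 -> Eul D1 N rho_arr = hamiltonian_arr *+ 2.
Proof.
move=> sk cl; have N0 : (0 < N)%N by rewrite (leq_ltn_trans _ nN).
have -> : rho_arr = (fun i j => du i (K * s j)) - (fun i => etens 0%N (du i SK))
   - (fun i j => du j (K * s i)) + (fun i => if i == 0%N then dV1 SK else 0)
   + (fun i => if i == 0%N then (fun j => dpart ct (s j)) else 0)
   - (fun i => etens 0%N (dpart ct (s i)))
   + (fun i j => \sum_(k < n) iter k sD K * dsigma_arr k i j).
  apply/funext => i; apply/funext => j.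
  rewrite !(fctDE, fctNE) /rho_arr /kappa_arr /sigma_arr /etens /transp !(fctDE, fctNE).
  have E (b : bool) (f : nat -> fn) l : (if b then f else 0) l = if b then f l else 0.
    by case: b.
  have E3 (b : bool) c (f : fn) : dpart c (if b then f else 0) = if b then dpart c f else 0.
    by case: b; rewrite ?raddf0.
  rewrite !E !raddfB /= !E3 /dV1; case: (j == _) (i == _) => -[]; ring.
have Z : Eul D1 N (fun i j => \sum_(k < n) iter k sD K * dsigma_arr k i j) = 0.
  pose phi k (a : nat -> fn) : nat -> fn := fun j => iter k sD K * a j.
  have phiB k : zmod_morphism (phi k).
    by move=> a b; apply/funext => j; rewrite /phi !fctBE mulrBr.
  pose mx k := GRing.isZmodMorphism.Build (nat -> fn) (nat -> fn) (phi k) (phiB k).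
  pose phi' k : {additive (nat -> fn) -> (nat -> fn)} := HB.pack (phi k) (mx k).
  have := @Eul_Eul _ _ D1 D1 phi' _ n N dsigma_arr.
  rewrite (Eul_dsigma sk) cl mul0rn => E.
  transitivity (Eul D1 N (fun i => \sum_(k < n) phi' k (dsigma_arr k i))).
    by congr Eul; apply/funext => i; rewrite fct_sumE.
  rewrite -E//.
  - transitivity (Eul D1 N (0 : nat -> nat -> fn)); last exact: raddf0.
    by congr Eul; apply/funext => i; rewrite raddf0.
  - move=> k u; apply/funext => j; rewrite /= /phi /shD !fctDE /= svactM mulrDr.
    rewrite addrA; congr (_ + _); by case: j; rewrite ?mulr0.
  - move=> k nk; apply/funext => i; apply/funext => j.
    by apply: dsigma_arr_bounded; rewrite nk.
  - by move=> k i ni; apply/funext => j; apply: dsigma_arr_bounded; rewrite ni orbT.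
rewrite !raddfD !raddfN /= !(Eul_e0 _ _ N0) Z addr0 (Eul_dK sk) (Eul_dV1K sk) dt_adjoint sk.
rewrite opprK /hamiltonian_arr; apply/funext => j; rewrite mulr2n !(fctDE, fctNE) raddfN /=.
ring.
Qed.


End ArraysOnE.

(** * The two-form of an operator and its vertical differential *)

Section SymplecticForm.
Variable R : realType.
Local Notation fn := (sfun R nat).
Local Notation aform := (seq coframe -> fn).
Local Notation du i := (@dpart R nat (cu (i : nat))).
Local Notation sD := (svact (@eDx_sfield R)).
Implicit Types (w : aform) (c : coframe) (l : seq coframe) (f : fn).

Definition scale_form f w : aform := fun l => f * w l.

Lemma scale_form_is_zmod_morphism f : zmod_morphism (scale_form f).
Proof. by move=> v w; apply/funext => l; rewrite /scale_form !fctBE mulrBr. Qed.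
HB.instance Definition _ f :=
  GRing.isZmodMorphism.Build aform aform (scale_form f) (scale_form_is_zmod_morphism f).

Lemma alternating_scale_form f w : alternating w -> alternating (scale_form f w).
Proof. by move=> aw a b l1 l2; rewrite /scale_form aw mulrN. Qed.

Lemma count_is_scale_form P k f w : count_is P k w -> count_is P k (scale_form f w).
Proof. by move=> hw l hl; rewrite /scale_form hw// mulr0. Qed.

Lemma alternating_Eform N w : alternating w -> alternating (Eform sD N w).
Proof.
move=> aw; apply: alternating_sum => i _.
by have [_] := @iter_fDxE R (ctr (theta i) w) i (@alternating_ctr _ _ _ aw).
Qed.

Lemma count_is_negiter (P : pred coframe) k i w :
  (forall c c', cpred c = Some c' -> P c' = P c) -> count_is P k w ->
  count_is P k (negiter (fD sD) i w).
Proof. by move=> hP hw; elim: i => // i IH; apply/count_isN/count_is_fD. Qed.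

Definition type1 r w :=
  [/\ alternating w, count_is is_dt 0 w, count_is is_dx 1 w & count_is is_theta r w].

Lemma type1_Eform r N w : type1 r.+1 w -> type1 r (Eform sD N w).
Proof.
move=> [aw wt wx wr]; split; first exact: alternating_Eform.
- apply: count_is_sum => i _; apply: count_is_negiter; first by case=> [||[]] // ? ? [<-].
  exact: count_is_ctr.
- apply: count_is_sum => i _; apply: count_is_negiter; first by case=> [||[]] // ? ? [<-].
  exact: count_is_ctr.
- apply: count_is_sum => i _; apply: count_is_negiter; first by case=> [||[]] // ? ? [<-].
  exact: count_is_ctr.
Qed.

(** By antisymmetry a form of type (1,1) is known from its values on dx, theta_j,
    so the vanishing of I_E becomes an equation between arrays; the same holds in
    the next degree. *)
Lemma IE2_eq0 n N w : type1 2 w -> theta_bounded n w -> (n + n < N)%N ->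
  form_eq0 (IE 2 (fform w)) <-> Eul (shD sD) N (arr2 (ctr dx w)) = 0.
Proof.
move=> tw wn nN; have [aw _ _ wr] := tw; rewrite (IE_eq0 aw wn wr nN).
have e : arr1 (ctr dx (Eform sD N w)) = - Eul (shD sD) N (arr2 (ctr dx w)).
  by rewrite ctr_dx_Eform// raddfN /= arr1_Eform.
split=> [h|h].
  by apply/eqP; rewrite -oppr_eq0 -e h raddf0.
have [aE Et Ex Er] := type1_Eform N tw; apply: (alternating_eq0 aE Et Ex Er) => -[|j []]// _.
by have := congr1 (@^~ j) e; rewrite h oppr0.
Qed.

Lemma IE3_eq0 n N w : type1 3 w -> theta_bounded n w -> (n + n < N)%N ->
  form_eq0 (IE 3 (fform w)) <->
  Eul (shD (shD sD)) N (fun i j k => ctr dx w [:: theta i; theta j; theta k]) = 0.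
Proof.
move=> tw wn nN; have [aw _ _ wr] := tw; rewrite (IE_eq0 aw wn wr nN).
have e : arr2 (ctr dx (Eform sD N w)) =
    - Eul (shD (shD sD)) N (fun i j k => ctr dx w [:: theta i; theta j; theta k]).
  by rewrite ctr_dx_Eform// raddfN /= arr2_Eform.
split=> [h|h].
  by apply/eqP; rewrite -oppr_eq0 -e h !raddf0.
have [aE Et Ex Er] := type1_Eform N tw; apply: (alternating_eq0 aE Et Ex Er) => -[|j [|k []]]// _.
by have := congr1 (fun a => a j k) e; rewrite h oppr0.
Qed.

Definition adV n w : aform := \sum_(i < n) awedge (theta i) (cmap (du i) w).

Lemma dVE n w : (forall i l, (n <= i)%N -> du i (w l) = 0) ->
  dV (fform w) = fform (adV n w).
Proof.
move=> wn; apply/funext => l; apply/funext => p; rewrite /dV.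
have E i : wedge (theta i) (fun cs' => partial (cu i) (fform w cs')) l p =
    awedge (theta i) (cmap (du i) w) l p.
  by rewrite -[(fun cs' => _)]/(fform (cmap (du i) w)) wedgeE.
rewrite (@fsbig_nat _ n) => [|i ni].
  by under eq_bigr do rewrite E; rewrite /fform /adV fct_sumE sfun_sumE.
rewrite E (_ : cmap (du i) w = 0) ?raddf0//.
by apply/funext => cs; rewrite /cmap wn.
Qed.

Lemma ctr_cmap (g : fn -> fn) c w : ctr c (cmap g w) = cmap g (ctr c w).
Proof. by []. Qed.

Lemma ctr_adV_dx n w : ctr dx (adV n w) = - adV n (ctr dx w).
Proof.
rewrite /adV raddf_sum -sumrN; apply: eq_bigr => i _.
by rewrite /= ctr_awedge sub0r ctr_cmap.
Qed.

Lemma type1_adV n r w : type1 r w -> type1 r.+1 (adV n w).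
Proof.
move=> [aw wt wx wr]; split.
- by apply: alternating_sum => i _; apply: alternating_awedge; exact: (@alternating_cmap _ (du i)).
- by apply: count_is_sum => i _; apply: (@count_is_awedge _ is_dt 0 (theta i)); exact: (@count_is_cmap _ (du i)).
- by apply: count_is_sum => i _; apply: (@count_is_awedge _ is_dx 1 (theta i)); exact: (@count_is_cmap _ (du i)).
- by apply: count_is_sum => i _; apply: (@count_is_awedge _ is_theta r (theta i)); exact: (@count_is_cmap _ (du i)).
Qed.

Lemma theta_bounded_adV m n w : (m <= n)%N -> theta_bounded m w -> theta_bounded n (adV n w).
Proof.
move=> mn wm i ni; rewrite /adV raddf_sum big1// => k _ /=.
rewrite ctr_awedge ctr_cmap wm ?(leq_trans mn)//.
case: eqP => [[ik]|_]; first by move: ni; rewrite ik leqNgt ltn_ord.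
have -> : cmap (du k) 0 = 0 by apply/funext => l; exact: (raddf0 (du k)).
by rewrite raddf0 add0r ?oppr0.
Qed.

Lemma sum_theta_eq n j (F : nat -> fn) : bounded_by n F ->
  \sum_(k < n) (if theta j == theta k then F k else 0) = F j.
Proof.
move=> Fn; have [jn|nj] := ltnP j n; last first.
  rewrite Fn// big1// => k _; case: eqP => // -[jk].
  by move: nj; rewrite jk leqNgt ltn_ord.
rewrite (bigD1 (Ordinal jn))//= eqxx big1 ?addr0// => i ij.
by case: eqP => // -[ji]; case/eqP: ij; apply: val_inj; rewrite /= ji.
Qed.

Lemma adV2 n w i j : (forall k l, (n <= k)%N -> du k (w l) = 0) ->
  adV n w [:: theta i; theta j] = du i (w [:: theta j]) - du j (w [:: theta i]).
Proof.
move=> wn; rewrite /adV fct_sumE.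
under eq_bigr do rewrite !awedge_cons /= subr0.
by rewrite sumrB /cmap /ctr !(@sum_theta_eq n _ (fun k => du k (w _)))// => k nk; exact: wn.
Qed.

Lemma adV3 n w i j k : (forall k l, (n <= k)%N -> du k (w l) = 0) ->
  adV n w [:: theta i; theta j; theta k] =
  du i (w [:: theta j; theta k]) - du j (w [:: theta i; theta k]) + du k (w [:: theta i; theta j]).
Proof.
move=> wn; rewrite /adV fct_sumE.
under eq_bigr do rewrite !awedge_cons /= subr0 opprB addrA.
rewrite sumrB big_split /= /cmap /ctr.
rewrite !(@sum_theta_eq n _ (fun k => du k (w _)))//; first by rewrite addrAC.
all: by move=> ? ?; exact: wn.
Qed.

Definition unit_form : aform := fun l => if l is [::] then 1 else 0.
Definition operator_form m (s : nat -> fn) : aform :=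
  \sum_(i < m) scale_form (s i) (awedge (theta i) unit_form).
Definition vertical_Sigma m s : aform := awedge (theta 0) (operator_form m s).
Definition aSigma m s : aform := awedge dx (vertical_Sigma m s).

Variables (s : nat -> fn) (m : nat).
Hypothesis sm : bounded_by m s.

Lemma SigmaE : Sigma s = fform (aSigma m s).
Proof.
rewrite -wedgeE -wedgeE /Sigma; congr (wedge _ (wedge _ _)).
apply/funext => l; apply/funext => p.
have form1E : @form1 R = fform unit_form by apply/funext => -[].
rewrite form1E (@fsbig_nat _ m) => [|i mi]; last by rewrite sm// sfun0E mul0r.
rewrite /fform /operator_form fct_sumE sfun_sumE; apply: eq_bigr => i _.
by rewrite wedgeE.
Qed.

Lemma alternating_unit_form : alternating unit_form.
Proof. by move=> a b [|c l1] l2; rewrite /= oppr0. Qed.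

Lemma count_is_unit_form (P : pred coframe) : count_is P 0 unit_form.
Proof. by case. Qed.

Lemma alternating_vertical_Sigma : alternating (vertical_Sigma m s).
Proof.
apply/alternating_awedge/alternating_sum => i _.
exact/alternating_scale_form/alternating_awedge/alternating_unit_form.
Qed.

Lemma count_is_vertical_Sigma (P : pred coframe) :
  (forall i, P (theta i) = P (theta 0)) ->
  count_is P (P (theta 0) + (P (theta 0) + 0))%N (vertical_Sigma m s).
Proof.
move=> hP; apply/count_is_awedge/count_is_sum => i _; apply: count_is_scale_form.
by rewrite -(hP i); apply/count_is_awedge/count_is_unit_form.
Qed.

Lemma type1_aSigma : type1 2 (aSigma m s).
Proof.
split; first exact/alternating_awedge/alternating_vertical_Sigma.
- by apply: (@count_is_awedge _ is_dt 0 dx); exact: (@count_is_vertical_Sigma is_dt).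
- by apply: (@count_is_awedge _ is_dx 0 dx); exact: (@count_is_vertical_Sigma is_dx).
- by apply: (@count_is_awedge _ is_theta 2 dx); exact: (@count_is_vertical_Sigma is_theta).
Qed.

Lemma ctr_dx_aSigma : ctr dx (aSigma m s) = vertical_Sigma m s.
Proof.
rewrite ctr_awedge eqxx; have -> : ctr dx (vertical_Sigma m s) = 0.
  by apply: (@count_is_ctr0 _ is_dx) => //; exact: (@count_is_vertical_Sigma is_dx).
by rewrite raddf0 subr0.
Qed.

Lemma operator_form1 j : operator_form m s [:: theta j] = s j.
Proof.
rewrite /operator_form fct_sumE -[RHS](@sum_theta_eq m _ s)//.
apply: eq_bigr => i _; rewrite /scale_form awedge_cons subr0 /=.
by case: eqP; rewrite ?mulr1 ?mulr0.
Qed.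

Lemma vertical_Sigma2 j k : vertical_Sigma m s [:: theta j; theta k] = sigma_arr s j k.
Proof.
rewrite /vertical_Sigma !awedge_cons /= subr0 /ctr !operator_form1 /sigma_arr.
rewrite fctBE /transp /etens fctBE.
have E i : (theta i == theta 0) = (i == 0%N) by apply/eqP/eqP => [[]|->].
by rewrite !E; case: (j == 0%N) (k == 0%N) => -[].
Qed.

Lemma theta_bounded_aSigma : (0 < m)%N -> theta_bounded m (aSigma m s).
Proof.
move=> m0 i mi; have E : ctr (theta i) (vertical_Sigma m s) = 0.
  rewrite ctr_awedge.
  have -> : (theta i == theta 0) = false by apply/eqP => -[i0]; rewrite i0 leqNgt m0 in mi.
  rewrite sub0r /operator_form raddf_sum /= big1 ?raddf0 ?oppr0// => k _.
  rewrite -[ctr _ (scale_form _ _)]/(scale_form _ (ctr _ _)) ctr_awedge.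
  case: eqP => [[ik]|_]; first by move: mi; rewrite ik leqNgt ltn_ord.
  have -> : ctr (theta i) unit_form = 0 by [].
  by rewrite raddf0 subr0 raddf0.
by rewrite ctr_awedge /= E raddf0 subr0.
Qed.

Lemma du_awedge k c w : (forall l, du k (w l) = 0) -> forall l, du k (awedge c w l) = 0.
Proof.
move=> h l; elim: l w h => [|c' l IH] w h; first by rewrite raddf0.
rewrite awedge_cons raddfB /= IH; last by move=> l'; exact: h.
by case: ifP; rewrite ?h ?raddf0 ?subr0 ?addr0 ?oppr0.
Qed.

Lemma du_aSigma k : (forall i, du k (s i) = 0) -> forall l, du k (aSigma m s l) = 0.
Proof.
move=> h l; apply: du_awedge => {}l; apply: du_awedge => {}l.
rewrite /operator_form fct_sumE raddf_sum big1// => i _.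
rewrite /scale_form /= dpartM h mul0r add0r; rewrite du_awedge ?mulr0// => l'.
by rewrite /unit_form; case: l' => *; rewrite ?dpart1 ?raddf0.
Qed.

Variables (n N : nat).
Hypothesis m0 : (0 < m)%N.
Hypothesis mn : (m <= n)%N.
Hypothesis dsn : forall i j, (n <= j)%N -> du j (s i) = 0.
Hypothesis nN : (n + n < N)%N.

Let sn : bounded_by n s := bounded_byW mn sm.

Lemma adV_vertical_Sigma3 i j k :
  adV n (vertical_Sigma m s) [:: theta i; theta j; theta k] = dsigma_arr s i j k.
Proof.
rewrite adV3 ?vertical_Sigma2// => a l na; rewrite -ctr_dx_aSigma; apply: du_aSigma.
by move=> b; exact: dsn.
Qed.

Lemma deltaV_eq0 : form_eq0 (deltaV 2 (Sigma s)) <-> Eul (shD (shD sD)) N (dsigma_arr s) = 0.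
Proof.
rewrite /deltaV SigmaE (@dVE n); last by move=> i l ni; apply: du_aSigma => k; exact: dsn.
rewrite (@IE3_eq0 n N)//; first last.
- exact/(theta_bounded_adV mn)/theta_bounded_aSigma.
- exact/type1_adV/type1_aSigma.
rewrite ctr_adV_dx ctr_dx_aSigma.
have -> : (fun i j k => (- adV n (vertical_Sigma m s)) [:: theta i; theta j; theta k]) =
    - dsigma_arr s.
  apply/funext => i; apply/funext => j; apply/funext => k.
  by rewrite !fctNE adV_vertical_Sigma3.
rewrite raddfN /=; split=> [/eqP|->]; last by rewrite oppr0.
by rewrite oppr_eq0 => /eqP.
Qed.

End SymplecticForm.

(** * The Lie derivative along the evolution field *)

Section LieDerivative.
Variable R : realType.
Local Notation fn := (sfun R nat).
Local Notation aform := (seq coframe -> fn).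
Local Notation du i := (@dpart R nat (cu (i : nat))).
Local Notation sD := (svact (@eDx_sfield R)).
Implicit Types (w : aform) (c : coframe) (l : seq coframe) (f : fn).

Lemma iter_eDxE i f : iter i (@eDx R) f = iter i sD f.
Proof. by elim: i => // i IH; rewrite !iterS IH eDxE. Qed.

Definition adE n w : aform :=
  awedge dt (cmap (dpart ct) w) + awedge dx (fD sD w) + adV n w.

Lemma dE_E n w : alternating w -> (forall i l, (n <= i)%N -> du i (w l) = 0) ->
  dE (fform w) = fform (adE n w).
Proof.
move=> aw wn; apply/funext => l; apply/funext => p.
rewrite /dE /dH fDxE// (dVE wn) wedgeE.
by rewrite -[(fun cs' => partial ct _)]/(fform (cmap (dpart ct) w)) wedgeE.
Qed.

Definition acontr n (K : fn) w : aform :=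
  ctr dt w + \sum_(k < n) scale_form (iter k sD K) (ctr (theta k) w).

Lemma contractE n (K : fn) w : theta_bounded n w ->
  contract (T_field K) (fform w) = fform (acontr n K w).
Proof.
move=> wn; apply/funext => l; apply/funext => p; rewrite /contract /=.
rewrite mul1r mul0r addr0 /acontr /fform fctDE sfunDE; congr (_ + _).
have E i : (iter i (@eDx R) K p - p (cu i.+1) * 0) * w (theta i :: l) p =
    scale_form (iter i sD K) (ctr (theta i) w) l p.
  by rewrite mulr0 subr0 iter_eDxE.
rewrite (@fsbig_nat _ n) => [|i ni].
  by under eq_bigr do rewrite E; rewrite fct_sumE sfun_sumE.
by rewrite E wn// raddf0.
Qed.

Lemma theta_bounded_adE n w : alternating w -> (forall i l, (n <= i)%N -> du i (w l) = 0) ->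
  theta_bounded n w -> theta_bounded n.+1 (adE n w).
Proof.
move=> aw wn tw i ni.
have cz : cmap (dpart ct) 0 = 0 :> aform by apply/funext => l; exact: (raddf0 (dpart ct)).
have e2 : ctr (theta i) (fD sD w) = 0.
  rewrite ctr_fD tw ?(ltnW ni)// (raddf0 (fD sD)) add0r.
  by case: i ni => [|i] ni //; rewrite /= tw.
rewrite /adE !raddfD /= !ctr_awedge /= ctr_cmap tw ?(ltnW ni)// cz e2 !raddf0.
by rewrite (theta_bounded_adV (leqnn n))// ?(ltnW ni)// !addr0 ?subr0 ?oppr0.
Qed.

Variables (s : nat -> fn) (m n N : nat) (K : fn).
Hypothesis sm : bounded_by m s.
Hypothesis m0 : (0 < m)%N.
Hypothesis mn : (m <= n)%N.
Hypothesis dsn : forall i j, (n <= j)%N -> du j (s i) = 0.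
Hypothesis dKn : forall i j, (i < m)%N -> (n <= j)%N -> du j (iter i sD K) = 0.
Hypothesis nN : (n + n < N)%N.

Local Notation Sig := (aSigma m s).

Let tSig : type1 2 Sig := type1_aSigma s m.
Let aSig : alternating Sig. Proof. by case: tSig. Qed.
Let bSig : theta_bounded m Sig := theta_bounded_aSigma s m0.
Let dSig i l : (n <= i)%N -> du i (Sig l) = 0.
Proof. by move=> ni; apply: du_aSigma => k; exact: dsn. Qed.

(** [kappa_form] is T contracted with Sigma. On entries without dt and with one
    dx, only the vertical differential of it survives in Cartan's formula, and
    contraction with d/dt of the dt part of d Sigma gives the time derivative. *)
Definition kappa_form : aform := \sum_(k < m) scale_form (iter k sD K) (ctr (theta k) Sig).

Definition lie_form : aform :=
  adV n kappa_form + \sum_(k < n) scale_form (iter k sD K) (ctr (theta k) (adV n Sig))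
  + cmap (dpart ct) Sig.

Lemma acontr_aSigma : acontr m K Sig = kappa_form.
Proof.
rewrite /acontr (_ : ctr dt Sig = 0) ?add0r//.
by have [_ h _ _] := tSig; apply: (@count_is_ctr0 _ is_dt).
Qed.

Lemma type1_kappa : type1 1 kappa_form.
Proof.
have [aw wt wx wr] := tSig; split.
- by apply: alternating_sum => i _; apply: alternating_scale_form; exact: alternating_ctr.
- by apply: count_is_sum => i _; apply: count_is_scale_form; exact: (@count_is_ctr _ is_dt 0 (theta i)).
- by apply: count_is_sum => i _; apply: count_is_scale_form; exact: (@count_is_ctr _ is_dx 1 (theta i)).
- by apply: count_is_sum => i _; apply: count_is_scale_form; exact: (@count_is_ctr _ is_theta 1 (theta i)).
Qed.

Lemma du_kappa i l : (n <= i)%N -> du i (kappa_form l) = 0.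
Proof.
move=> ni; rewrite /kappa_form fct_sumE raddf_sum big1// => k _.
by rewrite /scale_form /ctr /= dpartM dSig// dKn// mul0r mulr0 addr0.
Qed.

Lemma theta_bounded_kappa : theta_bounded n kappa_form.
Proof.
move=> i ni; rewrite /kappa_form raddf_sum big1// => k _ /=.
rewrite /= -[ctr _ (scale_form _ _)]/(scale_form _ (ctr _ _)) alternating_ctr2// bSig ?(leq_trans mn)//.
by rewrite !raddf0 ?oppr0 ?raddf0.
Qed.

Lemma type1_lie_form : type1 2 lie_form.
Proof.
have [a1 t1 x1 r1] := type1_adV n type1_kappa.
have [a2 t2 x2 r2] := type1_adV n tSig.
have [a3 t3 x3 r3] := tSig.
split; rewrite /lie_form.
- apply: alternatingD; last exact: (@alternating_cmap _ (dpart ct)).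
  apply: alternatingD => //; apply: alternating_sum => i _.
  by apply: alternating_scale_form; exact: alternating_ctr.
- apply: count_isD; last exact: (@count_is_cmap _ (dpart ct)).
  apply: count_isD => //; apply: count_is_sum => i _; apply: count_is_scale_form.
  exact: (@count_is_ctr _ is_dt 0 (theta i)).
- apply: count_isD; last exact: (@count_is_cmap _ (dpart ct)).
  apply: count_isD => //; apply: count_is_sum => i _; apply: count_is_scale_form.
  exact: (@count_is_ctr _ is_dx 1 (theta i)).
- apply: count_isD; last exact: (@count_is_cmap _ (dpart ct)).
  apply: count_isD => //; apply: count_is_sum => i _; apply: count_is_scale_form.
  exact: (@count_is_ctr _ is_theta 2 (theta i)).
Qed.

Lemma theta_bounded_lie_form : theta_bounded n lie_form.
Proof.
move=> i ni; rewrite /lie_form !(raddfD (ctr (theta i))) /=.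
rewrite (theta_bounded_adV (leqnn n) theta_bounded_kappa)// add0r (raddf_sum (ctr (theta i))) big1 => [|k _].
  rewrite add0r ctr_cmap bSig ?(leq_trans mn)//.
  by apply/funext => l; exact: (raddf0 (dpart ct)).
have [a2 _ _ _] := type1_adV n tSig.
rewrite /= -[ctr _ (scale_form _ _)]/(scale_form _ (ctr _ _)) alternating_ctr2//.
by rewrite (theta_bounded_adV mn bSig)// !raddf0 ?oppr0 ?raddf0.
Qed.

Lemma count_dtE l : count_mem dt l = count is_dt l.
Proof. by apply: eq_count => -[]. Qed.
Lemma count_dxE l : count_mem dx l = count is_dx l.
Proof. by apply: eq_count => -[]. Qed.
Lemma size_count l : size l = (count is_dt l + count is_dx l + count is_theta l)%N.
Proof. by elim: l => // -[||i] l /= ->; lia. Qed.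

Lemma lieE l p : count is_dt l = 0%N -> count is_dx l = 1%N ->
  lie (T_field K) (fform Sig) l p = lie_form l p.
Proof.
move=> lt lx; have dtl : dt \notin l.
  by rewrite -has_pred1 has_count count_dtE lt.
have [aw wt wx wr] := tSig; have [ak kt kx kr] := type1_kappa.
have [_ vt _ _] := type1_adV n tSig.
rewrite /lie (contractE K bSig) acontr_aSigma (@dE_E n)//; first last.
  by move=> i k ni; exact: du_kappa.
rewrite (@dE_E n)// (@contractE n.+1); last first.
  apply: theta_bounded_adE => // i ni; apply: bSig; exact: leq_trans ni.
(* The terms dx /\ D_x(-) of the exterior derivative would need two entries
   dx. *)
have dxdx w k : count_is is_dx 1 w -> count is_dx k = 1%N -> awedge dx w k = 0.
  by move=> hw hk; apply: (@count_is_awedge _ is_dx 1 dx) => //; rewrite hk.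
have fDx w : count_is is_dx 1 w -> count_is is_dx 1 (fD sD w).
  by move=> hw; apply: count_is_fD => // -[||[]] // ? ? [<-].
have adE0 w c k : count_is is_dx 1 w -> count is_dx (c :: k) = 1%N ->
    dt \notin c :: k -> adE n w (c :: k) = adV n w (c :: k).
  move=> hw hk dtk; rewrite -[LHS]/(awedge dt _ _ + awedge dx _ _ + adV n w _).
  by rewrite awedge_notin// dxdx ?add0r//; exact: fDx.
transitivity ((adE n kappa_form l + acontr n.+1 K (adE n Sig) l) p); first by [].
congr (sval_fun _ p).
have -> : adE n kappa_form l = adV n kappa_form l.
  by case: l lt lx dtl => // c k lt lx dtl; exact: adE0.
rewrite -[RHS]/(adV n kappa_form l + _ + dpart ct (Sig l)) -addrA; congr (_ + _).
rewrite -[LHS]/(adE n Sig (dt :: l) + _) [LHS]addrC; congr (_ + _); last first.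
  rewrite -[LHS]/(awedge dt _ (dt :: l) + awedge dx _ (dt :: l) + adV n Sig _).
  rewrite vt// ?addr0.
  rewrite dxdx ?addr0//; last exact: fDx.
  by rewrite awedge_cons eqxx awedge_notin// subr0.
rewrite fct_sumE [in RHS]fct_sumE big_ord_recr /=.
have E k : scale_form (iter k sD K) (ctr (theta k) (adE n Sig)) l =
           scale_form (iter k sD K) (ctr (theta k) (adV n Sig)) l.
  by rewrite /scale_form /ctr adE0// inE negb_or dtl.
rewrite !E (theta_bounded_adV mn bSig)// raddf0 addr0.
by apply: eq_bigr => k _; rewrite E.
Qed.

Lemma proj_lieE : proj_rs 1 2 (lie (T_field K) (Sigma s)) = fform lie_form.
Proof.
have [_ h1 h2 h3] := type1_lie_form.
apply/funext => l; apply/funext => p; rewrite /proj_rs (SigmaE sm) count_dtE count_dxE.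
case: ifP => [/and3P[_ /eqP lt /eqP lx]|]; first exact: lieE.
have [lt|/h1 h] := eqVneq (count is_dt l) 0%N; last by rewrite /fform h.
have [lx|/h2 h] := eqVneq (count is_dx l) 1%N; last by rewrite /fform h.
have [lr|/h3 h] := eqVneq (count is_theta l) 2%N; last by rewrite /fform h.
by rewrite size_count lt lx lr.
Qed.

Lemma kappa_form1 j : ctr dx kappa_form [:: theta j] = - kappa_arr s n K j.
Proof.
rewrite /kappa_form raddf_sum fct_sumE /kappa_arr.
have e k : ctr dx (scale_form (iter k sD K) (ctr (theta k) Sig)) [:: theta j] =
   - (iter k sD K * sigma_arr s k j).
  rewrite /= -[ctr _ (scale_form _ _)]/(scale_form _ (ctr _ _)) alternating_ctr2// ctr_dx_aSigma.
  by rewrite /scale_form fctNE mulrN /ctr vertical_Sigma2.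
under eq_bigr do rewrite /= e.
rewrite sumrN; congr (- _); rewrite /sigma_arr !fctBE /transp /etens.
under eq_bigr do rewrite !fctBE mulrBr.
rewrite sumrB; congr (_ - _).
  case: m m0 => // m' _; rewrite big_ord_recl /= big1 ?addr0// => i _.
  by rewrite mulr0.
case: ifP => _; last by rewrite big1// => i _; rewrite mulr0.
rewrite /SK (@sum_bounded _ m n (fun i => s i * iter i sD K))//; last first.
  by move=> i mi; rewrite sm// mul0r.
by apply: eq_bigr => i _; rewrite mulrC.
Qed.

Lemma arr2_lie_form : arr2 (ctr dx lie_form) = rho_arr s n K.
Proof.
apply/funext => i; apply/funext => j; rewrite /arr2 /lie_form !(raddfD (ctr dx)) !fctDE /=.
rewrite ctr_adV_dx fctNE adV2; last by move=> k l nk; exact: du_kappa.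
rewrite !kappa_form1 (raddfN (du i)) (raddfN (du j)) /= opprB opprK [- _ + _]addrC.
rewrite /rho_arr addrAC; congr (_ + _ + _).
  by rewrite ctr_cmap ctr_dx_aSigma /cmap vertical_Sigma2.
rewrite (raddf_sum (ctr dx)) fct_sumE.
apply: eq_bigr => k _; have [aw _ _ _] := type1_adV n tSig.
rewrite /= -[ctr _ (scale_form _ _)]/(scale_form _ (ctr _ _)) alternating_ctr2//.
rewrite /scale_form fctNE ctr_adV_dx (raddfN (ctr (theta k))) fctNE opprK ctr_dx_aSigma.
by rewrite /= /ctr (adV_vertical_Sigma3 sm dsn).
Qed.

Lemma hamiltonian_eq0 :
  symplectic_hamiltonian K s <-> Eul (shD sD) N (rho_arr s n K) = 0.
Proof.
rewrite /symplectic_hamiltonian proj_lieE (@IE2_eq0 _ n N)//.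
- by rewrite arr2_lie_form.
- exact: type1_lie_form.
- exact: theta_bounded_lie_form.
Qed.

End LieDerivative.

(** * Symplectic Hamiltonian systems as equations on coefficients *)

Section TestFunctions.
Variables (A : comPzRingType) (D : {additive A -> A}).
Hypothesis DM : forall f g, D (f * g) = D f * g + f * D g.

Lemma derivation1 : D 1 = 0.
Proof.
have h := DM 1 1; rewrite !mulr1 mul1r in h.
by move/eqP: h; rewrite -subr_eq0 opprD addNKr oppr_eq0 => /eqP.
Qed.

Lemma derivation_exp y k : D y = 1 -> D (y ^+ k) = y ^+ k.-1 *+ k.
Proof.
move=> Dy; elim: k => [|k IH]; first by rewrite expr0 derivation1 mulr0n.
rewrite exprS DM Dy mul1r IH mulrnAr /= mulrS; congr (_ + _).
by case: k {IH} => // k; rewrite /= -exprS.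
Qed.

Lemma iter_derivation_exp y k j : D y = 1 ->
  iter j D (y ^+ k) = y ^+ (k - j) *+ (k ^_ j).
Proof.
move=> Dy; elim: j => [|j IH]; first by rewrite subn0 ffactn0 mulr1n.
by rewrite iterS IH raddfMn /= derivation_exp// -mulrnA subnS ffactnSr mulnC.
Qed.

End TestFunctions.

Section SkewAdjoint.
Variable R : realType.
Local Notation fn := (sfun R nat).
Local Notation du i := (@dpart R nat (cu (i : nat))).
Local Notation sD := (svact (@eDx_sfield R)).

Lemma sfun_natmulE (A : choiceType) (f : sfun R A) k p : (f *+ k) p = f p *+ k.
Proof. by elim: k => // k IH; rewrite !mulrS sfunDE IH. Qed.

Lemma sfun_expE (A : choiceType) (f : sfun R A) k p : (f ^+ k) p = f p ^+ k.
Proof. by elim: k => // k IH; rewrite !exprS sfunME IH. Qed.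

(** At a point with first coordinates (t0, x0) the function (x - x0)^k isolates
    k! times the coefficient of D_x^k. *)
Lemma ev_inj M (a : nat -> fn) : bounded_by M a -> (forall f, ev sD M f a = 0) -> a = 0.
Proof.
move=> aM h; apply/funext => k; have [/aM//|kM] := leqP M k; apply: sfunP => p.
pose y : fn := scoord R cx - sconst nat (p cx).
have Dy : sD y = 1.
  rewrite raddfB /= svact_coord /=.
  have -> : sconst nat (p cx) = 1 * sconst nat (p cx) by rewrite mul1r.
  have [cs ucs fcs] := smooth_depends (smooth_sfun (sconst nat (p cx))).
  rewrite mul1r (svactE _ ucs fcs) big1 ?subr0// => c _.
  by rewrite dpart_const mulr0.
have V j : iter j sD (y ^+ k) p = if j == k then k`!%:R else 0.
  rewrite (iter_derivation_exp (@svactM _ _ _))// sfun_natmulE sfun_expE.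
  rewrite [y p]sfunDE sfunNE subrr expr0n subn_eq0.
  have [->|jk] := eqVneq j k; first by rewrite leqnn ffactnn.
  have [kj|jk'] := leqP k j; last by rewrite mul0rn.
  by rewrite ffact_small ?mulr0n// ltn_neqAle kj eq_sym jk.
have := congr1 (fun f : fn => f p) (h (y ^+ k)); rewrite /ev sfun_sumE.
under eq_bigr do rewrite sfunME V.
rewrite (bigD1 (Ordinal kM))//= eqxx big1 ?addr0 => [/eqP|j jk].
  by rewrite mulf_eq0 pnatr_eq0 eqn0Ngt fact_gt0 orbF => /eqP.
rewrite ifF ?mulr0//; apply: contraNF jk => /eqP jk; exact/eqP/val_inj.
Qed.

Variables (s : nat -> fn) (n N : nat).
Hypothesis sn : bounded_by n s.
Hypothesis nN : (n < N)%N.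

Lemma op_eE (f : fn) p : op_e s f p = (\sum_(i < n) s i * iter i sD f) p.
Proof.
rewrite /op_e (@fsbig_nat _ n) => [|i ni]; last by rewrite sn// mul0r.
by rewrite sfun_sumE; apply: eq_bigr => i _; rewrite iter_eDxE.
Qed.

Lemma adjoint_opE (f : fn) p : adjoint_op s f p = Eul sD N (fun i => s i * f) p.
Proof.
have E i : iter i (fun g q => - eDx g q) (fun q => s i q * f q) p = negiter sD i (s i * f) p.
  have H (g : fn) : iter i (fun g q => - eDx g q) g = negiter sD i g.
    by elim: i => // i IH; rewrite iterS IH eDxE.
  by rewrite -H.
rewrite /adjoint_op (@fsbig_nat _ N) => [|i Ni].
  by under eq_bigr do rewrite E; rewrite -sfun_sumE.
by rewrite E sn ?mul0r ?raddf0// (leq_trans (ltnW nN)).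
Qed.

Lemma skew_adjointP : skew_adjoint s <-> skew s N.
Proof.
have E (f : fn) : Eul sD N (fun i => s i * f) = ev sD N.+1 f (adjoint_coef s N).
  by rewrite (@Eul_etens_ev _ _ (@svactM _ _ _) n)// ltnW.
have E2 (f : fn) : \sum_(i < n) s i * iter i sD f = ev sD N.+1 f s.
  rewrite /ev (@sum_bounded _ n N.+1 (fun k => s k * iter k sD f)) ?(leq_trans (ltnW nN))//.
  by move=> i ni; rewrite sn// mul0r.
split=> [h|sk f sf p]; last first.
  by rewrite -[f]/(sval_fun (to_sfun sf)) adjoint_opE op_eE E E2 sk raddfN.
apply/eqP; rewrite -subr_eq0 opprK; apply/eqP; apply: (@ev_inj N.+1).
  move=> i Ni; rewrite fctDE sn ?addr0 ?(leq_trans (ltnW nN)) ?(ltnW Ni)//.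
  rewrite /adjoint_coef /Eul fct_sumE big1// => j _.
  rewrite (@bounded_negiter _ sD 1 _ j)//; first by case.
  by rewrite add1n (leq_trans _ (ltnW Ni)).
move=> f; rewrite raddfD /= -E -E2; apply: sfunP => p.
by rewrite sfunDE -adjoint_opE -op_eE h ?addNr//; exact: smooth_sfun.
Qed.

End SkewAdjoint.

Section SymplecticHamiltonian.
Variable R : realType.
Local Notation fn := (sfun R nat).
Local Notation du i := (@dpart R nat (cu (i : nat))).
Local Notation sD := (svact (@eDx_sfield R)).
Variables (s : nat -> fn) (m n N : nat) (K : fn).
Hypothesis sm : bounded_by m s.
Hypothesis m0 : (0 < m)%N.
Hypothesis mn : (m <= n)%N.
Hypothesis dsn : forall i j, (n <= j)%N -> du j (s i) = 0.
Hypothesis dKn : forall i j, (i < m)%N -> (n <= j)%N -> du j (iter i sD K) = 0.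
Hypothesis nN : (n + n < N)%N.

Let sn : bounded_by n s := bounded_byW mn sm.

Lemma fct_mulrn2_eq0 (T : Type) (V : zmodType) (f : T -> V) :
  (forall v : V, v *+ 2 = 0 -> v = 0) -> f *+ 2 = 0 -> f = 0.
Proof.
move=> V0 h; apply/funext => t; apply: V0.
by move/(congr1 (@^~ t)): h; rewrite natmulfctE.
Qed.

(** The condition that Sigma is nonzero follows from the others: Sigma = 0 means
    that S has order zero, and a skew-adjoint operator of order zero vanishes. *)
Lemma symplectic_hamiltonianP : (exists i p, s i p <> 0) ->
  (symplectic s /\ symplectic_hamiltonian K s) <->
  [/\ skew s N, closure_arr s N = 0 & hamiltonian_arr s n N K = 0].
Proof.
move=> s0; have n0 : (0 < n)%N := leq_trans m0 mn.
have nN1 : (n < N)%N by rewrite (leq_ltn_trans _ nN)// leq_addr.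
have dK0 j : (n <= j)%N -> du j K = 0 by exact: (dKn m0).
have f2 : forall v : fn, v *+ 2 = 0 -> v = 0 by exact: fn_mulrn_eq0.
have f2' : forall v : nat -> fn, v *+ 2 = 0 -> v = 0 by move=> v; exact: fct_mulrn2_eq0.
have [h1 h2] := hamiltonian_eq0 sm m0 mn dsn dKn nN.
have [d1 d2] := deltaV_eq0 sm m0 mn dsn nN.
have [k1 k2] := skew_adjointP sn nN1.
split=> [[[/k1 sk _ /d1 dS] /h1 h]|[sk cl h]].
  move: dS; rewrite (Eul_dsigma sn dsn nN sk) => /(fct_mulrn2_eq0 f2') cl.
  by move: h; rewrite (Eul_rho sn dsn nN dK0 n0 sk cl) => /(fct_mulrn2_eq0 f2).
split; last by apply: h2; rewrite (Eul_rho sn dsn nN dK0 n0 sk cl) h mul0rn.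
split; [exact: k2| |by apply: d2; rewrite (Eul_dsigma sn dsn nN sk) cl mul0rn].
rewrite (SigmaE sm) => /fform_eq0 S0.
have Sv : vertical_Sigma m s = 0 by rewrite -ctr_dx_aSigma S0.
have sS k : s k.+1 = 0.
  have := vertical_Sigma2 sm 0 k.+1; rewrite Sv /sigma_arr fctBE /transp /etens.
  by rewrite /= !fctBE !fct0E subr0 => <-.
case: s0 => -[|i] [p sip]; last by apply: sip; rewrite sS.
have := congr1 (@^~ 0%N) sk; rewrite /adjoint_coef /Eul fct_sumE fctNE.
case: N nN1 {sk cl h} => // N' _; rewrite big_ord_recl big1 => [|j _]; last first.
  by rewrite sS raddf0 raddf0.
rewrite /= /etens addr0 => e; apply: sip.
have := congr1 (fun f : fn => f p) e; rewrite sfunNE => /eqP.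
by rewrite eq_sym eqNr => /eqP.
Qed.

End SymplecticHamiltonian.

(** * Total derivatives on the jet space of the plane *)

Section JetAlgebra.
Variable R : realType.
Local Notation en := (sfun R nat).
Local Notation jn := (sfun R (nat * nat)%type).
Local Notation du i := (@dpart R nat (cu (i : nat))).
Local Notation sD := (svact (@eDx_sfield R)).
Local Notation dj a i := (@dpart R (nat * nat)%type (cu (a : nat, i : nat))).

Definition jDx_sfield (c : jcoord (nat * nat)) : jn :=
  match c with ct => 0 | cx => 1 | cu (a, i) => scoord R (cu (a, i.+1)) end.
Definition jDt_sfield (c : jcoord (nat * nat)) : jn :=
  match c with ct => 1 | cx => 0 | cu (a, i) => scoord R (cu (a.+1, i)) end.
Local Notation Dx := (svact jDx_sfield).
Local Notation Dt := (svact jDt_sfield).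

Lemma jDxE (f : jn) : jDx f = Dx f.
Proof. by apply: svact_eq => -[||[a i]]. Qed.
Lemma jDtE (f : jn) : jDt f = Dt f.
Proof. by apply: svact_eq => -[||[a i]]. Qed.

Lemma Dx_Dt f : Dx (Dt f) = Dt (Dx f).
Proof.
have D1 X : svact X 1 = 0 :> jn by apply: derivation1; exact: svactM.
apply: svactC => -[||[a i]] /=.
- by rewrite D1 raddf0.
- by rewrite D1 raddf0.
- by rewrite !svact_coord.
Qed.

(** The commutators [d/du_{a,i}, D_x] = d/du_{a,i-1} and
    [d/du_{a,i}, D_t] = d/du_{a-1,i}. *)
Lemma dj_Dx a i f : dj a i (Dx f) = Dx (dj a i f) + (if i is k.+1 then dj a k f else 0).
Proof.
rewrite (@dpart_svact_coord _ _ _ _ (if i is k.+1 then Some (cu (a, k)) else None)).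
  by case: i.
case=> [||[b k]] /=; rewrite ?raddf0 ?dpart1 ?dpart_coord; case: i => [|i] //=.
- by case: eqP.
- by rewrite (inj_eq Some_inj) eq_sym; congr (nat_of_bool _)%:R; apply/eqP/eqP => -[-> ->].
Qed.

Lemma dj_Dt a i f : dj a i (Dt f) = Dt (dj a i f) + (if a is b.+1 then dj b i f else 0).
Proof.
rewrite (@dpart_svact_coord _ _ _ _ (if a is b.+1 then Some (cu (b, i)) else None)).
  by case: a.
case=> [||[b k]] /=; rewrite ?raddf0 ?dpart1 ?dpart_coord; case: a => [|a] //=.
by rewrite (inj_eq Some_inj) eq_sym; congr (nat_of_bool _)%:R; apply/eqP/eqP => -[-> ->].
Qed.

Definition jemb (c : jcoord nat) : jcoord (nat * nat) :=
  match c with ct => ct | cx => cx | cu i => cu (0%N, i) end.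

Lemma jemb_inj : injective jemb.
Proof. by move=> [||i] [||j] //= [->]. Qed.

Lemma resE (p : jet R) c : res p c = p (jemb c).
Proof. by case: c. Qed.

Lemma res_dfwith_jemb (p : jet R) c r : res (dfwith p (jemb c) r) = dfwith (res p) c r.
Proof.
apply/funext => d; rewrite resE; have [<-|cd] := eqVneq c d.
  by rewrite !dfwithin.
by rewrite !dfwithout ?resE// (inj_eq jemb_inj).
Qed.

Lemma res_dfwith_out (p : jet R) a i r : res (dfwith p (cu (a.+1, i)) r) = res p.
Proof. by apply/funext => d; rewrite !resE dfwithout//; case: d. Qed.

(** The projection onto E is linear in coordinates, so the pull-backs form a class
    that is stable under partial derivatives; Lipschitz bounds pass through it. *)
Lemma smooth_pull (f : espace R -> R) : smooth f -> smooth (fun p : jet R => f (res p)).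
Proof.
pose P (g : jet R -> R) := exists2 f : espace R -> R, smooth f & g = fun p => f (res p).
move=> sf; apply: (@smooth_coind _ _ P); last by exists f.
move=> g [{sf}f' sf ->]; have [cs ucs fcs] := smooth_depends sf.
have dep : depends_on (map jemb cs) (fun p : jet R => f' (res p)).
  move=> p q pq; apply: fcs => c ccs; rewrite !resE; apply: pq.
  exact: map_f.
split; first by exists (map jemb cs).
- apply: (locally_Lipschitz_continuous dep) => p.
  have [M M0 hM] := smooth_Lipschitz (fun c => `|res p c| + 1) ucs sf fcs.
  exists M => // q qp; rewrite (le_trans (hM _ _ _ _))//.
  + by move=> c; rewrite lerDl.
  + move=> c; rewrite -[res q c](subrK (res p c)) addrC (le_trans (ler_normD _ _))//.
    by rewrite lerD2l !resE.
  + rewrite /dist1 big_map ler_wpM2l//; apply: ler_sum => c _; by rewrite !resE.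
- have emb c : has_partial (jemb c) (fun p : jet R => f' (res p)) /\
      partial (jemb c) (fun p : jet R => f' (res p)) = fun p => partial c f' (res p).
    apply: has_partial_of => p; under eq_fun do rewrite res_dfwith_jemb.
    by rewrite -resE; apply: is_derive_partial; exact: smooth_has_partial.
  move=> c; have [[b ->]|[a [i ->]]] : (exists b, c = jemb b) \/ exists a i, c = cu (a.+1, i).
  + case: c => [||[[|a] i]]; [by left; exists ct|by left; exists cx| |by right; exists a, i].
    by left; exists (cu i).
  + have [h e] := emb b; split; first exact: h.
    by rewrite e; exists (partial b f'); [exact: smooth_partial|].
  + have [h e] : has_partial (cu (a.+1, i)) (fun p : jet R => f' (res p)) /\
        partial (cu (a.+1, i)) (fun p : jet R => f' (res p)) = fun=> 0.
      apply: has_partial_of => p; under eq_fun do rewrite res_dfwith_out.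
      exact: is_derive_cst.
    by split; [exact: h|rewrite e; exists (fun=> 0); [exact: smooth_cst|]].
Qed.

(** Functions on E regarded as functions on the jet space. *)
Definition pull (f : en) : jn := to_sfun (smooth_pull (smooth_sfun f)).

Lemma pullE f p : pull f p = f (res p). Proof. by []. Qed.

Lemma pull_is_zmod_morphism : zmod_morphism pull.
Proof. by move=> f g; apply: sfunP. Qed.
HB.instance Definition _ := GRing.isZmodMorphism.Build en jn pull pull_is_zmod_morphism.

Lemma pullM f g : pull (f * g) = pull f * pull g.
Proof. by apply: sfunP. Qed.

Lemma dpart_pull c f : dpart (jemb c) (pull f) = pull (dpart c f).
Proof.
apply: sfunP => p /=; apply: partialP; under eq_fun do rewrite res_dfwith_jemb.
by rewrite -resE; apply: is_derive_partial; apply: smooth_has_partial; exact: smooth_sfun.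
Qed.

Lemma dj0_pull i f : dj 0%N i (pull f) = pull (du i f).
Proof. exact: (dpart_pull (cu i)). Qed.

Lemma djS_pull a i f : dj a.+1 i (pull f) = 0.
Proof.
apply: sfunP => p /=; apply: partialP; under eq_fun do rewrite res_dfwith_out.
exact: is_derive_cst.
Qed.

Lemma svact_pull X (f : en) cs : uniq cs -> depends_on cs f ->
  svact X (pull f) = \sum_(c <- cs) X (jemb c) * pull (dpart c f).
Proof.
move=> ucs fcs; rewrite (@svactE _ _ _ _ (map jemb cs)).
- by rewrite big_map; apply: eq_bigr => c _; rewrite dpart_pull.
- by rewrite map_inj_uniq//; exact: jemb_inj.
- by move=> p q pq; apply: fcs => c ccs; rewrite !resE; apply: pq; exact: map_f.
Qed.

Lemma Dx_pull f : Dx (pull f) = pull (sD f).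
Proof.
have [cs ucs fcs] := smooth_depends (smooth_sfun f).
rewrite (svact_pull _ ucs fcs) (svactE _ ucs fcs) raddf_sum; apply: eq_bigr => c _.
by rewrite /= pullM; congr (_ * _); apply: sfunP => p; case: c.
Qed.

Definition coords n : seq (jcoord nat) := ct :: cx :: [seq cu i | i <- iota 0 n].

Lemma uniq_coords n : uniq (coords n).
Proof.
rewrite /= inE negb_or /=; apply/and3P; split; [|by apply/mapP => -[]|].
  by apply/mapP => -[].
by rewrite map_inj_uniq ?iota_uniq// => i j [].
Qed.

Lemma mem_coords n i : (cu i \in coords n) = (i < n)%N.
Proof. by rewrite /coords !inE /= mem_map ?mem_iota// => j k []. Qed.

Lemma depends_on_coords (f : en) : exists n, depends_on (coords n) f.
Proof.
have [cs _ fcs] := smooth_depends (smooth_sfun f).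
suff [n hn] : exists n, {subset cs <= coords n}.
  by exists n; exact: depends_on_sub fcs.
elim: cs {fcs} => [|c cs [n IH]]; first by exists 0%N.
exists (maxn n (if c is cu i then i.+1 else 0%N)) => d; rewrite inE => /predU1P[->|].
  by case: c => [||i] //; rewrite mem_coords leq_maxr.
by case: d => [||i] // /IH; rewrite !mem_coords => ni; rewrite (leq_trans ni)// leq_maxl.
Qed.

Lemma du_coords n (f : en) i : depends_on (coords n) f -> (n <= i)%N -> du i f = 0.
Proof.
by move=> fn ni; apply: (dpart0 fn); rewrite mem_coords -leqNgt.
Qed.

(** D_t leaves E: the derivative of a function on E is affine in the coordinates
    u_{1,i}, with coefficients from E. *)
Lemma Dt_pull n f : (forall i, (n <= i)%N -> du i f = 0) ->
  Dt (pull f) = pull (dpart ct f) + \sum_(m < n) scoord R (cu (1%N, m : nat)) * pull (du m f).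
Proof.
move=> fn; have [k fk] := depends_on_coords f.
rewrite (svact_pull _ (uniq_coords k) fk) /coords !big_cons /= mul1r mul0r add0r.
congr (_ + _); rewrite big_map.
pose F i : jn := scoord R (cu (1%N, i)) * pull (du i f).
have Fn : bounded_by n F by move=> i ni; rewrite /F fn// raddf0 mulr0.
have Fk : bounded_by k F by move=> i ki; rewrite /F (du_coords fk)// raddf0 mulr0.
have -> : iota 0 k = index_iota 0 k by rewrite /index_iota subn0.
rewrite -[LHS]/(\sum_(i <- index_iota 0 k) F i) big_mkord.
by rewrite -(sum_bounded (leq_maxl k n) Fk) (sum_bounded (leq_maxr k n) Fn).
Qed.

End JetAlgebra.

(** * Formal adjoints in two variables *)

Section Arrays2D.
Variable V : zmodType.

Definition pointwise (D : V -> V) (a : nat -> V) : nat -> V := fun i => D (a i).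
Lemma pointwise_is_zmod_morphism (D : {additive V -> V}) : zmod_morphism (pointwise D).
Proof. by move=> a b; apply/funext => i; rewrite /pointwise !fctBE raddfB. Qed.
HB.instance Definition _ (D : {additive V -> V}) :=
  GRing.isZmodMorphism.Build (nat -> V) (nat -> V) (pointwise D) (pointwise_is_zmod_morphism D).

(** [Eul] in both variables; applied to the vertical derivatives of L it is the
    Euler operator. *)
Definition Eul2 (Dx Dt : {additive V -> V}) N (a : nat -> nat -> V) : V :=
  Eul Dx N (fun i => Eul Dt N (fun b => a b i)).

Lemma Eul2_is_zmod_morphism Dx Dt N : zmod_morphism (Eul2 Dx Dt N).
Proof.
move=> a b; rewrite /Eul2 -raddfB /=; congr Eul; apply/funext => i.
by rewrite fctBE -raddfB.
Qed.
HB.instance Definition _ Dx Dt N := GRing.isZmodMorphism.Build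
  (nat -> nat -> V) V (Eul2 Dx Dt N) (Eul2_is_zmod_morphism Dx Dt N).

Lemma eq_Eul2 Dx Dt N a b : (forall i j, a i j = b i j) -> Eul2 Dx Dt N a = Eul2 Dx Dt N b.
Proof. by move=> ab; congr Eul2; apply/funext => i; apply/funext. Qed.

Definition bounded2 n (a : nat -> nat -> V) := forall b i, (n <= b)%N || (n <= i)%N -> a b i = 0.

End Arrays2D.

(** The total derivatives on arrays indexed by the multi-indices (a,i) of
    $\partial_t^a\partial_x^i$. *)
Definition shDt (V : zmodType) (Dt : {additive V -> V}) : {additive (nat -> nat -> V) -> (nat -> nat -> V)} :=
  shD (pointwise Dt).
Definition shDx (V : zmodType) (Dx : {additive V -> V}) : {additive (nat -> nat -> V) -> (nat -> nat -> V)} :=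
  pointwise (shD Dx).

Section Parts2D.
Variables (U V : zmodType) (DxU DtU : {additive U -> U}) (Dx Dt : {additive V -> V}).
Hypothesis DxDt : forall v, Dx (Dt v) = Dt (Dx v).
Variable m : nat -> nat -> {additive U -> V}.
Hypothesis mx : forall a i u, Dx (m a i u) = m a i.+1 u + m a i (DxU u).
Hypothesis mt : forall a i u, Dt (m a i u) = m a.+1 i u + m a i (DtU u).

Lemma shDxE w b k : shDx DxU w b k = DxU (w b k) + (if k is k'.+1 then w b k' else 0).
Proof. by []. Qed.
Lemma shDtE w b k : shDt DtU w b k = DtU (w b k) + (if b is b'.+1 then w b' k else 0).
Proof. by case: b. Qed.

Lemma bounded2_shDx n w : bounded2 n w -> bounded2 n.+1 (shDx DxU w).
Proof.
move=> wn b k bk; rewrite shDxE wn ?raddf0 ?add0r.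
  by case: k bk => // k bk; apply: wn; case/orP: bk => [/ltnW->//|bk]; rewrite orbC -ltnS bk.
by case/orP: bk => /ltnW ->; rewrite ?orbT.
Qed.

Lemma bounded2_shDt n w : bounded2 n w -> bounded2 n.+1 (shDt DtU w).
Proof.
move=> wn b k bk; rewrite shDtE wn ?raddf0 ?add0r.
  by case: b bk => // b bk; apply: wn; case/orP: bk => [bk|/ltnW->]; rewrite ?orbT// -ltnS bk.
by case/orP: bk => /ltnW ->; rewrite ?orbT.
Qed.

Lemma bounded2_negiterx n w j : bounded2 n w ->
  bounded2 (n + j) (negiter (shDx DxU) j w).
Proof.
move=> wn; elim: j => [|j IH]; first by rewrite addn0.
by rewrite addnS => c k ck; rewrite negiterS !fctNE /= (bounded2_shDx IH ck) oppr0.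
Qed.

Lemma bounded2_negitert n w j : bounded2 n w ->
  bounded2 (n + j) (negiter (shDt DtU) j w).
Proof.
move=> wn; elim: j => [|j IH]; first by rewrite addn0.
by rewrite addnS => c k ck; rewrite negiterS !fctNE /= (bounded2_shDt IH ck) oppr0.
Qed.

(** Moving derivatives one at a time from the array w to the factor m(a,i) raises
    its indices; [paired_Eul2_negiter] is the result of all these steps. *)
Definition paired_Eul2 N a i w := Eul2 Dx Dt N (fun b k => m a i (w b k)).

Lemma paired_Eul2N N a i w : paired_Eul2 N a i (- w) = - paired_Eul2 N a i w.
Proof.
rewrite /paired_Eul2 /Eul2 -[RHS]raddfN /=; congr Eul; apply/funext => k.
by rewrite fctNE -raddfN /=; congr Eul; apply/funext => b; rewrite !fctNE raddfN.
Qed.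

Lemma paired_Eul2_shDx n N a i w : bounded2 n w -> (n < N)%N ->
  paired_Eul2 N a i (- shDx DxU w) = paired_Eul2 N a i.+1 w.
Proof.
move=> wn nN; rewrite paired_Eul2N /paired_Eul2 /Eul2.
have -> : (fun k => Eul Dt N (fun b => m a i (shDx DxU w b k))) =
  shD Dx (fun k => Eul Dt N (fun b => m a i (w b k))) -
  (fun k => Eul Dt N (fun b => m a i.+1 (w b k))).
  apply/funext => k; rewrite fctBE /shD (Eul_morph (DV := Dt))//.
  have -> : (if k is j.+1 then Eul Dt N (fun b => m a i (w b j)) else 0) =
     Eul Dt N (fun b => m a i (if k is j.+1 then w b j else 0)).
    case: k => //; transitivity (Eul Dt N 0); first by rewrite raddf0.
    by congr Eul; apply/funext => b; rewrite raddf0.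
  rewrite -raddfD -raddfB /=; congr Eul; apply/funext => b; rewrite fctBE fctDE shDxE.
  rewrite mx raddfD -[in RHS](addrA (m a i.+1 _)) [m a i.+1 _ + _]addrC.
  exact/esym/addrK.
rewrite raddfB /= (@Eul_shD _ _ n) ?sub0r ?opprK// => k nk.
rewrite (_ : (fun b => _) = 0) ?raddf0//; apply/funext => b.
by rewrite wn ?raddf0// nk orbT.
Qed.

Lemma paired_Eul2_shDt n N a i w : bounded2 n w -> (n < N)%N ->
  paired_Eul2 N a i (- shDt DtU w) = paired_Eul2 N a.+1 i w.
Proof.
move=> wn nN; rewrite paired_Eul2N /paired_Eul2 /Eul2 -[LHS]raddfN /=; congr Eul.
apply/funext => k; rewrite fctNE.
have -> : (fun b => m a i (shDt DtU w b k)) =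
  shD Dt (fun b => m a i (w b k)) - (fun b => m a.+1 i (w b k)).
  apply/funext => b; rewrite fctBE shDtE /shD mt raddfD.
  rewrite -[in RHS](addrA (m a.+1 i _)) [m a.+1 i _ + _]addrC.
  apply: etrans; last exact/esym/addrK.
  by congr (_ + _); case: b; rewrite ?raddf0.
rewrite raddfB /= (@Eul_shD _ _ n) ?sub0r ?opprK// => b nb.
by rewrite wn ?raddf0// nb.
Qed.

Lemma paired_Eul2_negiter n N a i b j w : bounded2 n w -> (n + b + j < N)%N ->
  paired_Eul2 N a i (negiter (shDx DxU) j (negiter (shDt DtU) b w)) = paired_Eul2 N (a + b) (i + j) w.
Proof.
move=> wn; elim: j i => [|j IH] i nN; last first.
  have Hb := @bounded2_negiterx _ _ j (@bounded2_negitert _ _ b wn).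
  rewrite negiterS (paired_Eul2_shDx _ _ Hb); last by lia.
  by rewrite IH ?addSnnS//; lia.
rewrite !addn0 in nN *; elim: b a nN => [|b IH] a nN; first by rewrite !addn0.
rewrite negiterS (paired_Eul2_shDt _ _ (@bounded2_negitert _ _ b wn)); last by lia.
by rewrite IH ?addSnnS//; lia.
Qed.

Lemma paired_Eul2_sum N a i (I : Type) (r : seq I) (P : pred I) (F : I -> nat -> nat -> U) :
  paired_Eul2 N a i (\sum_(j <- r | P j) F j) = \sum_(j <- r | P j) paired_Eul2 N a i (F j).
Proof.
elim/big_rec2: _ => [|j x y _ <-].
  rewrite /paired_Eul2 /Eul2 (_ : (fun k => _) = 0) ?raddf0//; apply/funext => k.
  rewrite (_ : (fun b => _) = 0) ?raddf0//; apply/funext => b.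
  by rewrite !fct0E raddf0.
rewrite /paired_Eul2 /Eul2 -[RHS]raddfD /=; congr Eul; apply/funext => k.
rewrite [RHS]fctDE -[RHS]raddfD /=; congr Eul; apply/funext => b.
by rewrite !fctDE raddfD.
Qed.

(** The bound n + n + n leaves room for the supports created by applying at most
    n derivatives in each variable to an array supported below n. *)
Lemma Eul2_Eul2 n N (M : nat -> nat -> nat -> nat -> U) :
  bounded2 n M -> (forall a i, bounded2 n (M a i)) -> (n + n + n < N)%N ->
  Eul2 Dx Dt N (fun b k => m 0 0 (Eul2 (shDx DxU) (shDt DtU) N M b k)) =
  Eul2 Dx Dt N (fun b k => \sum_(i < n) \sum_(a < n) m a i (M a i b k)).
Proof.
move=> Mn Mbn nN; have nN' : (n <= N)%N by rewrite (leq_trans _ (ltnW nN))// -addnA leq_addr.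
have -> : Eul2 (shDx DxU) (shDt DtU) N M =
    \sum_(i < n) \sum_(a < n) negiter (shDx DxU) i (negiter (shDt DtU) a (M a i)).
  rewrite /Eul2 (@Eul_bounded _ _ n)//; last first.
    move=> i ni; rewrite (_ : (fun b => _) = 0) ?raddf0//; apply/funext => b.
    by rewrite Mn// ni orbT.
  apply: eq_bigr => i _; rewrite (@Eul_bounded _ _ n) ?raddf_sum//.
  by move=> b nb; rewrite Mn// nb.
rewrite -/(paired_Eul2 N 0 0 _) paired_Eul2_sum.
have -> : (fun b k => \sum_(i < n) \sum_(a < n) m a i (M a i b k)) =
    \sum_(i < n) \sum_(a < n) (fun b k => m a i (M a i b k)).
  apply/funext => b; apply/funext => k; rewrite !fct_sumE; apply: eq_bigr => i _.
  by rewrite !fct_sumE.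
rewrite raddf_sum; apply: eq_bigr => i _; rewrite paired_Eul2_sum raddf_sum; apply: eq_bigr => a _ /=.
rewrite (@paired_Eul2_negiter n)// -addnA (leq_ltn_trans _ nN)// -addnA !leq_add//; exact: ltnW.
Qed.

End Parts2D.

Section SelfAdjoint.
Variables (V : zmodType) (Dx Dt : {additive V -> V}).
Hypothesis DxDt : forall v, Dx (Dt v) = Dt (Dx v).

Lemma shDx_shDt w : shDx Dx (shDt Dt w) = shDt Dt (shDx Dx w).
Proof.
apply/funext => b; apply/funext => k.
rewrite !(shDxE, shDtE) !raddfD /= DxDt -!addrA; congr (_ + _).
case: b k => [|b] [|k]; rewrite ?(shDxE, shDtE) ?raddf0 ?addr0 ?add0r//.
by rewrite addrA addrCA -!addrA; congr (_ + _); rewrite ?addrA// addrCA.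
Qed.

Definition etens2 a i : {additive V -> (nat -> nat -> V)} := etens a \o etens i.

Arguments etens2 (a i)%_N.

(** Coefficients of the formal adjoint of $\sum_{b,k} f_{b,k} D_t^b D_x^k$. *)
Definition adjoint2 N (f : nat -> nat -> V) : nat -> nat -> V :=
  Eul2 (shDx Dx) (shDt Dt) N (fun b k => etens2 0 0 (f b k)).

Lemma etens2x a i u : shDx Dx (etens2 a i u) = etens2 a i.+1 u + etens2 a i (Dx u).
Proof.
rewrite /etens2 /= -raddfD -shD_etens; apply/funext => b.
by rewrite /shDx /= /pointwise /etens; case: ifP => // _; exact: (raddf0 (shD Dx)).
Qed.

Lemma etens2t a i u : shDt Dt (etens2 a i u) = etens2 a.+1 i u + etens2 a i (Dt u).
Proof.
rewrite /etens2 /= /shDt shD_etens; congr (_ + etens _ _); apply/funext => k.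
rewrite -[LHS]/(Dt (if k == i then u else 0)) (fun_if Dt) raddf0. by [].
Qed.

Lemma sum_etens2 n (w : nat -> nat -> V) : bounded2 n w ->
  \sum_(i < n) \sum_(a < n) etens2 a i (w a i) = w.
Proof.
move=> wn; rewrite exchange_big /= -[RHS](@sum_etens _ n).
  apply: eq_bigr => a _; rewrite -[in RHS](@sum_etens _ n (w a)) ?raddf_sum//.
  by move=> i ni; apply: wn; rewrite ni orbT.
by move=> b nb; apply/funext => k; apply: wn; rewrite nb.
Qed.

(** Taking the adjoint of $\sum_I (-D)^I \circ \sum_J M_{IJ} D^J$ transposes the
    matrix M. *)
Lemma adjoint2_symmetric n N (M : nat -> nat -> nat -> nat -> V) :
  bounded2 n M -> (forall a i, bounded2 n (M a i)) -> (n + n + n < N)%N ->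
  (forall a i b k, M a i b k = M b k a i) ->
  adjoint2 N (Eul2 (shDx Dx) (shDt Dt) N M) = Eul2 (shDx Dx) (shDt Dt) N M.
Proof.
move=> Mn Mbn nN Ms.
rewrite /adjoint2 (Eul2_Eul2 shDx_shDt etens2x etens2t Mn Mbn nN); apply: eq_Eul2 => b k.
rewrite (@sum_etens2 n (fun a i => M a i b k)).
  by apply/funext => a; apply/funext => i.
by move=> a i ai; rewrite Mn.
Qed.

End SelfAdjoint.

(** * The linearization of S(u_t - K) *)

Section Source.
Variable R : realType.
Local Notation en := (sfun R nat).
Local Notation jn := (sfun R (nat * nat)%type).
Local Notation du i := (@dpart R nat (cu (i : nat))).
Local Notation sD := (svact (@eDx_sfield R)).
Local Notation dj a i := (@dpart R (nat * nat)%type (cu (a%N : nat, i%N : nat))).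
Local Notation Dx := (svact (@jDx_sfield R)).
Local Notation Dt := (svact (@jDt_sfield R)).
Local Notation u a i := (@scoord R (nat * nat)%type (cu (a%N : nat, i%N : nat))).

Definition dVJ (f : jn) : nat -> nat -> jn := fun a i => dj a i f.
Lemma dVJ_is_zmod_morphism : zmod_morphism dVJ.
Proof. by move=> f g; apply/funext => a; apply/funext => i; rewrite /dVJ raddfB. Qed.
HB.instance Definition _ := GRing.isZmodMorphism.Build jn (nat -> nat -> jn) dVJ
  dVJ_is_zmod_morphism.

Lemma dVJ_Dx f : dVJ (Dx f) = shDx Dx (dVJ f).
Proof. by apply/funext => a; apply/funext => i; rewrite /dVJ dj_Dx. Qed.

Lemma dVJ_Dt f : dVJ (Dt f) = shDt Dt (dVJ f).
Proof. by apply/funext => a; apply/funext => i; rewrite /dVJ dj_Dt shDtE. Qed.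

Definition pullA (a : nat -> en) : nat -> jn := fun i => pull (a i).
Lemma pullA_is_zmod_morphism : zmod_morphism pullA.
Proof. by move=> f g; apply/funext => i; rewrite /pullA raddfB. Qed.
HB.instance Definition _ := GRing.isZmodMorphism.Build (nat -> en) (nat -> jn) pullA
  pullA_is_zmod_morphism.

Lemma pullA_shD a : pullA (shD sD a) = shD Dx (pullA a).
Proof.
apply/funext => i; rewrite /pullA /shD raddfD /= Dx_pull; congr (_ + _).
by case: i; rewrite ?raddf0.
Qed.

Lemma pull_Eul N (a : nat -> en) :
  Eul (shD Dx) N (fun j => etens 0 (pull (a j))) = pullA (Eul (shD sD) N (fun j => etens 0 (a j))).
Proof.
apply/esym/eq_Eul_morph; first exact: pullA_shD.
move=> j; apply/funext => k; rewrite /= /pullA /etens.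
by case: ifP; rewrite ?raddf0.
Qed.

(** The first slot of a bilinear operator is evaluated at u_t, whose derivatives
    in x are the u_{1,i}. *)
Definition evu2 M (Y : nat -> nat -> en) : nat -> jn :=
  fun k => \sum_(i < M) u 1 i * pull (Y i k).
Lemma evu2_is_zmod_morphism M : zmod_morphism (evu2 M).
Proof.
move=> f g; apply/funext => k; rewrite fctBE /evu2 -sumrB; apply: eq_bigr => i _.
by rewrite !fctBE raddfB mulrBr.
Qed.
HB.instance Definition _ M := GRing.isZmodMorphism.Build
  (nat -> nat -> en) (nat -> jn) (evu2 M) (evu2_is_zmod_morphism M).

Lemma evu2_shD m M Y : bounded_by m Y -> (m < M)%N ->
  evu2 M (shD (shD sD) Y) = shD Dx (evu2 M Y).
Proof.
move=> Ym mM; apply/funext => k; rewrite /evu2.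
have -> : shD Dx (fun k => \sum_(i < M) u 1 i * pull (Y i k)) k =
   \sum_(i < M) (u 1 i.+1 * pull (Y i k) + u 1 i * pull (shD sD (Y i) k)).
  rewrite /shD raddf_sum /=.
  have -> : (if k is j.+1 then \sum_(i < M) u 1 i * pull (Y i j) else 0) =
    \sum_(i < M) u 1 i * pull (if k is j.+1 then Y i j else 0).
    by case: k => // ; rewrite big1// => i _; rewrite raddf0 mulr0.
  rewrite -big_split; apply: eq_bigr => i _ /=.
  by rewrite svactM svact_coord /= Dx_pull raddfD mulrDr addrA.
have -> : \sum_(i < M) u 1 i * pull (shD (shD sD) Y i k) =
   \sum_(i < M) (u 1 i * pull (shD sD (Y i) k) + u 1 i * pull (if i : nat is j.+1 then Y j k else 0)).
  by apply: eq_bigr => -[[|i] iM] _; rewrite -mulrDr -raddfD.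
rewrite !big_split /= addrC; congr (_ + _).
case: M mM => // M; rewrite ltnS => mM.
rewrite big_ord_recl [RHS]big_ord_recr /= (Ym M mM) fct0E !raddf0 !mulr0 add0r addr0.
by apply: eq_bigr.
Qed.

Lemma evu2_negiter m M Y i : bounded_by m Y -> (m + i <= M)%N ->
  evu2 M (negiter (shD (shD sD)) i Y) = negiter (shD Dx) i (evu2 M Y).
Proof.
move=> Ym; elim: i => // i IH; rewrite addnS => mM.
rewrite !negiterS raddfN /= (@evu2_shD (m + i))//; last exact: bounded_negiter.
by rewrite IH// ltnW.
Qed.

Lemma evu2_Eul m M N (Y : nat -> nat -> en) : (forall j, bounded_by m (Y j)) ->
  (m + N <= M)%N ->
  Eul (shD Dx) N (fun j => etens 0 (\sum_(i < M) u 1 i * pull (Y j i))) =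
  evu2 M (Eul (shD (shD sD)) N (fun j i => etens 0 (Y j i))).
Proof.
move=> Ym mM; rewrite /Eul raddf_sum; apply: eq_bigr => j _ /=.
rewrite (@evu2_negiter m)//.
- congr negiter; apply/funext => k; rewrite /evu2 /etens.
  by case: ifP => // _; rewrite big1// => i _; rewrite raddf0 mulr0.
- by move=> i mi; rewrite Ym// raddf0.
- by rewrite (leq_trans _ mM)// leq_add2l ltnW.
Qed.

Variables (s : nat -> en) (n N : nat) (K : en).
Hypothesis sn : bounded_by n s.
Hypothesis n0 : (0 < n)%N.
Hypothesis dsn : forall i j, (n <= j)%N -> du j (s i) = 0.
Hypothesis nN : (n + n < N)%N.

Let nN' : (n <= N)%N. Proof. by rewrite (leq_trans _ (ltnW nN))// leq_addr. Qed.

(** The function S(u_t - K) on the jet space. *)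
Definition source : jn := \sum_(i < n) pull (s i) * (u 1 i - pull (iter i sD K)).

Lemma sourceE : source = \sum_(i < n) u 1 i * pull (s i) - pull (SK s n K).
Proof.
rewrite /source /SK raddf_sum -sumrB; apply: eq_bigr => i _ /=.
by rewrite pullM mulrBr mulrC.
Qed.

Lemma dj_source a j : dj a j source =
  \sum_(i < n) ((cu (a, j) == cu (1%N, i : nat))%:R * pull (s i) + u 1 i * dj a j (pull (s i)))
  - dj a j (pull (SK s n K)).
Proof.
rewrite sourceE raddfB raddf_sum; congr (_ - _); apply: eq_bigr => i _ /=.
by rewrite dpartM dpart_coord.
Qed.

Lemma cu_eq (a b i j : nat) : (cu (a, i) == cu (b, j)) = (a == b) && (i == j).
Proof. by apply/eqP/andP => [[-> ->]|[/eqP-> /eqP->]]. Qed.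

Lemma dj1_source j : dj 1 j source = pull (s j).
Proof.
rewrite dj_source djS_pull subr0.
under eq_bigr do rewrite djS_pull mulr0 addr0 cu_eq /=.
have [jn|nj] := ltnP j n; last first.
  rewrite sn// raddf0 big1// => i _; case: eqP => [ji|]; rewrite ?mul0r//.
  by move: nj; rewrite ji leqNgt ltn_ord.
rewrite (bigD1 (Ordinal jn))//= eqxx mul1r big1 ?addr0// => i ij.
by case: eqP => [ji|]; rewrite ?mul0r//; case/eqP: ij; apply: val_inj.
Qed.

Lemma djSS_source a j : dj a.+2 j source = 0.
Proof.
rewrite dj_source djS_pull subr0 big1// => i _.
by rewrite djS_pull mulr0 addr0 cu_eq mul0r.
Qed.

Lemma dj0_source M j : (n <= M)%N ->
  dj 0 j source = \sum_(i < M) u 1 i * pull (du j (s i)) - pull (du j (SK s n K)).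
Proof.
move=> nM; rewrite dj_source dj0_pull; congr (_ - _).
rewrite (@sum_bounded _ n M (fun i => u 1 i * pull (du j (s i))))//; last first.
  by move=> i ni; rewrite sn// !raddf0 mulr0.
by apply: eq_bigr => i _; rewrite cu_eq mul0r add0r dj0_pull.
Qed.

(** F is affine in the u_{1,i} and involves no u_{a,i} with a > 1, so its
    linearization has order one in D_t. The adjoint of a term f D_t D_x^j is
    $(-D_x)^j \circ (-D_t) \circ f$, where $D_t \circ f = f D_t + D_t(f)$
    contributes to both orders. *)
Lemma adjoint2_source : adjoint2 Dx Dt N (dVJ source) =
  etens 0 (Eul (shD Dx) N (fun j => etens 0 (dj 0 j source - Dt (dj 1 j source))))
  - etens 1 (Eul (shD Dx) N (fun j => etens 0 (dj 1 j source))).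
Proof.
rewrite /adjoint2 /Eul2.
have E j : Eul (shDt Dt) N (fun b => etens2 jn 0 0 (dVJ source b j)) =
    etens 0 (etens 0 (dj 0 j source - Dt (dj 1 j source))) - etens 1 (etens 0 (dj 1 j source)).
  rewrite (@Eul_bounded _ _ 2).
  - rewrite /Eul !big_ord_recl big_ord0 addr0 /= /negD /= /dVJ.
    by rewrite -[etens 0 (etens 0 (dj (bump 0 0) _ _))]/(etens2 jn 0 0 (dj 1 j source)) etens2t /= !raddfB opprD addrA addrAC.
  - lia.
  - by move=> [|[|b]]// _; rewrite /dVJ djSS_source raddf0.
under eq_fun do rewrite E.
have H c : forall w : nat -> jn, etens c (shD Dx w) = shDx Dx (etens c w).
  by move=> w; apply/funext => b; rewrite /shDx /= /pointwise /etens; case: ifP => // _; rewrite raddf0.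
rewrite -[(fun i => _)]/((fun j => etens 0 (etens 0 (dj 0 j source - Dt (dj 1 j source)))) -
  (fun j => etens 1 (etens 0 (dj 1 j source)))) raddfB /=.
by rewrite (Eul_morph (H 0%N)) (Eul_morph (H 1%N)).
Qed.

Definition evu M (y : nat -> en) : jn := \sum_(i < M) u 1 i * pull (y i).

(** The coordinates u_{1,i} are independent of those of E. *)
Lemma evu_eq_pull M (y : nat -> en) (h : en) : evu M y = pull h ->
  (forall i, (i < M)%N -> y i = 0) /\ h = 0.
Proof.
move=> e.
(* A jet that restricts to a given point q of E, with v_i as its u_{a,i} for
   all a > 0. *)
pose jt (q : espace R) (v : nat -> R) : jet R := fun c => match c with
  | ct => q ct | cx => q cx | cu (0%N, i) => q (cu i) | cu (_, i) => v i end.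
have res_jt q v : res (jt q v) = q by apply/funext => -[].
have ev q (v : nat -> R) : \sum_(i < M) v i * y i q = h q.
  have := congr1 (fun f : jn => f (jt q v)) e.
  by rewrite /evu sfun_sumE pullE res_jt => <-; apply: eq_bigr => i _; rewrite sfunME pullE res_jt.
have h0 : h = 0.
  by apply: sfunP => q; rewrite -(ev q (fun=> 0)) big1// => i _; rewrite mul0r.
split=> // i iM; apply: sfunP => q; have := ev q (fun j => (j == i)%:R).
rewrite h0 (bigD1 (Ordinal iM))//= eqxx mul1r big1 ?addr0// => j ij.
by case: eqP => [ji|]; rewrite ?mul0r//; case/eqP: ij; apply: val_inj.
Qed.

(** The coefficients of order zero in D_t of the linearization minus its adjoint,
    once S is skew-adjoint: the part linear in the u_{1,i} involves S alone, and
    the rest is the Hamiltonian condition. *)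
Lemma dj0_source_adjoint M k : skew s N -> (n + N <= M)%N ->
  dj 0 k source - Eul (shD Dx) N (fun j => etens 0 (dj 0 j source - Dt (dj 1 j source))) k =
  evu M (fun i => closure_arr s N i k) - pull (hamiltonian_arr s n N K k).
Proof.
move=> sk nM; have nM' : (n <= M)%N by rewrite (leq_trans _ nM)// leq_addr.
have E j : dj 0 j source - Dt (dj 1 j source) =
   \sum_(i < M) u 1 i * pull (du j (s i) - du i (s j)) - pull (du j (SK s n K) + dpart ct (s j)).
  rewrite dj1_source (@Dt_pull _ n); last by move=> i ni; exact: dsn.
  rewrite (dj0_source _ nM').
  have -> : \sum_(m < n) u 1 m * pull (du m (s j)) = \sum_(m < M) u 1 m * pull (du m (s j)).
    rewrite (@sum_bounded _ n M (fun m => u 1 m * pull (du m (s j))))//.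
    by move=> i ni; rewrite dsn// raddf0 mulr0.
  under [in RHS]eq_bigr do rewrite raddfB mulrBr.
  by rewrite sumrB raddfD /=; ring.
have -> : (fun j => etens 0 (dj 0 j source - Dt (dj 1 j source))) =
  (fun j => etens 0 (\sum_(i < M) u 1 i * pull (du j (s i) - du i (s j)))) -
  (fun j => etens 0 (pull (du j (SK s n K) + dpart ct (s j)))).
  by apply/funext => j; rewrite fctBE E raddfB.
rewrite raddfB /= (@evu2_Eul n M N (fun j i => du j (s i) - du i (s j)))//; last first.
  by move=> j i ni; rewrite (sn ni) dsn// raddf0 subr0.
rewrite pull_Eul fctBE /pullA.
have -> : (fun j => etens 0 (du j (SK s n K) + dpart ct (s j))) =
   (fun j => etens 0 (du j (SK s n K))) + (fun j => etens 0 (dpart ct (s j))).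
  by apply/funext => j; rewrite fctDE raddfD.
rewrite [Eul _ _ (_ + _)]raddfD /= (@dt_adjoint _ s N) sk.
have -> : (fun j i => etens 0 (du j (s i) - du i (s j))) =
  (fun j i => etens 0 (du j (s i))) - (fun j i => etens 0 (du i (s j))).
  by apply/funext => j; apply/funext => i; rewrite !fctBE raddfB.
rewrite [Eul _ _ (_ - _)]raddfB /= transp_linearization_adjoint dV2_adjoint sk.
rewrite (linearization_adjoint_antisym sn dsn nN sk) (dj0_source _ nM') /evu2 /evu /closure_arr /hamiltonian_arr.
rewrite !(fctDE, fctNE) /transp /dV2 /dV1.
set X := \sum_(i < M) _; set Z := \sum_(i < M) _.
set Y := pull _; set W := pull _.
have -> : X - Y - (Z - W) = (X - Z) - (Y - W) by ring.
rewrite /X /Y /Z /W -sumrB -raddfB; congr (_ - _).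
  apply: eq_bigr => i _; rewrite -mulrBr -raddfB; congr (_ * pull _).
  by rewrite !(fctDE, fctNE) raddfN /=; ring.
by congr pull; rewrite raddfN /=; ring.
Qed.

Lemma closure_arr_bounded M i k : (n <= M)%N -> (N < M)%N -> (M <= i)%N ->
  closure_arr s N i k = 0.
Proof.
move=> nM NM Mi; rewrite /closure_arr !(fctDE, fctNE) /transp /dV2 dsn; last exact: leq_trans Mi.
rewrite (sn (leq_trans nM Mi)) oppr0 (raddf0 (du k)) !addr0 /linearization_adjoint /Eul !fct_sumE big1// => j _.
rewrite (@bounded_negiter _ (shD sD) 1 _ j) ?fct0E//; first by case.
by rewrite add1n (leq_trans _ Mi)// (leq_trans (ltn_ord j))// ltnW.
Qed.

Lemma etens01_eq (a b c d : nat -> jn) :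
  etens 0 a - etens 1 b = etens 0 c - etens 1 d <-> a = c /\ b = d.
Proof.
split=> [h|[-> ->]//]; split; apply/funext => k.
  by have := congr1 (fun w => w 0%N k) h; rewrite /= !fctBE /etens /= !fct0E !subr0.
by have := congr1 (fun w => w 1%N k) h; rewrite /= !fctBE /etens /= !fct0E !sub0r => /oppr_inj.
Qed.

(** Separating the equation according to the powers of D_t and to the
    coordinates u_(1,m) turns self-adjointness of the linearization of
    S(u_t - K) into the conditions on S and K. *)
Lemma adjoint2_sourceP : adjoint2 Dx Dt N (dVJ source) = dVJ source <->
  [/\ skew s N, closure_arr s N = 0 & hamiltonian_arr s n N K = 0].
Proof.
have e : dVJ source = etens 0 (fun j => dj 0 j source) - etens 1 (- (fun j => dj 1 j source)).
  apply/funext => -[|[|a]]; apply/funext => j; rewrite !fctBE /etens /= /dVJ.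
  - by rewrite fct0E subr0.
  - by rewrite fct0E sub0r opprK.
  - by rewrite djSS_source fct0E subr0.
rewrite adjoint2_source e etens01_eq.
have -> : (fun j => etens 0 (dj 1 j source)) = fun j => etens 0 (pull (s j)).
  by apply/funext => j; rewrite dj1_source.
rewrite pull_Eul; have pull_inj (f g : en) : pull f = pull g -> f = g.
  move=> h; have : evu 0 (fun=> 0) = pull (f - g) by rewrite /evu big_ord0 raddfB /= h subrr.
  by case/evu_eq_pull => _ /eqP; rewrite subr_eq0 => /eqP.
have skP : pullA (Eul (shD sD) N (fun j => etens 0 (s j))) = - (fun j => dj 1 j source) <-> skew s N.
  split=> [h|h].
    apply/funext => j; apply: pull_inj; have := congr1 (fun w => w j) h.
    by rewrite !fctNE raddfN /= dj1_source.
  apply/funext => j; rewrite -[Eul _ _ _]/(adjoint_coef s N) h fctNE dj1_source.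
  by rewrite /pullA fctNE raddfN.
(* Each of the N derivatives in an adjoint can enlarge the support by one, so
   the u_{1,i} with i < M carry all coefficients. *)
pose M := (n + N.+1)%N.
have nNM : (n + N <= M)%N by rewrite leq_add2l.
have nM : (n <= M)%N by exact: leq_addr.
have NM : (N < M)%N by rewrite /M addnS ltnS leq_addl.
split=> [[h1 /skP sk]|[sk cl hm]].
  have H k : (forall i, (i < M)%N -> closure_arr s N i k = 0) /\ hamiltonian_arr s n N K k = 0.
    apply: evu_eq_pull; apply/eqP; rewrite -subr_eq0 -dj0_source_adjoint// h1.
    by rewrite subrr.
  split=> //; apply/funext => i; last by have [] := H i.
  apply/funext => k; have [iM|Mi] := ltnP i M; first by have [/(_ i iM)] := H k.
  exact: (@closure_arr_bounded M).
split; last exact/skP.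
apply/funext => k; apply/esym/eqP; rewrite -subr_eq0 (dj0_source_adjoint _ sk nNM) hm cl.
by rewrite fct0E raddf0 subr0 /evu big1// => i _; rewrite raddf0 mulr0.
Qed.

End Source.

(** * Euler-Lagrange expressions have self-adjoint linearization *)

Section EulerOperator.
Variable R : realType.
Local Notation en := (sfun R nat).
Local Notation jn := (sfun R (nat * nat)%type).
Local Notation sD := (svact (@eDx_sfield R)).
Local Notation dj a i := (@dpart R (nat * nat)%type (cu (a%N : nat, i%N : nat))).
Local Notation Dx := (svact (@jDx_sfield R)).
Local Notation Dt := (svact (@jDt_sfield R)).
Local Notation u a i := (@scoord R (nat * nat)%type (cu (a%N : nat, i%N : nat))).

Lemma op_jetE (s : nat -> en) n (K : en) p : bounded_by n s ->
  op_jet s (evolution K) p = source s n K p.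
Proof.
move=> sn; have E i : iter i (@jDx R) (evolution K) = u 1 i - pull (iter i sD K).
  elim: i => [|i IH]; first by apply/funext.
  have -> : u 1 i.+1 - pull (iter i.+1 sD K) = Dx (u 1 i - pull (iter i sD K)).
    by rewrite raddfB /= svact_coord Dx_pull.
  by rewrite iterS IH jDxE.
rewrite /op_jet (@fsbig_nat _ n) => [|i ni]; last by rewrite sn// mul0r.
by rewrite /source sfun_sumE; apply: eq_bigr => i _; rewrite E.
Qed.

Lemma negiter_sign (A : comPzRingType) (D : {additive A -> A}) i (v : A) :
  negiter D i v = (-1) ^+ i * iter i D v.
Proof.
elim: i => [|i IH]; first by rewrite expr0 mul1r.
rewrite negiterS IH exprS mulN1r mulNr iterS; congr (- _).
by rewrite -signr_odd; case: (odd i); rewrite ?expr1 ?mulN1r ?expr0 ?mul1r ?raddfN.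
Qed.

Lemma fsbig_nat2 (V : nmodType) n (F : nat * nat -> V) :
  (forall a i, (n <= a)%N || (n <= i)%N -> F (a, i) = 0) ->
  \sum_(ai \in [set: nat * nat]) F ai = \sum_(i < n) \sum_(a < n) F (a : nat, i : nat).
Proof.
move=> F0; rewrite (fsbigE [seq (a, i) | a <- iota 0 n, i <- iota 0 n])//=; first last.
- move=> [a i] _ /allpairsP h; apply: F0; case: (leqP n a) => //= an.
  rewrite leqNgt; apply/negP => iN.
  by apply: h; exists (a, i); rewrite !mem_iota.
- by apply: allpairs_uniq; rewrite ?iota_uniq// => -[? ?] [? ?] _ _ [-> ->].
under eq_bigl do rewrite in_setT.
have e : iota 0 n = index_iota 0 n by rewrite /index_iota subn0.
rewrite big_allpairs exchange_big e big_mkord; apply: eq_bigr => i _.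
by rewrite big_mkord.
Qed.

Lemma eulerE (L : jn) n N p : bounded2 n (fun b k => dj b k L) -> (n <= N)%N ->
  euler L p = Eul2 Dx Dt N (fun b k => dj b k L) p.
Proof.
move=> Ln nN; rewrite /euler.
have iterE (D : jn -> jn) (D' : jfun R -> jfun R) (g : jn) i :
    (forall f : jn, D' f = D f) -> iter i D' g = iter i D g.
  by move=> h; elim: i => // i IH; rewrite !iterS IH h.
have E b k : (-1) ^+ (b + k) * iter k (@jDx R) (iter b (@jDt R) (partial (cu (b, k)) L)) p =
    negiter Dx k (negiter Dt b (dj b k L)) p.
  rewrite -[partial _ _]/(sval_fun (dj b k L)) (iterE Dt) ?(iterE Dx); last 2 first.
  - exact: jDxE.
  - exact: jDtE.
  move: (dj b k L) => g; rewrite !negiter_sign.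
  have -> : iter k Dx ((-1) ^+ b * iter b Dt g) = (-1) ^+ b * iter k Dx (iter b Dt g).
    elim: k => // k IH; rewrite !iterS IH -signr_odd.
    by case: (odd b); rewrite ?expr1 ?mulN1r ?expr0 ?mul1r ?raddfN.
  rewrite mulrA -exprD sfunME addnC sfun_expE sfunNE sfun1E.
  by [].
rewrite (@fsbig_nat2 _ N).
  rewrite /Eul2 /Eul sfun_sumE; apply: eq_bigr => k _; rewrite raddf_sum sfun_sumE.
  by apply: eq_bigr => b _; rewrite /= E.
move=> b k bk; rewrite /= E Ln ?raddf0 ?raddf0//.
by case/orP: bk => h; rewrite (leq_trans nN h) ?orbT.
Qed.

Lemma jet_bound (f : jn) : exists n, bounded2 n (fun b k => dj b k f).
Proof.
have [cs _ fcs] := smooth_depends (smooth_sfun f).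
suff [n hn] : exists n, forall b k, (n <= b)%N || (n <= k)%N -> cu (b, k) \notin cs.
  by exists n => b k bk; apply: (dpart0 fcs); exact: hn.
elim: cs {fcs} => [|c cs [n IH]]; first by exists 0%N.
case: c => [||[a i]]; [by exists n => b k /IH; rewrite inE|by exists n => b k /IH; rewrite inE|].
exists (maxn n (maxn a.+1 i.+1)) => b k bk; rewrite inE negb_or IH ?andbT.
  apply/eqP => -[ba ki]; move: bk; rewrite ba ki !geq_max !ltnn /= andbF.
  by rewrite !andbF.
by case/orP: bk; rewrite geq_max => /andP[-> _]; rewrite ?orbT.
Qed.

(** The Helmholtz condition: the linearization of an Euler-Lagrange expression
    is $\sum_{I,J} (-D)^I \circ L_{IJ} D^J$, hence self-adjoint. *)
Lemma adjoint2_euler (L : jn) n N : bounded2 n (fun b k => dj b k L) -> (n + n + n < N)%N ->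
  adjoint2 Dx Dt N (dVJ (Eul2 Dx Dt N (fun b k => dj b k L))) =
  dVJ (Eul2 Dx Dt N (fun b k => dj b k L)).
Proof.
move=> Ln nN.
have -> : dVJ (Eul2 Dx Dt N (fun b k => dj b k L)) =
    Eul2 (shDx Dx) (shDt Dt) N (fun b k => dVJ (dj b k L)).
  rewrite /Eul2 (Eul_morph (DV := shDx Dx)); last exact: dVJ_Dx.
  congr Eul; apply/funext => k; rewrite (Eul_morph (DV := shDt Dt))//.
  exact: dVJ_Dt.
apply: (@adjoint2_symmetric _ _ _ _ n) => //.
- by move=> f; exact: Dx_Dt.
- by move=> b k bk; rewrite Ln// raddf0.
- by move=> b k a i ai; rewrite /dVJ dpartC Ln// raddf0.
- by move=> a i b k; rewrite /dVJ dpartC.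
Qed.

End EulerOperator.

(** * Integrals over the dilations of the fibre *)

Section UnitIntegral.
Variable R : realType.
Implicit Types (g w : R -> R).

Definition integral01 g : R := Rintegral (@lebesgue_measure R) `[0, 1] g.

Lemma integrable01 g : continuous g ->
  (@lebesgue_measure R).-integrable `[0, 1] (EFin \o g).
Proof.
move=> gc; apply: continuous_compact_integrable; first exact: segment_compact.
exact: continuous_subspaceT.
Qed.

Lemma integral01B g w : continuous g -> continuous w ->
  integral01 (fun l => g l - w l) = integral01 g - integral01 w.
Proof. by move=> gc wc; rewrite /integral01 RintegralB//; exact: integrable01. Qed.

Lemma integral01Z (r : R) g : continuous g ->
  integral01 (fun l => r * g l) = r * integral01 g.
Proof. by move=> gc; rewrite /integral01 RintegralZl//; exact: integrable01. Qed.

Lemma integral01_le g (M : R) : continuous g ->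
  (forall l, 0 <= l <= 1 -> `|g l| <= M) -> `|integral01 g| <= M.
Proof.
move=> gc gM; rewrite /integral01.
rewrite (le_trans (le_normr_Rintegral _ (integrable01 gc)))//.
have ngc : continuous (fun l => `|g l|).
  by move=> l; apply: (@continuous_comp _ _ _ g); [exact: gc|exact: norm_continuous].
have := @le_Rintegral _ _ R (@lebesgue_measure R) `[0, 1] (fun l => `|g l|) (fun=> M).
rewrite Rintegral_cst//= lebesgue_measure_itv/= lte01 oppr0 adde0 /= mulr1; apply => //.
- exact: integrable01.
- by apply: integrable01 => l; exact: cst_continuous.
Qed.

Lemma is_derive_continuous g (x v : R) : is_derive x 1 g v -> {for x, continuous g}.
Proof. by move=> [h _]; apply/differentiable_continuous/derivable1_diffP. Qed.

Lemma integral01_derive g w : continuous w -> (forall l : R, is_derive l 1 g (w l)) ->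
  integral01 w = g 1 - g 0.
Proof.
move=> wc gh; rewrite /integral01 /Rintegral (@continuous_FTC2 _ w g)//.
- exact: continuous_subspaceT.
- split; first by move=> l _; have [] := gh l.
    by apply: cvg_at_right_filter; exact: is_derive_continuous (gh 0).
  by apply: cvg_at_left_filter; exact: is_derive_continuous (gh 1).
- by move=> l _; rewrite derive1E; have [_ ->] := gh l.
Qed.

(** A quadratic remainder bound can be integrated, unlike the definition of the
    derivative; this replaces a general theorem on differentiation under the
    integral sign. *)
Lemma is_derive_quadratic g (x v M : R) : 0 <= M ->
  (forall h, `|h| <= 1 -> `|g (x + h) - g x - h * v| <= M * h ^+ 2) ->
  is_derive x 1 g v.
Proof.
move=> M0 gM.
have H : (fun h => h^-1 *: (g (h + x) - g x)) @ 0^' --> v.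
  apply/cvgrPdist_le => e e0.
  have d0 : 0 < Num.min 1 (e / (M + 1)) by rewrite lt_min ltr01 divr_gt0// ltr_wpDl.
  near=> h; have h0 : h != 0 by near: h; exact: nbhs_dnbhs_neq.
  have hd : `|h| <= Num.min 1 (e / (M + 1)).
    near: h; apply: dnbhs0_le; exact: d0.
  have h1 : `|h| <= 1 by rewrite (le_trans hd)// ge_min lexx.
  rewrite distrC -[v](mulKf h0) -[h^-1 *: _]/(h^-1 * _) -mulrBr normrM normfV addrC.
  rewrite [h + x]addrC [- (h * v) + _]addrC ler_pdivrMl ?normr_gt0//.
  rewrite (le_trans (gM h h1))// -[h ^+ 2]ger0_norm ?sqr_ge0// normrX expr2.
  rewrite mulrCA ler_wpM2l// (@le_trans _ _ ((M + 1) * `|h|))//.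
    by rewrite ler_wpM2r// lerDl.
  rewrite mulrC -ler_pdivlMr ?ltr_wpDl//.
  by rewrite (le_trans hd)// ge_min lexx orbT.
have E : (fun h => h^-1 *: (g (h + x) - g x)) = (fun h : R => h^-1 *: (g (h *: 1 + x) - g x)).
  by apply/funext => h; rewrite [h *: 1]mulr1.
apply: DeriveDef; first by apply/cvg_ex; exists v; rewrite /= -E.
by rewrite /derive; apply/cvg_lim => //; rewrite -E.
Unshelve. all: by end_near. Qed.

Lemma continuous_bigsum (I : Type) (r : seq I) (F : I -> R -> R) :
  (forall i, continuous (F i)) -> continuous (fun l => \sum_(i <- r) F i l).
Proof.
move=> Fc; elim: r => [|i r IH].
  by under eq_fun do rewrite big_nil; move=> l; exact: cst_continuous.
under eq_fun do rewrite big_cons; move=> l.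
by apply: (@cvgD R R); [exact: Fc|exact: IH].
Qed.

End UnitIntegral.

Section Homotopy.
Variables (R : realType) (A : choiceType).
Implicit Types (f g : (jcoord A -> R) -> R) (p q : jcoord A -> R) (c : jcoord A).

Definition dil (l : R) p : jcoord A -> R :=
  fun c => match c with cu a => l * p (cu a) | _ => p c end.

(** The degree of homogeneity of a coordinate under [dil]. *)
Definition weight c : nat := if c is cu _ then 1%N else 0%N.

Lemma dilE l p c : dil l p c = l ^+ weight c * p c.
Proof. by case: c => [||a] /=; rewrite ?expr0 ?expr1 ?mul1r. Qed.

Lemma dil1 p : dil 1 p = p.
Proof. by apply/funext => c; rewrite dilE expr1n mul1r. Qed.

Lemma dil_diff l h p c : dil (l + h) p c - dil l p c = h * ((weight c)%:R * p c).
Proof. by case: c => [||a] /=; rewrite ?subrr ?mul0r ?mulr0// mul1r; ring. Qed.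

Lemma is_derive_dil f cs p (l : R) : uniq cs -> smooth f -> depends_on cs f ->
  is_derive l 1 (fun l => f (dil l p))
    (\sum_(c <- cs) partial c f (dil l p) * ((weight c)%:R * p c)).
Proof.
move=> ucs sf fcs.
have [M M0 hM] := smooth_Taylor (fun c => (`|l| + 1) * `|p c| + `|p c|) ucs sf fcs.
pose S := \sum_(c <- cs) `|(weight c)%:R * p c|.
have box h : `|h| <= 1 -> in_box (fun c => (`|l| + 1) * `|p c| + `|p c|) (dil (l + h) p).
  move=> h1 c; case: c => [||a] /=; rewrite ?lerDr ?mulr_ge0 ?addr_ge0//.
  rewrite normrM (@le_trans _ _ ((`|l| + 1) * `|p (cu a)|))//; last by rewrite lerDl.
  by rewrite ler_wpM2r// (le_trans (ler_normD _ _))// lerD2l.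
apply: (@is_derive_quadratic _ _ _ _ (M * S ^+ 2)); first by rewrite mulr_ge0// sqr_ge0.
move=> h h1; have := hM (dil l p) (dil (l + h) p) _ (box h h1).
rewrite mulr_sumr; under eq_bigr do rewrite dil_diff.
under [in X in _ -> X]eq_bigr do rewrite mulrCA.
move=> /(_ _)/le_trans; apply.
  by have := box 0; rewrite addr0 normr0; apply.
have -> : dist1 cs (dil l p) (dil (l + h) p) = `|h| * S.
  by rewrite /dist1 /S mulr_sumr; apply: eq_bigr => c _; rewrite dil_diff normrM.
rewrite exprMn real_normK ?num_real//.
by rewrite (_ : M * (h ^+ 2 * S ^+ 2) = M * S ^+ 2 * h ^+ 2)//; ring.
Qed.

Lemma continuous_dil f k p : smooth f -> continuous (fun l : R => l ^+ k * f (dil l p)).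
Proof.
move=> sf l; have [cs ucs fcs] := smooth_depends sf.
apply: (@cvgM R R (nbhs l)).
  exact: exprn_continuous.
exact: is_derive_continuous (is_derive_dil p l ucs sf fcs).
Qed.

(** The powers of l are needed because each derivative in a fibre coordinate
    produces a factor l: with them the class is closed under partial
    derivatives. *)
Definition dil_integral k f : (jcoord A -> R) -> R :=
  fun p => integral01 (fun l => l ^+ k * f (dil l p)).

Lemma normr01 (l : R) k : 0 <= l <= 1 -> `|l ^+ k| <= 1.
Proof. by move=> /andP[l0 l1]; rewrite normrX ger0_norm// exprn_ile1. Qed.

Lemma dil_box (l : R) p B : 0 <= l <= 1 -> in_box B p -> in_box B (dil l p).
Proof.
move=> l01 pB c; rewrite dilE normrM (le_trans _ (pB c))// ler_piMl//.
exact: normr01.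
Qed.

(** The Taylor bound is uniform on the box around p, and dilations by l in [0, 1]
    preserve boxes, so the remainder integrates to a quadratic one. *)
Lemma dil_integral_partial k f c : smooth f ->
  has_partial c (dil_integral k f) /\
  partial c (dil_integral k f) = dil_integral (k + weight c) (partial c f).
Proof.
move=> sf; apply: has_partial_of => p; have [cs ucs fcs] := smooth_depends sf.
have [M M0 hM] := smooth_Taylor (fun c => `|p c| + 1) ucs sf fcs.
apply: (@is_derive_quadratic _ _ _ _ (M * 1)); first by rewrite mulr1.
move=> h h1; rewrite dfwith_id.
pose q := dfwith p c (p c + h).
have qc d : q d - p d = (c == d)%:R * h.
  rewrite /q; have [<-|cd] := eqVneq c d; first by rewrite dfwithin mul1r addrC addKr.
  by rewrite dfwithout// subrr mul0r.
have pB : in_box (fun c => `|p c| + 1) p by move=> d; rewrite lerDl.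
have qB : in_box (fun c => `|p c| + 1) q.
  move=> d; rewrite -[q d](subrK (p d)) addrC qc (le_trans (ler_normD _ _))// lerD2l.
  by case: (c == d); rewrite ?mul1r// mul0r normr0.
have sc := smooth_partial c sf.
rewrite /dil_integral -integral01B; [|exact: continuous_dil|exact: continuous_dil].
rewrite -integral01Z; last exact: continuous_dil.
rewrite -integral01B; first last.
- by move=> l; apply: (@cvgM R R (nbhs l)); [exact: cvg_cst|exact: continuous_dil].
- by move=> l; apply: (@cvgB R R); exact: continuous_dil.
apply: integral01_le.
  move=> l; apply: (@cvgB R R); first by apply: (@cvgB R R); exact: continuous_dil.
  by apply: (@cvgM R R (nbhs l)); [exact: cvg_cst|exact: continuous_dil].
move=> l l01; have := hM (dil l p) (dil l q) (dil_box l01 pB) (dil_box l01 qB).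
have dq d : dil l q d - dil l p d = l ^+ weight d * ((c == d)%:R * h).
  by rewrite !dilE -mulrBr qc.
have -> : \sum_(d <- cs) partial d f (dil l p) * (dil l q d - dil l p d) =
    l ^+ weight c * partial c f (dil l p) * h.
  under eq_bigr do rewrite dq.
  have [ccs|ccs] := boolP (c \in cs).
    rewrite (bigD1_seq _ ccs ucs)/= eqxx mul1r big1 ?addr0; first by ring.
    by move=> d /negPf; rewrite eq_sym => ->; rewrite mul0r !mulr0.
  rewrite (depends_on_partial0 fcs ccs) mulr0 mul0r big_seq big1// => d dcs.
  by case: eqP => [cd|]; rewrite ?mul0r ?mulr0//; move: ccs; rewrite cd dcs.
have d1 : dist1 cs (dil l p) (dil l q) <= `|h|.
  rewrite /dist1; under eq_bigr do rewrite dq.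
  have [ccs|ccs] := boolP (c \in cs).
    rewrite (bigD1_seq _ ccs ucs)/= eqxx mul1r big1 ?addr0; last first.
      by move=> d /negPf; rewrite eq_sym => ->; rewrite mul0r mulr0 normr0.
    by rewrite normrM ler_piMl// normr01.
  rewrite big_seq big1// => d dcs.
  by case: eqP => [cd|]; rewrite ?mul0r ?mulr0 ?normr0//; move: ccs; rewrite cd dcs.
move=> H; rewrite exprD.
have -> : l ^+ k * f (dil l q) - l ^+ k * f (dil l p) -
    h * (l ^+ k * l ^+ weight c * partial c f (dil l p)) =
    l ^+ k * (f (dil l q) - f (dil l p) - l ^+ weight c * partial c f (dil l p) * h) by ring.
rewrite normrM (le_trans (ler_piMl _ (normr01 k l01)))// (le_trans H)// mulr1.
rewrite ler_wpM2l// -[h ^+ 2]ger0_norm ?sqr_ge0// normrX lerXn2r// nnegrE ?dist1_ge0//.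
Qed.

Lemma dil_integral_depends cs k f : depends_on cs f -> depends_on cs (dil_integral k f).
Proof.
move=> fcs p q pq; rewrite /dil_integral; congr integral01; apply/funext => l.
by congr (_ * _); apply: fcs => c ccs; rewrite !dilE pq.
Qed.

Lemma smooth_dil_integral k f : smooth f -> smooth (dil_integral k f).
Proof.
pose P g := exists k f, smooth f /\ g = dil_integral k f.
move=> sf; apply: (@smooth_coind _ _ P); last by exists k, f.
move=> g [{sf}k' [f' [sf ->]]]; have [cs ucs fcs] := smooth_depends sf.
split; first by exists cs; exact: dil_integral_depends.
- apply: (locally_Lipschitz_continuous (dil_integral_depends k' fcs)) => p.
  have [M M0 hM] := smooth_Lipschitz (fun c => `|p c| + 1) ucs sf fcs.
  exists M => // q qp.
  have pB : in_box (fun c => `|p c| + 1) p by move=> d; rewrite lerDl.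
  have qB : in_box (fun c => `|p c| + 1) q.
    by move=> d; rewrite -[q d](subrK (p d)) addrC (le_trans (ler_normD _ _))// lerD2l.
  rewrite /dil_integral -integral01B; [|exact: continuous_dil|exact: continuous_dil].
  apply: integral01_le; first by move=> l; apply: (@cvgB R R); exact: continuous_dil.
  move=> l l01; rewrite -mulrBr normrM (le_trans (ler_piMl _ (normr01 k' l01)))//.
  rewrite (le_trans (hM _ _ (dil_box l01 pB) (dil_box l01 qB)))// ler_wpM2l//.
  apply: ler_sum => c _; rewrite !dilE -mulrBr normrM ler_piMl//; exact: normr01.
- move=> c; have [h ->] := dil_integral_partial k' c sf; split=> //.
  by exists (k' + weight c)%N, (partial c f'); split=> //; exact: smooth_partial.
Qed.

(** The integrand is the derivative of l f(dil l p), which takes the values 0 and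
    f p at the ends. *)
Lemma dil_integral_homotopy f cs p : uniq cs -> smooth f -> depends_on cs f ->
  integral01 (fun l => f (dil l p) +
    l * \sum_(c <- cs) partial c f (dil l p) * ((weight c)%:R * p c)) = f p.
Proof.
move=> ucs sf fcs; set w := (X in integral01 X).
have cdil g : smooth g -> continuous (fun l : R => g (dil l p)).
  move=> sg; rewrite (_ : (fun l => _) = fun l => l ^+ 0 * g (dil l p)).
    exact: continuous_dil.
  by apply/funext => l; rewrite expr0 mul1r.
have wc : continuous w.
  move=> l; apply: (@cvgD R R); first exact: cdil.
  apply: (@cvgM R R (nbhs l)); first exact: cvg_id.
  move: l; apply: continuous_bigsum => c l.
  apply: (@cvgM R R (nbhs l)); last exact: cvg_cst.
  exact/cdil/smooth_partial.
have wd (l : R) : is_derive l 1 (fun l => l * f (dil l p)) (w l).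
  have h := is_derive_dil p l ucs sf fcs.
  apply: (is_derive_eq (is_deriveM (is_derive_id l 1) h)).
  by rewrite addrC /GRing.scale /= mulr1.
by rewrite (integral01_derive wc wd) mul1r mul0r subr0 dil1.
Qed.

End Homotopy.

(** * The homotopy Lagrangian *)

Section Lagrangian.
Variable R : realType.
Local Notation jn := (sfun R (nat * nat)%type).
Local Notation dj a i := (@dpart R (nat * nat)%type (cu (a%N : nat, i%N : nat))).
Local Notation Dx := (svact (@jDx_sfield R)).
Local Notation Dt := (svact (@jDt_sfield R)).
Local Notation u a i := (@scoord R (nat * nat)%type (cu (a%N : nat, i%N : nat))).

Definition sdil_integral k (f : jn) : jn := to_sfun (smooth_dil_integral k (smooth_sfun f)).

Arguments sdil_integral k%_N f.

Lemma continuous_dil_jn k (f : jn) p : continuous (fun l : R => l ^+ k * f (dil l p)).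
Proof. exact/continuous_dil/smooth_sfun. Qed.

Lemma sdil_integral_is_zmod_morphism k : zmod_morphism (sdil_integral k).
Proof.
move=> f g; apply: sfunP => p.
rewrite sfunDE sfunNE /= /dil_integral -integral01B; [|exact: continuous_dil_jn|exact: continuous_dil_jn].
by congr integral01; apply/funext => l; rewrite mulrBr.
Qed.
HB.instance Definition _ k := GRing.isZmodMorphism.Build jn jn (sdil_integral k) (sdil_integral_is_zmod_morphism k).

Lemma dpart_sdil_integral k c f : dpart c (sdil_integral k f) = sdil_integral (k + weight c) (dpart c f).
Proof.
by apply: sfunP => p /=; have [_ ->] := dil_integral_partial k c (smooth_sfun f).
Qed.

(** Homogeneous factors can be moved under the integral sign. *)
Lemma mul_sdil_integral k w (h g : jn) : (forall l p, h (dil l p) = l ^+ w * h p) ->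
  h * sdil_integral (k + w) g = sdil_integral k (h * g).
Proof.
move=> hw; apply: sfunP => p; rewrite sfunME /= /dil_integral -integral01Z; last exact: continuous_dil_jn.
by congr integral01; apply/funext => l; rewrite -[X in _ = _ * X]/(h (dil l p) * g (dil l p)) hw exprD; ring.
Qed.

(** Vector fields that are homogeneous under the dilations, such as D_x and D_t,
    commute with the integration over dilations. *)
Lemma svact_sdil_integral (X : jcoord (nat * nat) -> jn) (f : jn) : (forall c l p, X c (dil l p) = l ^+ weight c * X c p) ->
  svact X (sdil_integral 0 f) = sdil_integral 0 (svact X f).
Proof.
move=> hX; have [cs ucs fcs] := smooth_depends (smooth_sfun f).
rewrite (svactE X ucs); last exact: dil_integral_depends.
rewrite (svactE X ucs fcs) raddf_sum; apply: eq_bigr => c _ /=.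
by rewrite dpart_sdil_integral add0n -{1}[weight c]add0n mul_sdil_integral.
Qed.

Lemma Dx_sdil_integral (f : jn) : Dx (sdil_integral 0 f) = sdil_integral 0 (Dx f).
Proof.
by apply: svact_sdil_integral => -[||[a i]] l p /=; rewrite ?expr0 ?mul1r// mulr0.
Qed.

Lemma Dt_sdil_integral (f : jn) : Dt (sdil_integral 0 f) = sdil_integral 0 (Dt f).
Proof.
by apply: svact_sdil_integral => -[||[a i]] l p /=; rewrite ?expr0 ?mul1r// mulr0.
Qed.

Lemma iter_Dx_u a i : iter i Dx (u a 0) = u a i.
Proof. by elim: i => // i IH; rewrite iterS IH svact_coord. Qed.

Lemma iter_Dt_u a i : iter a Dt (u 0 i) = u a i.
Proof. by elim: a => // a IH; rewrite iterS IH svact_coord. Qed.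

(** The operator with coefficients w applied to u. *)
Definition ev_u M (w : nat -> nat -> jn) : jn := \sum_(a < M) \sum_(i < M) w a i * u a i.

Lemma ev_u_is_zmod_morphism M : zmod_morphism (ev_u M).
Proof.
move=> v w; rewrite /ev_u -sumrB; apply: eq_bigr => a _; rewrite -sumrB.
by apply: eq_bigr => i _; rewrite !fctBE mulrBl.
Qed.
HB.instance Definition _ M := GRing.isZmodMorphism.Build (nat -> nat -> jn) jn (ev_u M)
  (ev_u_is_zmod_morphism M).

Lemma ev_uEx M w : ev_u M w = \sum_(a < M) ev Dx M (u a 0) (w a).
Proof.
by apply: eq_bigr => a _; apply: eq_bigr => i _; rewrite iter_Dx_u.
Qed.

Lemma ev_uEt M w : ev_u M w = \sum_(i < M) ev Dt M (u 0 i) (fun a => w a i).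
Proof.
rewrite /ev_u exchange_big; apply: eq_bigr => i _; apply: eq_bigr => a _ /=.
by rewrite iter_Dt_u.
Qed.

Lemma ev_u_shDx m M w : bounded2 m w -> (m < M)%N -> ev_u M (shDx Dx w) = Dx (ev_u M w).
Proof.
move=> wm mM; rewrite !ev_uEx raddf_sum; apply: eq_bigr => a _ /=.
rewrite -(@ev_shD _ Dx (@svactM _ _ _) m)// => i mi; apply: wm; by rewrite mi orbT.
Qed.

Lemma ev_u_shDt m M w : bounded2 m w -> (m < M)%N -> ev_u M (shDt Dt w) = Dt (ev_u M w).
Proof.
move=> wm mM; rewrite !ev_uEt raddf_sum; apply: eq_bigr => i _ /=.
rewrite -(@ev_shD _ Dt (@svactM _ _ _) m)//; last by move=> a ma; apply: wm; rewrite ma.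
by congr ev; apply/funext => a; rewrite shDtE /shD; case: a.
Qed.

Lemma ev_u_negiter m M w a i : bounded2 m w -> (m + a + i <= M)%N ->
  ev_u M (negiter (shDx Dx) i (negiter (shDt Dt) a w)) = negiter Dx i (negiter Dt a (ev_u M w)).
Proof.
move=> wm; elim: i => [|i IH] mM; last first.
  rewrite !negiterS raddfN /= (@ev_u_shDx (m + a + i)) ?IH//; [lia| |lia].
  exact/bounded2_negiterx/bounded2_negitert.
rewrite addn0 in mM; rewrite /=; elim: a mM => // a IH mM.
rewrite !negiterS raddfN /= (@ev_u_shDt (m + a)) ?IH//; [lia| |lia].
exact: bounded2_negitert.
Qed.

(** Applying an adjoint operator to u: its value is the Euler expression of u w,
    which appears when a Lagrangian u G is varied. *)
Lemma ev_u_adjoint2 N M (w : nat -> nat -> jn) : (0 < N)%N -> (N + N <= M)%N ->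
  ev_u M (adjoint2 Dx Dt N w) = Eul2 Dx Dt N (fun b k => u 0 0 * w b k).
Proof.
move=> N0 NM; rewrite /adjoint2 /Eul2 /Eul raddf_sum; apply: eq_bigr => k _.
rewrite !raddf_sum; apply: eq_bigr => b _ /=.
rewrite (@ev_u_negiter 1).
- congr (negiter _ _ (negiter _ _ _)); rewrite /ev_u.
  have M0 : (0 < M)%N by lia.
  case: M M0 {NM} => // M _; rewrite big_ord_recl big_ord_recl /= /etens /=.
  by rewrite big1 ?big1 ?addr0 1?mulrC// => i _; rewrite ?big1 ?mul0r// => j _; rewrite fct0E mul0r.
- by move=> [|a] [|i]//= _; rewrite /etens /= ?fct0E.
- have := ltn_ord k; have := ltn_ord b; lia.
Qed.

Definition jcoords n : seq (jcoord (nat * nat)) :=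
  ct :: cx :: [seq cu ai | ai <- [seq (a, i) | a <- iota 0 n, i <- iota 0 n]].

Lemma uniq_jcoords n : uniq (jcoords n).
Proof.
rewrite /= inE negb_or /=; apply/and3P; split; [|by apply/mapP => -[]|].
  by apply/mapP => -[].
rewrite map_inj_uniq; last by move=> ? ? [].
by apply: allpairs_uniq; rewrite ?iota_uniq// => -[? ?] [? ?] _ _ [-> ->].
Qed.

Lemma mem_jcoords n a i : (cu (a, i) \in jcoords n) = (a < n)%N && (i < n)%N.
Proof.
rewrite /jcoords !inE /= mem_map; last by move=> ? ? [].
by apply/allpairsP/andP => [[[b j] [/= + + [-> ->]]]|[an iN]]; rewrite ?mem_iota//; exists (a, i); rewrite !mem_iota.
Qed.

Lemma depends_on_jcoords (f : jn) : exists n, forall k, (n <= k)%N -> depends_on (jcoords k) f.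
Proof.
have [cs _ fcs] := smooth_depends (smooth_sfun f).
suff [n hn] : exists n, forall k, (n <= k)%N -> {subset cs <= jcoords k}.
  by exists n => k nk; apply: depends_on_sub fcs; exact: hn.
elim: cs {fcs} => [|c cs [n IH]]; first by exists 0%N.
exists (maxn n (if c is cu ai then maxn ai.1.+1 ai.2.+1 else 0%N)) => k.
rewrite geq_max => /andP[/IH nk ck] d; rewrite inE => /predU1P[->|/nk//].
by case: c ck => [||[a i]] //=; rewrite mem_jcoords geq_max.
Qed.

Lemma big_jcoords (V : zmodType) n (F : jcoord (nat * nat) -> V) :
  \sum_(c <- jcoords n) F c = F ct + F cx + \sum_(a < n) \sum_(i < n) F (cu (a : nat, i : nat)).
Proof.
rewrite !big_cons addrA big_map big_allpairs.
have e : iota 0 n = index_iota 0 n by rewrite /index_iota subn0.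
by rewrite e big_mkord; congr (_ + _); apply: eq_bigr => a _; rewrite big_mkord.
Qed.

(** The Lagrangian is $L = u \int_0^1 F(\lambda u)\, d\lambda$. Varying the factor
    u gives the integral itself; varying F gives the adjoint of its linearization
    applied to u, hence by self-adjointness the linearization applied to u. The
    two together are the integral of the derivative of
    $\lambda F(\lambda u)$. *)
Lemma homotopy_lagrangian (F : jn) n N : (0 < n)%N -> depends_on (jcoords n) F ->
  (n < N)%N -> adjoint2 Dx Dt N (dVJ F) = dVJ F ->
  exists L : jn, forall p, euler L p = F p.
Proof.
move=> n0 Fn nN FA; exists (u 0 0 * sdil_integral 0 F) => p.
have hu l q : u 0 0 (dil l q) = l ^+ 1 * u 0 0 q :> R by rewrite /= expr1.
have F0 b k : (n <= b)%N || (n <= k)%N -> dj b k F = 0.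
  by move=> bk; apply: (dpart0 Fn); rewrite mem_jcoords negb_and -!leqNgt.
have dL b k : dj b k (u 0 0 * sdil_integral 0 F) =
    (if (b == 0%N) && (k == 0%N) then sdil_integral 0 F else 0) + sdil_integral 0 (u 0 0 * dj b k F).
  rewrite dpartM dpart_coord cu_eq dpart_sdil_integral -(mul_sdil_integral 0%N (dj b k F) hu); congr (_ + _).
  by case: andP => _; rewrite ?mul1r ?mul0r.
rewrite (@eulerE _ _ n N) ?(ltnW nN)//; last first.
  move=> b k bk; rewrite dL F0// mulr0 raddf0 addr0.
  by case: b k bk => [|b] [|k]//; rewrite leqNgt n0.
have -> : (fun b k => dj b k (u 0 0 * sdil_integral 0 F)) =
   (fun b k => if (b == 0%N) && (k == 0%N) then sdil_integral 0 F else 0) +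
   (fun b k => sdil_integral 0 (u 0 0 * dj b k F)).
  by apply/funext => b; apply/funext => k; rewrite dL.
rewrite raddfD /=.
have N0 : (0 < N)%N by exact: leq_ltn_trans nN.
have -> : Eul2 Dx Dt N (fun b k => if (b == 0%N) && (k == 0%N) then sdil_integral 0 F else 0) = sdil_integral 0 F.
  rewrite /Eul2 -[RHS](Eul_e0 Dx _ N0); congr Eul; apply/funext => k.
  case: eqP => _; last by rewrite -[RHS](raddf0 (Eul Dt N)); congr Eul; apply/funext => b; rewrite andbF.
  by rewrite -[RHS](Eul_e0 Dt _ N0); congr Eul; apply/funext => b; rewrite andbT.
have -> : Eul2 Dx Dt N (fun b k => sdil_integral 0 (u 0 0 * dj b k F)) =
    sdil_integral 0 (Eul2 Dx Dt N (fun b k => u 0 0 * dj b k F)).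
  rewrite /Eul2 (Eul_morph (DV := Dx)); last by move=> f; exact/esym/Dx_sdil_integral.
  congr Eul; apply/funext => k; rewrite (Eul_morph (DV := Dt))//.
  by move=> f; exact/esym/Dt_sdil_integral.
rewrite -(ev_u_adjoint2 (M := (N + N)%N) _ N0 (leqnn _)) FA.
transitivity (sdil_integral 0 (F + ev_u (N + N) (dVJ F)) p); first by rewrite (raddfD (sdil_integral 0)).
rewrite -[RHS](dil_integral_homotopy p (uniq_jcoords n) (smooth_sfun F) Fn) /dil_integral.
congr integral01; apply/funext => l; rewrite expr0 mul1r.
rewrite -[LHS]/(F (dil l p) + ev_u (N + N)%N (dVJ F) (dil l p)); congr (_ + _).
rewrite big_jcoords !mul0r !mulr0 !add0r.
have -> : ev_u (N + N) (dVJ F) = ev_u n (dVJ F).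
  have nNN : (n <= N + N)%N by lia.
  rewrite /ev_u (@sum_bounded _ n (N + N) (fun a => \sum_(i < N + N) dVJ F a i * u a i))//.
    apply: eq_bigr => a _.
    rewrite (@sum_bounded _ n (N + N) (fun i => dVJ F a i * u a i))// => i ni.
    by rewrite /dVJ F0 ?mul0r// ni orbT.
  by move=> a na; rewrite big1// => i _; rewrite /dVJ F0 ?mul0r// na.
rewrite /ev_u sfun_sumE mulr_sumr; apply: eq_bigr => a _.
rewrite sfun_sumE mulr_sumr; apply: eq_bigr => i _.
by rewrite sfunME /= mul1r mulrCA.
Qed.

End Lagrangian.

(** * The equivalence *)

Section Bounds.
Variable R : realType.
Local Notation en := (sfun R nat).
Local Notation du i := (@dpart R nat (cu (i : nat))).

Lemma du_family_bound m (fs : nat -> en) :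
  exists n, forall i j, (i < m)%N -> (n <= j)%N -> du j (fs i) = 0.
Proof.
elim: m => [|m [n IH]]; first by exists 0%N.
have [k fk] := depends_on_coords (fs m).
exists (maxn n k) => i j; rewrite ltnS leq_eqVlt geq_max => /orP[/eqP ->|im] /andP[nj kj].
  exact: (du_coords fk).
exact: IH.
Qed.

End Bounds.

Theorem theorem1p2 (R : realType) (n : nat) (K : efun R) (s : nat -> efun R)
  (hn : (2 <= n)%N)
  (K_smooth : smooth K)
  (K_order : depends_on (ct :: cx :: [seq cu i | i <- iota 0 n.+1]) K)
  (K_n : forall p, partial (cu n) K p <> 0)
  (s_diffop : diffop s)
  (s_neq0 : exists i p, s i p <> 0) :
  symplectic s /\ symplectic_hamiltonian K s <->
  variational_operator s (evolution K).
Proof.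
case: s_diffop => [s_smooth [m0 s0]].
pose S i : sfun R nat := to_sfun (s_smooth i).
pose k : sfun R nat := to_sfun K_smooth.
have Sm : bounded_by m0.+1 S by move=> i mi; apply: sfunP => p; exact: s0.
have [n1 dS] := du_family_bound m0.+1 S.
have [n2 dK] := du_family_bound m0.+1 (fun i => iter i (svact (@eDx_sfield R)) k).
have op_source N p : (m0 < N)%N -> op_jet s (evolution K) p = source S N k p.
  by move=> mN; rewrite -(op_jetE k p (bounded_byW mN Sm)).
(* The bound n' has to dominate the orders of all functions involved; it is
   kept free here since a given Lagrangian enlarges it. The range of
   summation exceeds 3 n' as [Eul2_Eul2] requires. *)
have all_bounds n' : (n1 <= n')%N -> (n2 <= n')%N -> (m0 < n')%N ->
    symplectic s /\ symplectic_hamiltonian K s <->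
    adjoint2 (svact (@jDx_sfield R)) (svact (@jDt_sfield R)) (n' + n' + n').+1
      (dVJ (source S n' k)) = dVJ (source S n' k).
  move=> n1n n2n mn.
  have nN : (n' + n' < (n' + n' + n').+1)%N by rewrite ltnS leq_addr.
  have dSn i j : (n' <= j)%N -> dpart (cu j) (S i) = 0.
    move=> nj; have [im|mi] := ltnP i m0.+1; last by rewrite Sm// raddf0.
    by apply: dS => //; exact: leq_trans nj.
  have dKn i j : (i < m0.+1)%N -> (n' <= j)%N ->
      dpart (cu j) (iter i (svact (@eDx_sfield R)) k) = 0.
    by move=> im nj; apply: dK => //; exact: leq_trans nj.
  have n'0 : (0 < n')%N by exact: leq_ltn_trans mn.
  have := symplectic_hamiltonianP Sm (ltn0Sn m0) mn dSn dKn nN s_neq0.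
  by rewrite (adjoint2_sourceP k (bounded_byW mn Sm) n'0 dSn nN).
split=> [sh|[L [L_smooth EL]]].
  have [n3 Fn] := depends_on_jcoords (source S m0.+1 k).
  pose n' := maxn m0.+1 (maxn n1 (maxn n2 n3)).
  have [mn n1n n2n n3n] : [/\ (m0 < n')%N, (n1 <= n')%N, (n2 <= n')%N & (n3 <= n')%N].
    by rewrite /n' !leq_max !leqnn !orbT.
  have Fn' : depends_on (jcoords n') (source S n' k).
    have -> : source S n' k = source S m0.+1 k.
      by apply: sfunP => p; rewrite -!op_source.
    exact: Fn.
  have nN : (n' < (n' + n' + n').+1)%N by rewrite ltnS -addnA leq_addr.
  have [L EL] := homotopy_lagrangian (leq_ltn_trans (leq0n m0) mn) Fn' nN
    ((all_bounds n' n1n n2n mn).1 sh).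
  exists L; split; first exact: smooth_sfun.
  by move=> p; rewrite EL (op_source n').
pose l := to_sfun L_smooth.
have [n3 Ln] := jet_bound l.
pose n' := maxn m0.+1 (maxn n1 (maxn n2 n3)).
have [mn n1n n2n n3n] : [/\ (m0 < n')%N, (n1 <= n')%N, (n2 <= n')%N & (n3 <= n')%N].
  by rewrite /n' !leq_max !leqnn !orbT.
apply/(all_bounds n' n1n n2n mn).
have Ln' : bounded2 n' (fun b i => dpart (cu (b, i)) l).
  by move=> b i bi; apply: Ln; case/orP: bi => h; rewrite (leq_trans n3n h) ?orbT.
have nN : (n' <= (n' + n' + n').+1)%N by rewrite -addnA ltnW// ltnS leq_addr.
have -> : source S n' k = Eul2 (svact (@jDx_sfield R)) (svact (@jDt_sfield R)) (n' + n' + n').+1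
    (fun b i => dpart (cu (b, i)) l).
  by apply: sfunP => p; rewrite -(eulerE p Ln' nN) -EL (op_source n').
exact: (adjoint2_euler Ln' (ltnSn _)).
Qed.
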